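(* Let $\mathcal{B}$ be an oriented finite 2-dimensional CW complex, with $1$-skeleton $\mathcal{B}^{(1)}$, boundary graph $\mathcal{B}_\partial$, and algebra $C^*(\mathcal{B})=C^*(\mathcal{B}^{(1)})\otimes C^*(\mathcal{B}_\partial)$, and let $\mathcal{M}_{\mathcal{B}}\subset C^*(\mathcal{B})$ be the linear span of the elements $S_\mu S_\nu^* S_\Omega S_\Lambda^*$, where $\mu,\nu$ are oriented paths in $\mathcal{B}^{(1)}$ with $r(\mu)=r(\nu)$ and $\Omega,\Lambda$ are oriented paths in $\mathcal{B}_\partial$ with $\partial r(\Omega)=\partial r(\Lambda)$. (1) Let $(g,\tilde\lambda,\lambda,\eta)$ be a rank 2 graph weight on $\mathcal{B}$ such that $g,\tilde\lambda,\lambda,\eta$ are nowhere vanishing. Then setting $$\psi(S_\mu S_\nu^* S_\Omega S_\Lambda^* )=\delta_{\mu,\nu}\,\delta_{\Omega,\Lambda}\;\tilde\lambda(e_1)\cdots\tilde\lambda(e_n)\,g(r(e_n))\;\eta(\sigma_1)\cdots\eta(\sigma_m)\,\lambda(a_m'),$$ where $\mu=e_1\cdots e_n$, $\Omega=(\sigma_1,a_1)\cdots(\sigma_m,a_m)$ and $a_m'$ is the edge following $a_m$ in $\nu(\sigma_m)$, uniquely defines a weight $\psi:\mathcal{M}_{\mathcal{B}}\to\mathbb{C}$ which is gauge invariant and satisfies the KMS condition with respect to the time evolution determined by $\sigma_t(S_e)=\tilde\lambda(e)^{it}S_e$ and $\sigma_t(S_{\sigma,e})=\eta(\sigma)^{it}S_{\sigma,e}$.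 (2) Conversely, let $\psi:\mathcal{M}_{\mathcal{B}}\to\mathbb{C}$ be a faithful gauge invariant weight such that the ratio $\psi(S_{\sigma,e}S_{\sigma,e}^* )/\psi(S_{\sigma,e}^*S_{\sigma,e})$ depends only on $\sigma$ and not on the chosen (appearance of an) edge $e$ in $\nu(\sigma)$. Then setting $$g(v)=\psi(P_v),\qquad \tilde\lambda(e)=\frac{\psi(S_eS_e^* )}{\psi(S_e^*S_e)},\qquad \lambda(e)=\psi(P_e),\qquad \eta(\sigma)=\frac{\psi(S_{\sigma,e}S_{\sigma,e}^* )}{\psi(S_{\sigma,e}^*S_{\sigma,e})}$$ determines a rank 2 graph weight on $\mathcal{B}$ with $g,\tilde\lambda,\lambda,\eta$ nowhere vanishing.
   Context: **Oriented complexes.** A finite 2-dimensional CW complex $\mathcal{B}$ with sets of cells $\mathcal{B}^0,\mathcal{B}^1,\mathcal{B}^2$ is oriented if its $1$-skeleton $\mathcal{B}^{(1)}$ is a directed graph with range and source maps $r,s:\mathcal{B}^1\to\mathcal{B}^0$, and there is a map $\nu$ assigning to each face $\sigma\in\mathcal{B}^2$ a cyclic word $\nu(\sigma)=(e_1,\dots,e_n)$ of edges (a tuple modulo cyclic permutation) with $r(e_i)=s(e_{i+1})$ for $i\in\mathbb{Z}/n\mathbb{Z}$. **Boundary graph.** $\mathcal{B}_\partial$ is the directed graph with vertex set $\mathcal{B}^1$ and with one edge from $e$ to $e'$ for each instance, over all $\sigma\in\mathcal{B}^2$, in which $e'$ follows $e$ in $\nu(\sigma)$. Its edges are denoted $(\sigma,e)$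 (one for each appearance of $e$ in $\nu(\sigma)$), with source $\partial s(\sigma,e)=e$ and range $\partial r(\sigma,e)=e'$, the edge following that appearance of $e$ in $\nu(\sigma)$. **Rank 2 graph weights.** A graph weight on a finite directed graph $E=(E^0,E^1,s,r)$ is a pair of nonnegative real functions $(g,\lambda)$ on $E^0$ and $E^1$ with $g(v)=\sum_{s(e)=v}\lambda(e)g(r(e))$ for every $v\in E^0$ that is not a sink. A rank 2 graph weight on $\mathcal{B}$ is a quadruple $(g,\tilde\lambda,\lambda,\eta)$ of nonnegative real functions on $\mathcal{B}^0,\mathcal{B}^1,\mathcal{B}^1,\mathcal{B}^2$ respectively, such that $(g,\tilde\lambda)$ is a graph weight on $\mathcal{B}^{(1)}$ and $(\lambda,\eta)$ is a graph weight on $\mathcal{B}_\partial$ (with $\eta$ giving the edge $(\sigma,e)$ the value $\eta(\sigma)$); that is, $g(v)=\sum_{s(e)=v}\tilde\lambda(e)g(r(e))$ and $\lambda(e)=\sum\eta(\sigma)\lambda(e')$, the second sum being over all $\sigma$ and all appearances of $e$ in $\nu(\sigma)$, with $e'$ the edge following that appearance. **Algebras.** The graph $C^*$-algebra $C^*(E)$ of a finite directed graph $E$ is the universal $C^*$-algebra generated by mutually orthogonal projections $P_v$ ($v\in E^0$) and partial isometries $S_e$ ($e\in E^1$) with $S_e^*S_e=P_{r(e)}$ for all $e$ and $P_v=\sum_{s(e)=v}S_eS_e^*$ for every $v$ that is not a sink. In $C^*(\mathcal{B})=C^*(\mathcal{B}^{(1)})\otimes C^*(\mathcal{B}_\partial)$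 the generators of the first factor are written $P_v,S_e$ and those of the second $P_e,S_{\sigma,e}$ (so $S_{\sigma,e}^*S_{\sigma,e}=P_{e'}$); elements of each factor are identified with their images under tensoring with the unit of the other factor. For an oriented path $\mu=e_1\cdots e_n$ (with $r(e_i)=s(e_{i+1})$), $S_\mu=S_{e_1}\cdots S_{e_n}$ and $r(\mu)=r(e_n)$; paths of length zero (vertices $v$) are allowed, with $S_v=P_v$, $r(v)=v$ and an empty product of edge weights; similarly in $\mathcal{B}_\partial$. **Weights on $\mathcal{M}_{\mathcal{B}}$.** A weight $\psi:\mathcal{M}_{\mathcal{B}}\to\mathbb{C}$ is a positive linear functional on the $*$-algebra $\mathcal{M}_{\mathcal{B}}$ ($\psi(x^*x)\ge 0$); it is faithful if $\psi(x^*x)>0$ for $x\ne0$. Gauge invariant means invariant under the action of $U(1)\times U(1)$ given by $S_e\mapsto zS_e$, $S_{\sigma,e}\mapsto wS_{\sigma,e}$ (fixing the projections $P_v,P_e$). The KMS condition with respect to $\sigma_t$ means: $\psi\circ\sigma_t=\psi$, and for all $x,y\in\mathcal{M}_{\mathcal{B}}$ there is a function $F_{x,y}$, analytic on the strip $\{0<\Im z<1\}$ and continuous on its closure, with $F_{x,y}(t)=\psi(\sigma_t(x)y)$ and $F_{x,y}(t+i)=\psi(y\,\sigma_t(x))$ for $t\in\mathbb{R}$. *)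

(* Defs.v *)
From HB Require Import structures.
From mathcomp Require Import all_boot all_order all_algebra.
From mathcomp Require Import complex.
From mathcomp Require Import all_classical all_reals all_analysis.

Set Implicit Arguments.
Unset Strict Implicit.
Unset Printing Implicit Defensive.

Import Order.TTheory GRing.Theory Num.Theory.
Import numFieldNormedType.Exports.

Local Open Scope classical_set_scope.
Local Open Scope ring_scope.
Local Open Scope complex_scope.

(* C*-algebras need not be unital and may be zero. The norm of a normed module over R[i] takes
   its values in R[i]. *)
HB.mixin Record isCStarAlgebra (R : realType) A
    of CompleteNormedModule R[i] A := {
  cmul : A -> A -> A;
  cstar : A -> A;
  cmulA : forall a b c, cmul a (cmul b c) = cmul (cmul a b) c;
  cmulDl : forall a b c, cmul (a + b) c = cmul a c + cmul b c;
  cmulDr : forall a b c, cmul a (b + c) = cmul a b + cmul a c;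
  cmulZl : forall (k : R[i]) a b, cmul (k *: a) b = k *: cmul a b;
  cmulZr : forall (k : R[i]) a b, cmul a (k *: b) = k *: cmul a b;
  cstarK : forall a, cstar (cstar a) = a;
  cstarD : forall a b, cstar (a + b) = cstar a + cstar b;
  cstarZ : forall (k : R[i]) a, cstar (k *: a) = k^* *: cstar a;
  cstarM : forall a b, cstar (cmul a b) = cmul (cstar b) (cstar a);
  cnormM : forall a b, `|cmul a b| <= `|a| * `|b|;
  cnorm_star : forall a, `|cmul (cstar a) a| = `|a| ^+ 2
}.

#[short(type="cstarAlgType")]
HB.structure Definition CStarAlgebra (R : realType) :=
  {A of isCStarAlgebra R A & CompleteNormedModule R[i] A}.

Declare Scope cstar_scope.
Delimit Scope cstar_scope with cstar.
Notation "a ∗ b" := (cmul a b) (at level 40, left associativity)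
  : cstar_scope.
Notation "a ^†" := (cstar a) (at level 1, left associativity,
  format "a ^†") : cstar_scope.
Local Open Scope cstar_scope.

Definition is_starhom (R : realType) (A D : cstarAlgType R) (f : A -> D) :=
  [/\ forall a b, f (a + b) = f a + f b,
      forall (k : R[i]) a, f (k *: a) = k *: f a,
      forall a b, f (a ∗ b) = f a ∗ f b &
      forall a, f a^† = (f a)^†].

Definition is_cunit (R : realType) (A : cstarAlgType R) (u : A) :=
  forall a : A, u ∗ a = a /\ a ∗ u = a.

(* The unit of A (and 0 when A has no unit). *)
Definition cunit (R : realType) (A : cstarAlgType R) : A :=
  xget 0 [set u : A | is_cunit u].

Definition is_cproj (R : realType) (A : cstarAlgType R) (p : A) :=
  p ∗ p = p /\ p^† = p.

Definition is_partial_isometry (R : realType) (A : cstarAlgType R) (s : A) :=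
  s ∗ s^† ∗ s = s.

Definition lin_span (R : realType) (A : cstarAlgType R) (X : set A) : set A :=
  [set x | exists (n : nat) (k : 'I_n -> R[i]) (y : 'I_n -> A),
     (forall i, X (y i)) /\ x = \sum_(i < n) k i *: y i].

Definition closed_star_subalgebra (R : realType) (A : cstarAlgType R)
    (X : set A) :=
  closed X /\
  [/\ X 0,
      forall a b, X a -> X b -> X (a + b),
      forall (k : R[i]) a, X a -> X (k *: a),
      forall a b, X a -> X b -> X (a ∗ b) &
      forall a, X a -> X a^†].

Record digraph := Digraph {
  vert : finType;
  edge : finType;
  src : edge -> vert;
  rng : edge -> vert
}.

Definition nonsink (G : digraph) (v : vert G) := exists e : edge G, src e = v.

Definition graph_weight (R : realType) (G : digraph)
    (g : vert G -> R) (lam : edge G -> R) :=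
  [/\ forall v, 0 <= g v,
      forall e, 0 <= lam e &
      forall v, nonsink v -> g v = \sum_(e | src e == v) lam e * g (rng e)].

Fixpoint is_walk (G : digraph) (v : vert G) (es : seq (edge G)) : bool :=
  if es is e :: es' then (src e == v) && is_walk (rng e) es' else true.

(* An oriented path is its initial vertex with its sequence of edges, so that
   there is one path of length zero for each vertex. *)
Definition gpath (G : digraph) :=
  {p : vert G * seq (edge G) | is_walk p.1 p.2}.

Definition pedges (G : digraph) (p : gpath G) : seq (edge G) := (val p).2.

Definition prange (G : digraph) (p : gpath G) : vert G :=
  last (val p).1 (map (@rng G) (pedges p)).

Record graph_family (R : realType) (G : digraph) (A : cstarAlgType R) :=
  GraphFamily { gP : vert G -> A; gS : edge G -> A }.

Definition is_graph_family (R : realType) (G : digraph) (A : cstarAlgType R)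
    (F : graph_family G A) :=
  [/\ forall v, is_cproj (gP F v),
      forall v w, v != w -> gP F v ∗ gP F w = 0,
      forall e, is_partial_isometry (gS F e),
      forall e, (gS F e)^† ∗ gS F e = gP F (rng e) &
      forall v, nonsink v ->
        gP F v = \sum_(e | src e == v) gS F e ∗ (gS F e)^†].

(* C^*(G), given through the property that defines it up to isomorphism. *)
Record graph_cstar (R : realType) (G : digraph) := GraphCstar {
  gc_alg :> cstarAlgType R;
  gc_fam : graph_family G gc_alg;
  gc_rel : is_graph_family gc_fam;
  gc_generated : forall X : set gc_alg, closed_star_subalgebra X ->
    (forall v, X (gP gc_fam v)) -> (forall e, X (gS gc_fam e)) -> X = setT;
  gc_universal : forall (D : cstarAlgType R) (F : graph_family G D),
    is_graph_family F ->
    exists f : gc_alg -> D, [/\ is_starhom f,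
      forall v, f (gP gc_fam v) = gP F v &
      forall e, f (gS gc_fam e) = gS F e]
}.

Definition Spath (R : realType) (G : digraph) (A : graph_cstar R G)
    (p : gpath G) : A :=
  match pedges p with
  | [::] => gP (gc_fam A) (val p).1
  | e :: es => foldl (fun a f => a ∗ gS (gc_fam A) f) (gS (gc_fam A) e) es
  end.

Definition bilinear_map (R : realType) (U V W : lmodType R[i])
    (b : U -> V -> W) :=
  [/\ forall u u' v, b (u + u') v = b u v + b u' v,
      forall u v v', b u (v + v') = b u v + b u v',
      forall k u v, b (k *: u) v = k *: b u v &
      forall k u v, b u (k *: v) = k *: b u v].

(* A completion of the algebraic tensor product of A1 and A2 for some C*-norm.
   Graph C*-algebras are nuclear, so for them there is only one such norm; no
   choice among the C*-tensor products (minimal, maximal) is made here.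
   By ct_alg_tensor the only linear relations between elementary tensors are
   those that hold in the algebraic tensor product. *)
Record cstar_tensor (R : realType) (A1 A2 : cstarAlgType R) := CstarTensor {
  ct_alg :> cstarAlgType R;
  tens : A1 -> A2 -> ct_alg;
  ct_bilinear : bilinear_map tens;
  ct_mul : forall a b c d, tens a c ∗ tens b d = tens (a ∗ b) (c ∗ d);
  ct_star : forall a c, (tens a c)^† = tens a^† c^†;
  ct_alg_tensor : forall (n : nat) (a : 'I_n -> A1) (c : 'I_n -> A2),
    \sum_(i < n) tens (a i) (c i) = 0 ->
    forall (W : lmodType R[i]) (b : A1 -> A2 -> W), bilinear_map b ->
      \sum_(i < n) b (a i) (c i) = 0;
  ct_dense :
    closure (lin_span [set x | exists a c, x = tens a c]) = setT
}.

(* The combinatorial data of an oriented finite CW complex of dimension 2 (so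
   with at least one face). The cyclic word of a face f is given by one of the
   tuples representing it: the letter of index i is followed by the letter of
   index ordS i, its successor modulo the length. *)
Record oriented_complex := OrientedComplex {
  skeleton : digraph;
  face : finType;
  face_exists : (0 < #|face|)%N;
  flen : face -> nat;
  flen_gt0 : forall f, (0 < flen f)%N;
  fword : forall f, (flen f).-tuple (edge skeleton);
  fwordP : forall f (i : 'I_(flen f)),
    rng (tnth (fword f) i) = src (tnth (fword f) (ordS i))
}.

(* Its edge Tagged _ i, with i : 'I_(flen f), is the edge (f, e) for the
   appearance of e at index i in the word of f. *)
Definition boundary_graph (B : oriented_complex) : digraph :=
  @Digraph (edge (skeleton B)) {f : face B & 'I_(flen f)}
    (fun x => tnth (fword (tag x)) (tagged x))
    (fun x => tnth (fword (tag x)) (ordS (tagged x))).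

Definition bedge (B : oriented_complex) (f : face B) (i : 'I_(flen f)) :
  edge (boundary_graph B) := Tagged (fun f => 'I_(flen f)) i.

Definition rank2_weight (R : realType) (B : oriented_complex)
    (g : vert (skeleton B) -> R) (lamt lam : edge (skeleton B) -> R)
    (eta : face B -> R) :=
  [/\ graph_weight g lamt,
      forall f, 0 <= eta f &
      @graph_weight R (boundary_graph B) lam (fun x => eta (tag x))].

Definition nowhere_zero (R : realType) (X : Type) (f : X -> R) :=
  forall x, f x != 0.

Section ComplexAlgebra.
Context (R : realType) (B : oriented_complex).
Context (A1 : graph_cstar R (skeleton B)).
Context (A2 : graph_cstar R (boundary_graph B)).
Context (T : cstar_tensor A1 A2).

Definition inL (a : A1) : T := tens T a (cunit A2).
Definition inR (c : A2) : T := tens T (cunit A1) c.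

Definition Pv (v : vert (skeleton B)) : T := inL (gP (gc_fam A1) v).
Definition Se (e : edge (skeleton B)) : T := inL (gS (gc_fam A1) e).
Definition Pe (e : edge (skeleton B)) : T := inR (gP (gc_fam A2) e).
Definition Sf (x : edge (boundary_graph B)) : T := inR (gS (gc_fam A2) x).

Definition monomial (mu nu : gpath (skeleton B))
    (Om La : gpath (boundary_graph B)) : T :=
  inL (Spath A1 mu) ∗ (inL (Spath A1 nu))^† ∗
  inR (Spath A2 Om) ∗ (inR (Spath A2 La))^†.

Definition MB : set T :=
  lin_span [set x | exists mu nu Om La,
    [/\ prange mu = prange nu, prange Om = prange La &
        x = monomial mu nu Om La]].

(* Maps on M_B are represented by maps on C^*(B), of which only the
   restriction to M_B is considered. *)

Definition is_weight (psi : T -> R[i]) :=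
  [/\ forall x y, MB x -> MB y -> psi (x + y) = psi x + psi y,
      forall k x, MB x -> psi (k *: x) = k * psi x &
      forall x, MB x -> 0 <= psi (x^† ∗ x)].

Definition faithful (psi : T -> R[i]) :=
  forall x, MB x -> x != 0 -> 0 < psi (x^† ∗ x).

Definition is_MB_starhom (f : T -> T) :=
  (forall x, MB x -> MB (f x)) /\
  [/\ forall x y, MB x -> MB y -> f (x + y) = f x + f y,
      forall k x, MB x -> f (k *: x) = k *: f x,
      forall x y, MB x -> MB y -> f (x ∗ y) = f x ∗ f y &
      forall x, MB x -> f x^† = (f x)^†].

Definition scales_generators (a : edge (skeleton B) -> R[i])
    (b : face B -> R[i]) (f : T -> T) :=
  [/\ forall v, f (Pv v) = Pv v,
      forall e, f (Pe e) = Pe e,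
      forall e, f (Se e) = a e *: Se e &
      forall x, f (Sf x) = b (tag x) *: Sf x].

Definition is_gauge_action (gam : R[i] -> R[i] -> T -> T) :=
  [/\ forall x, MB x -> gam 1 1 x = x,
      forall z w z' w', `|z| = 1 -> `|w| = 1 -> `|z'| = 1 -> `|w'| = 1 ->
        forall x, MB x -> gam (z * z') (w * w') x = gam z w (gam z' w' x) &
      forall z w, `|z| = 1 -> `|w| = 1 ->
        is_MB_starhom (gam z w) /\
        scales_generators (fun=> z) (fun=> w) (gam z w)].

Definition gauge_invariant (psi : T -> R[i]) :=
  exists2 gam, is_gauge_action gam &
    forall z w, `|z| = 1 -> `|w| = 1 ->
      forall x, MB x -> psi (gam z w x) = psi x.

Definition is_time_evolution (sig : R -> T -> T) :=
  [/\ forall t, is_MB_starhom (sig t),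
      forall x, MB x -> sig 0 x = x,
      forall s t x, MB x -> sig (s + t) x = sig s (sig t x) &
      forall x, MB x -> continuous (fun t : R => sig t x)].

(* x ^ (i t) for x > 0 *)
Definition powit (x t : R) : R[i] := cos (t * ln x) +i* sin (t * ln x).

Definition weight_evolution (lamt : edge (skeleton B) -> R) (eta : face B -> R)
    (sig : R -> T -> T) :=
  is_time_evolution sig /\
  forall t, scales_generators (fun e => powit (lamt e) t)
    (fun f => powit (eta f) t) (sig t).

Definition kms (sig : R -> T -> T) (psi : T -> R[i]) :=
  (forall t x, MB x -> psi (sig t x) = psi x) /\
  forall x y, MB x -> MB y -> exists F : R[i]^o -> R[i]^o,
    [/\ forall z : R[i], 0 < complex.Im z < 1 -> derivable F z 1,
        {within [set z : R[i]^o | 0 <= complex.Im z <= 1], continuous F},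
        forall t : R, F t%:C = psi (sig t x ∗ y) &
        forall t : R, F (t +i* 1) = psi (y ∗ sig t x)].

Definition monomial_formula (g : vert (skeleton B) -> R)
    (lamt lam : edge (skeleton B) -> R) (eta : face B -> R) (psi : T -> R[i]) :=
  forall mu nu Om La, prange mu = prange nu -> prange Om = prange La ->
    psi (monomial mu nu Om La) =
      (mu == nu)%:R * (Om == La)%:R *
      ((\prod_(e <- pedges mu) lamt e) * g (prange mu) *
       ((\prod_(x <- pedges Om) eta (tag x)) * lam (prange Om)))%:C.

Definition face_ratio (psi : T -> R[i]) (f : face B) (i : 'I_(flen f)) : R[i] :=
  psi (Sf (bedge i) ∗ (Sf (bedge i))^†) / psi ((Sf (bedge i))^† ∗ Sf (bedge i)).

End ComplexAlgebra.

(* Main.v *)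
(* The weight is the tensor product of two functionals, one on each graph
   algebra, with phi (S_mu S_nu^* ) = delta_(mu,nu) lam(mu) g(r(mu)). To see that
   such a phi exists one needs to know which linear relations hold between the
   S_mu S_nu^*, hence a representation in which they act nontrivially: on l2 of
   a countable set of points, each edge acts by a partial injection, and a
   degree coordinate makes the diagonal coefficient at x of S_mu S_nu^* equal to
   1 if mu = nu and x is in the range of mu, and to 0 otherwise. Integrating
   these coefficients against finitely supported approximations of the measure
   on paths giving to the cylinder of mu the mass lam(mu) g(r(mu)) gives
   functionals which on S_mu S_nu^* are eventually equal to phi. They are
   nonnegative combinations of vector functionals, so their tensor products are
   positive. Both actions come from the universal property of the graph algebras.
   The KMS condition reduces to phi (S_e x) = lam(e) phi (x S_e), which extends
   from edges to paths multiplicatively. For the converse, the representation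
   shows that P_v tensor P_e does not vanish, and the weight equations are the
   Cuntz-Krieger relations under psi. *)

From HB Require Import structures.
Require Import Defs.
From mathcomp Require Import all_boot all_order all_algebra.
From mathcomp Require Import complex.
From mathcomp Require Import all_classical all_reals all_analysis.
From mathcomp Require Import ring lra.

Set Implicit Arguments.
Unset Strict Implicit.
Unset Printing Implicit Defensive.

Import Order.TTheory GRing.Theory Num.Theory.
Import numFieldNormedType.Exports.

Local Open Scope classical_set_scope.
Local Open Scope complex_scope.
Local Open Scope ring_scope.
Local Open Scope cstar_scope.

(** The universal property of a graph algebra only yields homomorphisms into C*-algebras, so the
    bounded operators on l2 have to be built in full: inner product, adjoints, C*-identity and
    completeness. The functional on a graph algebra is never shown to be bounded, or even linear on
    all of it: it is the eventual value of linear functionals, exact on a monomial once the depth is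
    at least the length of its path. This suffices because M_B lies in the algebraic tensor product,
    where bilinear maps lift without any continuity; the gauge action and the time evolution are
    lifted in the same way. Positivity is checked at a fixed depth: at a basis point, monomials act
    by partial injections, so the diagonal coefficients of the products of adjoints of monomials
    with monomials record which images coincide, and such a matrix is positive semidefinite.
    Multiplying monomials also takes the relation that distinct edges with the same source have
    orthogonal ranges. It is not a defining relation, and its proof rests on norm estimates
    alone. *)

Local Notation Re := complex.Re.
Local Notation Im := complex.Im.

(** * Square-summable sequences *)

Section ComplexLimits.
Context (R : realType).
Implicit Types (s t : nat -> R[i]) (a b k : R[i]).

Lemma ReD a b : Re (a + b) = Re a + Re b. Proof. by case: a; case: b. Qed.
Lemma ImD a b : Im (a + b) = Im a + Im b. Proof. by case: a; case: b. Qed.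
Lemma ReM a b : Re (a * b) = Re a * Re b - Im a * Im b.
Proof. by case: a; case: b. Qed.
Lemma ImM a b : Im (a * b) = Re a * Im b + Im a * Re b.
Proof. by case: a; case: b. Qed.
Lemma ReJ a : Re a^* = Re a. Proof. by case: a. Qed.
Lemma conjD a b : (a + b)^* = a^* + b^*. Proof. exact: rmorphD. Qed.
Lemma conjM a b : (a * b)^* = a^* * b^*. Proof. exact: rmorphM. Qed.
Lemma conjN a : (- a)^* = - a^*. Proof. exact: rmorphN. Qed.
Lemma conjR (x : R) : (x%:C)^* = x%:C. Proof. exact: conjc_real. Qed.
Lemma ImJ a : Im a^* = - Im a. Proof. by case: a. Qed.

(* Convergence is taken coordinatewise: the library has no completeness of R[i]. *)
Definition ccvg s a :=
  (fun n => Re (s n)) @ \oo --> Re a /\ (fun n => Im (s n)) @ \oo --> Im a.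

Definition clim s : R[i] :=
  lim ((fun n => Re (s n)) @ \oo) +i* lim ((fun n => Im (s n)) @ \oo).

Lemma ccvg_lim s a : ccvg s a -> clim s = a.
Proof. by case: a => x y [/= hx hy]; congr Complex; exact: cvg_lim. Qed.

Lemma ccvgD s t a b : ccvg s a -> ccvg t b -> ccvg (fun n => s n + t n) (a + b).
Proof.
move=> [sa1 sa2] [tb1 tb2]; split; rewrite ?ReD ?ImD; under eq_fun do
  rewrite ?ReD ?ImD.
  exact: cvgD.
exact: cvgD.
Qed.

Lemma ccvgM k s a : ccvg s a -> ccvg (fun n => k * s n) (k * a).
Proof.
move=> [sa1 sa2]; split; rewrite ?ReM ?ImM; under eq_fun do rewrite ?ReM ?ImM.
  by apply: cvgB; apply: cvgMr.
by apply: cvgD; apply: cvgMr.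
Qed.

Lemma ccvgMM s t a b : ccvg s a -> ccvg t b -> ccvg (fun n => s n * t n) (a * b).
Proof.
move=> [sa1 sa2] [tb1 tb2]; split; rewrite ?ReM ?ImM;
  under eq_fun do rewrite ?ReM ?ImM.
  by apply: cvgB; apply: cvgM.
by apply: cvgD; apply: cvgM.
Qed.

Lemma ccvgJ s a : ccvg s a -> ccvg (fun n => (s n)^*) a^*.
Proof.
move=> [sa1 sa2]; split; rewrite ?ReJ ?ImJ; under eq_fun do rewrite ?ReJ ?ImJ.
  by [].
exact: cvgN.
Qed.

Lemma ccvg_cst k : ccvg (fun=> k) k.
Proof. by split; exact: cvg_cst. Qed.

Lemma ccvg_sum (I : Type) (r : seq I) (F : I -> nat -> R[i]) (l : I -> R[i]) :
  (forall i, ccvg (F i) (l i)) ->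
  ccvg (fun n => \sum_(i <- r) F i n) (\sum_(i <- r) l i).
Proof.
move=> cF; elim: r => [|i r IH].
  by under eq_fun do rewrite big_nil; rewrite big_nil; exact: ccvg_cst.
by rewrite big_cons; under eq_fun do rewrite big_cons; apply: ccvgD.
Qed.

Lemma nondecreasing_ccvg s (M : R[i]) :
  (forall n, 0 <= s n) -> (forall n, s n <= s n.+1) -> (forall n, s n <= M) ->
  ccvg s (clim s).
Proof.
move=> s0 sS sM; split => /=.
  apply: nondecreasing_is_cvgn.
    apply/nondecreasing_seqP => n; by have := sS n; rewrite lecE => /andP[].
  exists (Re M) => _ [n _ <-]; by have := sM n; rewrite lecE => /andP[].
have -> : (fun n => Im (s n)) = fun=> 0.
  by apply/funext => n; rewrite ger0_Im.
exact: is_cvg_cst.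
Qed.

Lemma Re_sqn (z : R[i]) : Re (`|z| ^+ 2) = Re z ^+ 2 + Im z ^+ 2.
Proof. by rewrite -add_Re2_Im2. Qed.

Lemma Re_sqn_ge0 (z : R[i]) : 0 <= Re (`|z| ^+ 2).
Proof. by rewrite Re_sqn addr_ge0 // sqr_ge0. Qed.

Lemma sqn_ReE (z : R[i]) : `|z| ^+ 2 = (Re (`|z| ^+ 2))%:C.
Proof. by rewrite Re_sqn add_Re2_Im2. Qed.

Lemma real_cauchy_cvg (x e : R^nat) :
  (forall n m, (n <= m)%N -> `|x m - x n| <= e n) -> e @ \oo --> 0 ->
  cvg (x @ \oo).
Proof.
move=> xe e0; apply: cauchy_cvg; apply/cauchy_exP => eps eps0.
have [N _ HN] : \forall n \near \oo, e n < eps.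
  exact: (cvgr_lt _ e0).
exists (x N); exists N => // m /= Nm; rewrite /ball /= distrC.
by apply: (le_lt_trans (xe _ _ Nm)); apply: HN => /=.
Qed.

End ComplexLimits.

Section SquareSummable.
Context (R : realType).
Local Notation C := R[i].

Lemma sqnorm_parallelogram_le (a b : C) :
  `|a + b| ^+ 2 <= (`|a| ^+ 2 + `|b| ^+ 2) *+ 2.
Proof.
apply: (@le_trans _ _ ((`|a| + `|b|) ^+ 2)).
  by rewrite lerXn2r ?nnegrE ?addr_ge0 // ler_normD.
rewrite -subr_ge0 [X in 0 <= X](_ : _ = (`|a| - `|b|) ^+ 2); last by ring.
by rewrite real_exprn_even_ge0 // realB // normr_real.
Qed.

(** Boundedness of the partial sums lets membership be proved without a limit. The bound is a
    complex number, but the order of [R[i]] forces it to be real: take n = 0. *)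
Definition l2pred : {pred (nat -> C)} :=
  fun u => `[< exists M : C, forall n, \sum_(k < n) `|u k| ^+ 2 <= M >].

Lemma l2_submod : submod_closed l2pred.
Proof.
split; first by apply/asboolP; exists 0 => n; rewrite big1 // => k _;
  rewrite normr0 expr0n.
move=> a u v /asboolP[M hM] /asboolP[N hN]; apply/asboolP.
exists ((`|a| ^+ 2 * M + N) *+ 2) => n.
apply: (@le_trans _ _ (\sum_(k < n)
    (`|a| ^+ 2 * `|u k| ^+ 2 + `|v k| ^+ 2) *+ 2)).
  apply: ler_sum => k _; apply: (le_trans (sqnorm_parallelogram_le _ _)).
  by rewrite normrM exprMn.
rewrite sumrMnl lerMn2r /= big_split /= -mulr_sumr; apply: lerD.
  by apply: ler_wpM2l; [exact: exprn_ge0 | exact: hM].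
exact: hN.
Qed.

HB.instance Definition _ := GRing.isSubmodClosed.Build C (nat -> C) l2pred
  l2_submod.

Record l2 := L2 { l2val :> nat -> C; _ : l2val \in l2pred }.

HB.instance Definition _ := [isSub for l2val].
HB.instance Definition _ := [Choice of l2 by <:].
HB.instance Definition _ := [SubChoice_isSubLmodule of l2 by <:].

Implicit Types u v w : l2.

Lemma l2P u : exists M : C, forall n, \sum_(k < n) `|u k| ^+ 2 <= M.
Proof. by case: u => u hu; apply/asboolP; exact: hu. Qed.

Lemma l2D u v k : (u + v) k = u k + v k. Proof. by []. Qed.
Lemma l2Z (a : C) u k : (a *: u) k = a * u k. Proof. by []. Qed.
Lemma l2N u k : (- u) k = - u k. Proof. by []. Qed.
Lemma l20 k : (0 : l2) k = 0. Proof. by []. Qed.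

Definition ipn u v (n : nat) : C := \sum_(k < n) u k * (v k)^*.

(** Linear in the first argument. It is defined before convergence is known; [ccvg_ip] supplies
    that. *)
Definition ip u v : C := clim (ipn u v).

Arguments ip : simpl never.

Lemma ccvg_ipn_diag u : ccvg (ipn u u) (ip u u).
Proof.
have E n : ipn u u n = \sum_(k < n) `|u k| ^+ 2.
  by apply: eq_bigr => k _; rewrite sqr_normc.
have [M hM] := l2P u; apply: (@nondecreasing_ccvg R _ M) => n.
- by rewrite E sumr_ge0 // => k _; rewrite exprn_ge0.
- by rewrite !E big_ord_recr /= lerDl exprn_ge0.
- by rewrite E.
Qed.

(** Expresses a mixed term through squared moduli. Diagonal sums converge because they increase and
    are bounded, and this identity carries convergence over to [ipn u v]. *)
Lemma polarization (a b : C) :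
  a * b^* = 4^-1 * (\sum_(j < 4) 'i%C ^+ j *
     ((a + 'i%C ^+ j * b) * (a + 'i%C ^+ j * b)^*)).
Proof.
case: a b => a1 a2 [b1 b2].
have -> : 4^-1 = (4^-1 : R)%:C :> C by rewrite fmorphV rmorph_nat.
rewrite !big_ord_recr big_ord0 /= !exprS expr0 /=.
by apply/eqP; rewrite eq_complex /=; apply/andP; split; apply/eqP; field.
Qed.

Lemma ccvg_ip u v : ccvg (ipn u v) (ip u v).
Proof.
have E : ipn u v = (fun n => 4^-1 * (\sum_(j < 4) 'i%C ^+ j *
    ipn (u + 'i%C ^+ j *: v) (u + 'i%C ^+ j *: v) n)).
  apply/funext => n.
  under [X in _ = _ * X]eq_bigr do rewrite mulr_sumr.
  rewrite exchange_big mulr_sumr /=; apply: eq_bigr => k _.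
  by rewrite polarization.
have := ccvgM 4^-1 (ccvg_sum (index_enum 'I_4)
  (fun j => ccvgM ('i%C ^+ j) (ccvg_ipn_diag (u + 'i%C ^+ j *: v)))).
by rewrite -E => h; rewrite /ip (ccvg_lim h).
Qed.

Lemma ip_lim u v l : ccvg (ipn u v) l -> ip u v = l.
Proof. exact: ccvg_lim. Qed.

Lemma ipDl u v w : ip (u + v) w = ip u w + ip v w.
Proof.
apply: ip_lim; have -> : ipn (u + v) w = fun n => ipn u w n + ipn v w n.
  by apply/funext => n; rewrite /= -big_split /=; apply: eq_bigr => k _;
    rewrite mulrDl.
by apply: ccvgD; exact: ccvg_ip.
Qed.

Lemma ipZl a u w : ip (a *: u) w = a * ip u w.
Proof.
apply: ip_lim; have -> : ipn (a *: u) w = (fun n => a * ipn u w n).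
  by apply/funext => n; rewrite /= mulr_sumr; apply: eq_bigr => k _;
    rewrite l2Z mulrA.
by apply: ccvgM; exact: ccvg_ip.
Qed.

Lemma ipC u v : ip u v = (ip v u)^*.
Proof.
apply: ip_lim; have -> : ipn u v = (fun n => (ipn v u n)^*).
  apply/funext => n; rewrite rmorph_sum /=; apply: eq_bigr => k _.
  by case: (u k) (v k) => a b [c d]; congr Complex; ring.
by apply: ccvgJ; exact: ccvg_ip.
Qed.

Lemma ipDr u v w : ip u (v + w) = ip u v + ip u w.
Proof. by rewrite ipC ipDl conjD -!ipC. Qed.

Lemma ipZr a u w : ip u (a *: w) = a^* * ip u w.
Proof. by rewrite ipC ipZl conjM -ipC. Qed.

Definition nsq u : R := Re (ip u u).

Lemma Re_ipn_diag u n : Re (ipn u u n) = \sum_(k < n) Re (`|u k| ^+ 2).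
Proof.
rewrite /ipn (raddf_sum (@Re R : Rcomplex R -> R)).
by apply: eq_bigr => k _; rewrite sqr_normc.
Qed.

Lemma nsq_ge_partial u n : \sum_(k < n) Re (`|u k| ^+ 2) <= nsq u.
Proof.
rewrite -Re_ipn_diag; have [H _] := ccvg_ip u u.
rewrite /nsq -(cvg_lim _ H) //; apply: nondecreasing_cvgn_le => //.
  apply/nondecreasing_seqP => m; rewrite !Re_ipn_diag big_ord_recr /=.
  by rewrite lerDl Re_sqn_ge0.
Qed.

Lemma nsq_le u (M : R) : (forall n, \sum_(k < n) Re (`|u k| ^+ 2) <= M) ->
  nsq u <= M.
Proof.
move=> h; have [H _] := ccvg_ip u u.
rewrite /nsq -(cvg_lim _ H) //; apply: limr_le.
  by apply/cvg_ex; eexists; exact: H.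
by near=> n; rewrite Re_ipn_diag.
Unshelve. all: by end_near. Qed.

Lemma nsq_ge0 u : 0 <= nsq u.
Proof. by have := nsq_ge_partial u 0; rewrite big_ord0. Qed.

Lemma ip_nsq u : ip u u = (nsq u)%:C.
Proof.
rewrite /nsq; have := ipC u u; case: (ip u u) => a b [] /= h.
by congr Complex; lra.
Qed.

Lemma coord_sqn_le u k : Re (`|u k| ^+ 2) <= nsq u.
Proof.
apply: (le_trans _ (nsq_ge_partial u k.+1)); rewrite big_ord_recr /= lerDr.
by rewrite sumr_ge0 // => j _; rewrite Re_sqn_ge0.
Qed.

Lemma l2_ext u v : (forall k, u k = v k) -> u = v.
Proof. by move=> h; apply: val_inj; apply/funext. Qed.

Lemma nsq0_eq0 u : nsq u = 0 -> u = 0.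
Proof.
move=> h; apply: l2_ext => k; rewrite l20.
have := coord_sqn_le u k; rewrite h -add_Re2_Im2 /=.
case: (u k) => a b /= H.
have h1 := sqr_ge0 a; have h2 := sqr_ge0 b.
have /eqP : a ^+ 2 = 0 by lra.
have /eqP : b ^+ 2 = 0 by lra.
by rewrite !sqrf_eq0 => /eqP -> /eqP ->.
Qed.

Lemma ip0l u : ip 0 u = 0.
Proof. by rewrite -(scale0r 0) ipZl mul0r. Qed.

Lemma ip0r u : ip u 0 = 0.
Proof. by rewrite ipC ip0l rmorph0. Qed.

Lemma ipNl u v : ip (- u) v = - ip u v.
Proof. by rewrite -scaleN1r ipZl mulN1r. Qed.

Lemma ipNr u v : ip u (- v) = - ip u v.
Proof. by rewrite ipC ipNl conjN -ipC. Qed.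

Lemma ip_injl u v : (forall w, ip u w = ip v w) -> u = v.
Proof.
move=> h; apply/eqP; rewrite -subr_eq0; apply/eqP/nsq0_eq0.
by rewrite /nsq ipDl ipNl h subrr.
Qed.

Lemma CauchySchwarz_l2 u v : Re (`|ip u v| ^+ 2) <= nsq u * nsq v.
Proof.
have [v0|v0] := eqVneq (nsq v) 0.
  rewrite (nsq0_eq0 v0) ip0r normr0 expr0n /= mulr_ge0 // nsq_ge0 //.
have vp : 0 < nsq v by rewrite lt_neqAle eq_sym v0 nsq_ge0.
(* The vector below is [nsq v] times the component of u orthogonal to v; the factor [nsq v] avoids a
   division. *)
pose c := ip u v.
have := nsq_ge0 ((nsq v)%:C *: u - c *: v).
rewrite /nsq !(ipDl, ipDr, ipNl, ipNr, ipZl, ipZr) conjR !ip_nsq.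
rewrite (ipC v u) -/c -add_Re2_Im2; case: c => a b /=.
rewrite !(mulr0, mul0r, addr0, oppr0, subr0, add0r) => h.
have {h} : 0 <= nsq v * (nsq v * nsq u - (a ^+ 2 + b ^+ 2)).
  by apply: (le_trans h); rewrite le_eqVlt; apply/orP; left; apply/eqP; ring.
by rewrite pmulr_rge0 // subr_ge0 (mulrC (nsq u)).
Qed.

Definition nrm u : R := Num.sqrt (nsq u).

Lemma nrm_ge0 u : 0 <= nrm u. Proof. exact: sqrtr_ge0. Qed.

Lemma nrm_sq u : nrm u ^+ 2 = nsq u. Proof. by rewrite sqr_sqrtr // nsq_ge0. Qed.

Lemma nrm0_eq0 u : nrm u = 0 -> u = 0.
Proof. by move=> h; apply: nsq0_eq0; rewrite -nrm_sq h expr0n. Qed.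

Lemma nrm0 : nrm 0 = 0.
Proof. by rewrite /nrm /nsq ip0l sqrtr0. Qed.

Lemma ip_le u v : `|ip u v| <= (nrm u * nrm v)%:C.
Proof.
rewrite normc_def lecR -(ger0_norm (mulr_ge0 (nrm_ge0 u) (nrm_ge0 v))).
rewrite -sqrtr_sqr; apply: ler_wsqrtr; rewrite exprMn !nrm_sq.
by have := CauchySchwarz_l2 u v; rewrite -add_Re2_Im2.
Qed.

Lemma nrmZ a u : (nrm (a *: u))%:C = `|a| * (nrm u)%:C.
Proof.
rewrite normc_def -rmorphM /=; congr (_%:C); rewrite -sqrtrM ?addr_ge0 ?sqr_ge0 //.
congr Num.sqrt; rewrite /nsq ipZl ipZr ip_nsq; case: a => a b /=; ring.
Qed.

Lemma nrmD u v : nrm (u + v) <= nrm u + nrm v.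
Proof.
rewrite -(ler_pXn2r (ltn0Sn 1)) ?nnegrE ?addr_ge0 ?nrm_ge0 //.
rewrite sqrrD !nrm_sq /nsq !(ipDl, ipDr) (ipC v u).
have : Re (ip u v) <= nrm u * nrm v.
  rewrite (le_trans (ler_norm _)) // -lecR (le_trans _ (ip_le u v)) //.
  exact: normc_ge_Re.
rewrite !(raddfD (@Re R : Rcomplex R -> R)) /=.
by case: (ip u v) => a b /=; lra.
Qed.

End SquareSummable.

Lemma delta_sum (V : pzSemiRingType) (n K : nat) (f : nat -> V) :
  \sum_(k < K) f k * (k == n :> nat)%:R = if (n < K)%N then f n else 0.
Proof.
case: ltnP => h.
  rewrite (bigD1 (Ordinal h)) //= eqxx mulr1 big1 ?addr0 // => k kn.
  by move/negPf : kn; rewrite -val_eqE /= => ->; rewrite mulr0.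
rewrite big1 // => k _; rewrite (_ : (k == n :> nat) = false) ?mulr0 //.
by apply/negbTE; rewrite neq_ltn (leq_trans (ltn_ord k) h).
Qed.

(** * Completeness of l2 and density of finitely supported vectors *)

Section HilbertSpace.
Context (R : realType).
Local Notation C := R[i].
Local Notation l2 := (l2 R).
Implicit Types u v w : l2.

Lemma coord_le u k : Normc.normc (u k) <= nrm u.
Proof.
have -> : Normc.normc (u k) = Num.sqrt (Re (`|u k| ^+ 2)).
  by rewrite Re_sqn; case: (u k).
by rewrite ler_wsqrtr // coord_sqn_le.
Qed.

(** Coordinates converge, and the estimate passes to the limit in every finite partial sum. The rate
    is kept in the conclusion: for operators it becomes [e n * nrm u], which makes the limit
    operator bounded. *)
Lemma l2_complete (s : nat -> l2) (e : R^nat) :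
  (forall n m, (n <= m)%N -> nrm (s m - s n) <= e n) -> e @ \oo --> 0 ->
  exists u, forall n, nrm (u - s n) <= e n.
Proof.
move=> se e0.
have e_ge0 n : 0 <= e n by apply: le_trans (se n n (leqnn n)); exact: nrm_ge0.
have sk k n m : (n <= m)%N -> Normc.normc (s m k - s n k) <= e n.
  by move=> /se; apply: le_trans; exact: (coord_le (s m - s n) k).
pose v k := clim (fun n => s n k).
have sv k : ccvg (fun n => s n k) (v k).
  split; apply: (@real_cauchy_cvg _ _ e) => // n m /(sk k); apply: le_trans.
    by rewrite -(raddfB (@Re R : Rcomplex R -> R)) -lecR; have := normc_ge_Re (s m k - s n k).
  rewrite -(raddfB (@Im R : Rcomplex R -> R)); case: (s m k - s n k) => a b /=.
  by rewrite -sqrtr_sqr ler_wsqrtr // lerDr sqr_ge0.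
have key n K : \sum_(k < K) Re (`|v k - s n k| ^+ 2) <= e n ^+ 2.
  have cv : ccvg (fun m => \sum_(k < K) ((s m k - s n k) * (s m k - s n k)^*))
      (\sum_(k < K) ((v k - s n k) * (v k - s n k)^*)).
    apply: (ccvg_sum _ (F := fun (k : 'I_K) m => _) (l := fun k : 'I_K => _)) => k.
    have h : ccvg (fun m => s m k - s n k) (v k - s n k).
      by apply: ccvgD; [exact: sv | exact: ccvg_cst].
    by apply: ccvgMM => //; exact: ccvgJ.
  have -> : \sum_(k < K) Re (`|v k - s n k| ^+ 2) =
      Re (\sum_(k < K) ((v k - s n k) * (v k - s n k)^*)).
    rewrite (raddf_sum (@Re R : Rcomplex R -> R)).
    by apply: eq_bigr => k _; rewrite sqr_normc.
  case: cv => cv _; rewrite -(cvg_lim _ cv) //; apply: limr_le.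
    by apply/cvg_ex; eexists; exact: cv.
  exists n => // m /= nm; rewrite (raddf_sum (@Re R : Rcomplex R -> R)).
  apply: (@le_trans _ _ (nsq (s m - s n))).
    apply: le_trans (nsq_ge_partial _ K); apply: ler_sum => k _.
    by rewrite -sqr_normc.
  by rewrite -nrm_sq lerXn2r ?nnegrE ?nrm_ge0 // se.
(* At n = 0, [key] shows that v - s 0 is square-summable; s 0 is added back afterwards. *)
have w0P : (fun k => v k - s 0%N k) \in @l2pred R.
  apply/asboolP; exists (e 0%N ^+ 2)%:C => K.
  rewrite (eq_bigr _ (fun k _ => sqn_ReE _)) -rmorph_sum lecR.
  exact: key.
exists (L2 w0P + s 0%N) => n.
rewrite -(ler_pXn2r (ltn0Sn 1)) ?nnegrE ?nrm_ge0 // nrm_sq.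
apply: nsq_le => K; apply: le_trans (key n K).
by apply: ler_sum => k _; rewrite !l2D l2N /= subrK.
Qed.

Definition delta_fun (n k : nat) : C := (k == n)%:R.

Lemma delta_l2 n : delta_fun n \in @l2pred R.
Proof.
apply/asboolP; exists 1 => K.
rewrite (eq_bigr (fun k : 'I_K => 1 * (k == n :> nat)%:R)).
  by rewrite (delta_sum n K (fun=> 1)); case: ifP => // _; exact: ler01.
by move=> k _; rewrite /delta_fun; case: eqP; rewrite ?normr1 ?normr0 ?expr1n ?expr0n ?mul1r.
Qed.

Definition delta n : l2 := L2 (delta_l2 n).

Lemma deltaE n k : delta n k = (k == n)%:R. Proof. by []. Qed.

Lemma ip_delta u n : ip u (delta n) = u n.
Proof.
apply: ip_lim.
have E K : (n < K)%N -> ipn u (delta n) K = u n.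
  move=> nK; rewrite /ipn (eq_bigr (fun k : 'I_K => u k * (k == n :> nat)%:R)).
    by rewrite delta_sum nK.
  by move=> k _; rewrite deltaE; case: eqP; rewrite ?rmorph1 ?rmorph0.
split; apply: cvg_near_cst; exists n.+1 => // K /= nK; by rewrite E.
Qed.

Lemma delta_ip u n : ip (delta n) u = (u n)^*.
Proof. by rewrite ipC ip_delta. Qed.

Lemma l2_dense u (e : R) : 0 < e ->
  exists n, nrm (u - \sum_(k < n) u k *: delta k) <= e.
Proof.
move=> e0; have [H _] := ccvg_ip u u.
have [n _ hn] : \forall n \near \oo, nsq u - e ^+ 2 < Re (ipn u u n).
  by apply: (cvgr_gt _ H); rewrite ltrBlDr ltrDl exprn_gt0.
exists n; rewrite -(ler_pXn2r (ltn0Sn 1)) ?nnegrE ?nrm_ge0 ?(ltW e0) // nrm_sq.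
have {}hn := hn n (leqnn n); rewrite Re_ipn_diag in hn.
have E k : (u - \sum_(j < n) u j *: delta j) k = if (k < n)%N then 0 else u k.
  have -> : (u - \sum_(j < n) u j *: delta j) k =
      u k - \sum_(j < n) u j * (j == k :> nat)%:R.
    rewrite l2D l2N; congr (_ - _).
    elim/big_rec2: _ => // j a w _ <-.
    by rewrite l2D l2Z deltaE eq_sym.
  by rewrite delta_sum; case: ifP; rewrite ?subrr ?subr0.
apply: nsq_le => K.
(* By [E] the remainder lives on the coordinates from n on, so the two sums together count each
   coordinate of u at most once. *)
have : \sum_(k < K) Re (`|(u - \sum_(j < n) u j *: delta j) k| ^+ 2) +
    \sum_(k < n) Re (`|u k| ^+ 2) <= nsq u.
  apply: le_trans (nsq_ge_partial u (maxn n K)).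
  rewrite -(big_mkord xpredT (fun k => Re (`|u k| ^+ 2))).
  rewrite -(big_mkord xpredT (fun k => Re (`|(u - _) k| ^+ 2))).
  rewrite -(big_mkord xpredT (fun k => Re (`|u k| ^+ 2))).
  rewrite [leRHS](@big_cat_nat _ _ _ n) ?leq_maxl // [leLHS]addrC lerD2l.
  have [Kn|nK] := leqP K n.
    rewrite [leRHS]big_geq // big_nat_cond big1 // => k.
    by rewrite andbT => /andP[_ kK]; rewrite E (leq_trans kK Kn) normr0 expr0n.
  rewrite [leLHS](@big_cat_nat _ _ _ n) ?(ltnW nK) //.
  rewrite big_nat_cond big1 => [|k]; last first.
    by rewrite andbT => /andP[_ kn]; rewrite E kn normr0 expr0n.
  rewrite [leLHS]add0r big_nat_cond [leRHS]big_nat_cond.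
  apply: ler_sum => k; rewrite andbT => /andP[nk _].
  by rewrite E ltnNge nk.
by lra.
Qed.

End HilbertSpace.

(** * Bounded operators *)

Section BoundedOperators.
Context (R : realType).
Local Notation C := R[i].
Local Notation l2 := (l2 R).
Implicit Types u v w : l2.

Definition adjoint (S T : l2 -> l2) := forall u v, ip (S u) v = ip u (T v).

(** Asking for an adjoint makes linearity automatic ([adjoint_linear]) and replaces the Riesz
    representation theorem in the definition of the star. *)
Definition boppred : {pred (l2 -> l2)} := fun S =>
  `[< (exists T, adjoint S T) /\ exists M : R, forall u, nrm (S u) <= M * nrm u >].

Lemma nrm_normZ a u : nrm (a *: u) = Normc.normc a * nrm u.
Proof. by apply: (@complexI R); rewrite nrmZ rmorphM. Qed.

Lemma normc_ge0 (a : C) : 0 <= Normc.normc a.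
Proof. by case: a => a b; exact: sqrtr_ge0. Qed.

Lemma bop_submod : submod_closed boppred.
Proof.
split.
  apply/asboolP; split; first by exists (fun=> 0) => u v; rewrite ip0l ip0r.
  by exists 0 => u; rewrite nrm0 mul0r.
move=> a S1 S2 /asboolP[[T1 h1] [M1 b1]] /asboolP[[T2 h2] [M2 b2]].
apply/asboolP; split.
  exists (fun v => a^* *: T1 v + T2 v) => u v.
  rewrite -[(a *: S1 + S2) u]/(a *: S1 u + S2 u).
  by rewrite ipDl ipZl ipDr ipZr conjCK h1 h2.
exists (Normc.normc a * M1 + M2) => u; rewrite mulrDl.
apply: (le_trans (nrmD _ _)); apply: lerD => //.
by rewrite nrm_normZ -mulrA ler_wpM2l // normc_ge0.
Qed.

HB.instance Definition _ := GRing.isSubmodClosed.Build C (l2 -> l2) boppred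
  bop_submod.

Record bop := Bop { bopval :> l2 -> l2; _ : bopval \in boppred }.

HB.instance Definition _ := [isSub for bopval].
HB.instance Definition _ := [Choice of bop by <:].
HB.instance Definition _ := [SubChoice_isSubLmodule of bop by <:].

Implicit Types S T : bop.

Lemma bopP S : (exists T : l2 -> l2, adjoint S T) /\
  exists M : R, forall u, nrm (S u) <= M * nrm u.
Proof. by case: S => S hS; apply/asboolP; exact: hS. Qed.

Lemma bopD S T u : (S + T) u = S u + T u. Proof. by []. Qed.
Lemma bopZ (a : C) S u : (a *: S) u = a *: S u. Proof. by []. Qed.
Lemma bopN S u : (- S) u = - S u. Proof. by []. Qed.

Lemma bop_ext S T : (forall u, S u = T u) -> S = T.
Proof. by move=> h; apply: val_inj; apply/funext. Qed.

Lemma adjoint_sym (f g : l2 -> l2) : adjoint f g -> adjoint g f.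
Proof. by move=> h u v; rewrite ipC -h -ipC. Qed.

Lemma adjoint_linear (f g : l2 -> l2) : adjoint f g ->
  forall a u v, f (a *: u + v) = a *: f u + f v.
Proof. by move=> h a u v; apply: ip_injl => w; rewrite !(ipDl, ipZl, h). Qed.

(** The square |g u|^2 = <f (g u), u> is at most M |g u| |u|; then divide by |g u|. *)
Lemma adjoint_bounded (f g : l2 -> l2) (M : R) : adjoint f g ->
  (forall u, nrm (f u) <= M * nrm u) -> forall u, nrm (g u) <= M * nrm u.
Proof.
move=> h b u; have := nrm_ge0 (g u); rewrite le_eqVlt => /orP[/eqP g0|gp].
  by rewrite -g0; apply: le_trans (b u); exact: nrm_ge0.
rewrite -(ler_pM2l gp) -expr2 nrm_sq -lecR -ip_nsq -(adjoint_sym (adjoint_sym h)).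
apply: (@le_trans _ _ `|ip (f (g u)) u|).
  by rewrite ger0_norm // h ip_nsq lecR nsq_ge0.
apply: (le_trans (ip_le _ _)); rewrite lecR mulrCA mulrA.
by rewrite ler_wpM2r ?nrm_ge0 //; apply: le_trans (b _) _; rewrite mulrC.
Qed.

Definition opn S : R := sup [set nrm (S u) | u in [set u | nrm u <= 1]].

Lemma opn_has_sup S : has_sup [set nrm (S u) | u in [set u | nrm u <= 1]].
Proof.
have [_ [M b]] := bopP S; split.
  by exists (nrm (S 0)); exists 0 => //=; rewrite nrm0.
exists `|M| => _ [u /= u1 <-]; apply: (le_trans (b u)).
apply: (@le_trans _ _ (`|M| * nrm u)).
  by rewrite ler_wpM2r ?nrm_ge0 // ler_norm.
by rewrite -[leRHS]mulr1 ler_wpM2l.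
Qed.

Lemma opn_ge0 S : 0 <= opn S.
Proof.
apply: (@le_trans _ _ (nrm (S 0))); first exact: nrm_ge0.
by apply: ub_le_sup; [case: (opn_has_sup S) | exists 0 => //=; rewrite nrm0].
Qed.

Lemma bop_linear S a u v : S (a *: u + v) = a *: S u + S v.
Proof. by have [[T h] _] := bopP S; exact: (adjoint_linear h). Qed.

Lemma bop_0 S : S 0 = 0.
Proof. by have := bop_linear S 1 0 0; rewrite !scale1r addr0 -[LHS]addr0 => /addrI. Qed.

Lemma bop_scale S a u : S (a *: u) = a *: S u.
Proof. by rewrite -[a *: u]addr0 bop_linear bop_0 addr0. Qed.

Lemma opn_bound S u : nrm (S u) <= opn S * nrm u.
Proof.
have := nrm_ge0 u; rewrite le_eqVlt => /orP[/eqP u0|up].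
  by rewrite (nrm0_eq0 (esym u0)) bop_0 !nrm0 mulr0.
have c0 : 0 <= (nrm u)^-1 by rewrite invr_ge0 ltW.
have E v : nrm ((nrm u)^-1%:C *: v) = (nrm u)^-1 * nrm v.
  by rewrite nrm_normZ /= expr0n addr0 sqrtr_sqr ger0_norm.
have : nrm (S ((nrm u)^-1%:C *: u)) <= opn S.
  apply: ub_le_sup; first by case: (opn_has_sup S).
  by exists ((nrm u)^-1%:C *: u) => //=; rewrite E mulVf ?gt_eqF.
by rewrite bop_scale E ler_pdivrMl // mulrC.
Qed.

Lemma opn_le S (M : R) : 0 <= M -> (forall u, nrm (S u) <= M * nrm u) ->
  opn S <= M.
Proof.
move=> M0 h; apply: ge_sup; first by case: (opn_has_sup S).
move=> _ [u /= u1 <-]; apply: (le_trans (h u)).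
by rewrite -[leRHS]mulr1 ler_wpM2l.
Qed.

Lemma opnD S T : opn (S + T) <= opn S + opn T.
Proof.
apply: opn_le => [|u]; first by rewrite addr_ge0 ?opn_ge0.
rewrite bopD mulrDl; apply: (le_trans (nrmD _ _)).
by apply: lerD; exact: opn_bound.
Qed.

Lemma opnZ (a : C) S : (opn (a *: S))%:C = `|a| * (opn S)%:C.
Proof.
suff -> : opn (a *: S) = Normc.normc a * opn S by rewrite rmorphM.
have le b T : opn (b *: T) <= Normc.normc b * opn T.
  apply: opn_le => [|u]; first by rewrite mulr_ge0 ?opn_ge0 ?normc_ge0.
  by rewrite bopZ nrm_normZ -mulrA ler_wpM2l ?normc_ge0 // opn_bound.
apply/eqP; rewrite eq_le le /=.
have [->|a0] := eqVneq a 0; first by rewrite Normc.normc0 mul0r opn_ge0.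
have ap : 0 < Normc.normc a.
  rewrite lt_neqAle normc_ge0 andbT eq_sym; apply: contra a0 => /eqP h.
  by apply/eqP; exact: Normc.eq0_normc.
have := le a^-1 (a *: S); rewrite scalerA mulVf // scale1r Normc.normcV.
by rewrite ler_pdivlMl.
Qed.

Lemma opn0_eq0 S : opn S = 0 -> S = 0.
Proof.
move=> h; apply: bop_ext => u; apply: nrm0_eq0; apply/eqP.
by rewrite eq_le nrm_ge0 andbT (le_trans (opn_bound S u)) // h mul0r.
Qed.

Lemma complex_opnD S T : (opn (S + T))%:C <= (opn S)%:C + (opn T)%:C.
Proof. by rewrite -rmorphD lecR opnD. Qed.

Lemma complex_opn0_eq0 S : (opn S)%:C = 0 -> S = 0.
Proof. by move=> /complexI/opn0_eq0. Qed.

HB.instance Definition _ := Lmodule_isNormed.Build C bop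
  complex_opnD opnZ complex_opn0_eq0.

Lemma bop_normE S : `|S| = (opn S)%:C. Proof. by []. Qed.

Definition star_fun S : l2 -> l2 := proj1_sig (cid (proj1 (bopP S))).

Lemma star_funP S : adjoint S (star_fun S).
Proof. by rewrite /star_fun; case: cid. Qed.

Lemma star_bop S : star_fun S \in boppred.
Proof.
apply/asboolP; split; first by exists S; exact: (adjoint_sym (star_funP S)).
by exists (opn S); apply: (adjoint_bounded (star_funP S)); exact: opn_bound.
Qed.

Definition bstar S : bop := Bop (star_bop S).

Lemma bstarP S u v : ip (S u) v = ip u (bstar S v).
Proof. exact: star_funP. Qed.

Lemma bstarPr S u v : ip (bstar S u) v = ip u (S v).
Proof. exact: (adjoint_sym (star_funP S)). Qed.

Lemma comp_bop S T : S \o T \in boppred.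
Proof.
apply/asboolP; split.
  by exists (bstar T \o bstar S) => u v /=; rewrite !bstarP.
exists (opn S * opn T) => u /=; apply: (le_trans (opn_bound S (T u))).
by rewrite -mulrA ler_wpM2l ?opn_ge0 // opn_bound.
Qed.

Definition bmul S T : bop := Bop (comp_bop S T).

Lemma bmulE S T u : bmul S T u = S (T u). Proof. by []. Qed.

Lemma bstar_uniq S T : adjoint S T -> bstar S = T.
Proof. by move=> h; apply: bop_ext => u; apply: ip_injl => w; rewrite ipC -bstarP h -ipC. Qed.

Lemma opn_star_le S : opn (bstar S) <= opn S.
Proof.
apply: opn_le; first exact: opn_ge0.
exact: (adjoint_bounded (star_funP S) (opn_bound S)).
Qed.

Lemma bstarK S : bstar (bstar S) = S.
Proof. by apply: bstar_uniq => u v; rewrite bstarPr. Qed.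

Lemma opn_star S : opn (bstar S) = opn S.
Proof.
by apply/eqP; rewrite eq_le opn_star_le /= -{1}[S]bstarK opn_star_le.
Qed.

Lemma opnM S T : opn (bmul S T) <= opn S * opn T.
Proof.
apply: opn_le => [|u]; first by rewrite mulr_ge0 ?opn_ge0.
apply: (le_trans (opn_bound S (T u))).
by rewrite -mulrA ler_wpM2l ?opn_ge0 // opn_bound.
Qed.

(** For the inequality that is not submultiplicativity, |S u|^2 = <u, S^* S u> is bounded by
    Cauchy-Schwarz. *)
Lemma opn_cstar S : opn (bmul (bstar S) S) = opn S ^+ 2.
Proof.
apply/eqP; rewrite eq_le expr2 (le_trans (opnM _ _)) ?opn_star //=.
set K := opn (bmul _ _).
have : opn S <= Num.sqrt K.
  apply: opn_le => [|u]; first exact: sqrtr_ge0.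
  rewrite -(ler_pXn2r (ltn0Sn 1)) ?nnegrE ?mulr_ge0 ?sqrtr_ge0 ?nrm_ge0 //.
  rewrite exprMn !nrm_sq sqr_sqrtr ?opn_ge0 // -lecR -ip_nsq bstarP.
  rewrite -[X in X <= _]ger0_norm; last by rewrite -bstarP ip_nsq lecR nsq_ge0.
  apply: (le_trans (ip_le _ _)); rewrite lecR mulrC -nrm_sq expr2 mulrA.
  by apply: ler_wpM2r; [exact: nrm_ge0 | exact: (opn_bound (bmul (bstar S) S) u)].
rewrite -(ler_pXn2r (ltn0Sn 1)) ?nnegrE ?opn_ge0 ?sqrtr_ge0 //.
by rewrite sqr_sqrtr ?opn_ge0.
Qed.

End BoundedOperators.

(** * The C*-algebra of bounded operators *)

Section BoundedOperatorsComplete.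
Context (R : realType).
Local Notation C := R[i].
Local Notation l2 := (l2 R).
Local Notation bop := (bop R).
Implicit Types S T : bop.

Lemma le0_cvg0 (a b : R) (e : R^nat) : e @ \oo --> 0 ->
  (forall n, a <= e n * b) -> a <= 0.
Proof.
move=> e0 h.
have he : (fun n => e n * b) @ \oo --> 0.
  by rewrite -[X in _ --> X](mul0r b); apply: cvgMl.
have -> : 0 = lim ((fun n => e n * b) @ \oo) by rewrite (cvg_lim _ he).
by apply: limr_ge; [apply/cvg_ex; exists 0 | exact: nearW].
Qed.

(** The operators and their adjoints obey the same Cauchy estimate, so both have pointwise limits L
    and L'. They are adjoint to each other because the defect is at most [e n] times a constant for
    every n. *)
Lemma bop_cauchy_seq_cvg (S : nat -> bop) (e : R^nat) :
  (forall n m, (n <= m)%N -> opn (S m - S n) <= e n) -> e @ \oo --> 0 ->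
  exists L, forall n, opn (L - S n) <= e n.
Proof.
move=> Se e0.
have e_ge0 n : 0 <= e n by apply: le_trans (Se n n (leqnn n)); exact: opn_ge0.
have lim_ex (f : nat -> l2 -> l2) :
    (forall n m u, (n <= m)%N -> nrm (f m u - f n u) <= e n * nrm u) ->
    exists L : l2 -> l2, forall n u, nrm (L u - f n u) <= e n * nrm u.
  move=> fe.
  have ex u : exists v, forall n, nrm (v - f n u) <= e n * nrm u.
    apply: (@l2_complete _ (fun n => f n u) (fun n => e n * nrm u)).
      by move=> n m; exact: fe.
    by rewrite -[X in _ --> X](mul0r (nrm u)); apply: cvgMl.
  by exists (fun u => proj1_sig (cid (ex u))) => n u; case: cid.
have [L hL] : exists L : l2 -> l2, forall n u, nrm (L u - S n u) <= e n * nrm u.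
  apply: lim_ex => n m u nm; apply: (le_trans (opn_bound (S m - S n) u)).
  by apply: ler_wpM2r; [exact: nrm_ge0 | exact: Se].
have [L' hL'] : exists L : l2 -> l2,
    forall n u, nrm (L u - bstar (S n) u) <= e n * nrm u.
  apply: (lim_ex (fun n => bstar (S n))) => n m u nm.
  have h : adjoint (S m - S n) (fun v => bstar (S m) v - bstar (S n) v).
    by move=> v w; rewrite bopD bopN ipDl ipNl ipDr ipNr !bstarP.
  apply: (adjoint_bounded h) => {}u; apply: (le_trans (opn_bound (S m - S n) u)).
  by apply: ler_wpM2r; [exact: nrm_ge0 | exact: Se].
have LP : L \in @boppred R.
  apply/asboolP; split; last first.
    exists (e 0%N + opn (S 0%N)) => u; rewrite mulrDl -[L u](subrK (S 0%N u)).
    by apply: (le_trans (nrmD _ _)); apply: lerD; [exact: hL|exact: opn_bound].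
  exists L' => u v; apply/eqP; rewrite -subr_eq0; apply/eqP/Normc.eq0_normc/eqP.
  rewrite eq_le normc_ge0 andbT.
  apply: (@le0_cvg0 _ (2 * (nrm u * nrm v)) e e0) => n.
  have -> : ip (L u) v - ip u (L' v) =
      ip (L u - S n u) v - ip u (L' v - bstar (S n) v).
    by rewrite ipDl ipNl ipDr ipNr bstarP; ring.
  rewrite -(lecR (Normc.normc _)).
  apply: (le_trans (ler_normB (ip (L u - S n u) v) (ip u (L' v - bstar (S n) v)))).
  apply: (@le_trans _ _ (nrm (L u - S n u) * nrm v +
      nrm u * nrm (L' v - bstar (S n) v))%:C).
    by rewrite rmorphD; apply: lerD; exact: ip_le.
  rewrite lecR; have h1 := hL n u; have h2 := hL' n v.
  have h3 := ler_wpM2r (nrm_ge0 v) h1; have h4 := ler_wpM2l (nrm_ge0 u) h2.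
  by apply: (le_trans (lerD h3 h4)); rewrite le_eqVlt; apply/orP; left; apply/eqP; ring.
exists (Bop LP) => n; apply: opn_le => // u; exact: hL.
Qed.

(** A Cauchy filter is replaced by a sequence: [S n] is the centre of a ball of radius 2^-n in F.
    Any two of these balls meet because F is proper, which gives the rate 2 * 2^-n. *)
Lemma bop_complete (F : set_system bop) : ProperFilter F -> cauchy F -> cvg F.
Proof.
move=> FF /cauchyP Fc.
pose d (n : nat) : R := 2^-1 ^+ n.
have d0 n : 0 < d n by rewrite exprn_gt0.
have ex n : exists S : bop, F (ball S (d n)%:C) by apply: Fc; rewrite ltcR.
pose S n := proj1_sig (cid (ex n)).
have FS n : F (ball (S n) (d n)%:C) by rewrite /S; case: cid.
have dd n : \forall T \near F, opn (S n - T) < d n.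
  by apply: filterS (FS n) => T; rewrite -ball_normE /ball_ /= bop_normE ltcR.
have opnB (T T' : bop) : opn (T - T') = opn (T' - T).
  by apply: (@complexI R); rewrite -!bop_normE distrC.
have dcvg : (fun n => 2 * d n) @ \oo --> 0.
  rewrite -[X in _ --> X](mulr0 2); apply: cvgMr.
  by apply: cvg_expr; rewrite ger0_norm // invf_lt1 ?ltr1n.
have [|L hL] := @bop_cauchy_seq_cvg S (fun n => 2 * d n) _ dcvg.
  move=> n m nm; have [T [h1 h2]] := filter_ex (filterI (dd n) (dd m)).
  have dnm : d m <= d n by rewrite /d ler_wiXn2l // invf_le1 ?ler1n.
  have -> : S m - S n = (S m - T) + (T - S n) by rewrite addrA subrK.
  apply: (le_trans (opnD _ _)); rewrite (opnB T) mulr_natl mulr2n.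
  by apply: lerD; [exact: le_trans (ltW h2) dnm | exact: ltW].
apply/cvg_ex; exists L; apply/cvgrPdist_lt => eps eps0.
have [r er] : exists r : R, eps = r%:C.
  by exists (Re eps); rewrite RRe_real // gtr0_real.
move: eps0; rewrite er ltcR => r0.
(* Two of the three summands [d n] bound L - S n, the third bounds S n - T. *)
have [n hn] : exists n, 3 * d n < r.
  have [n _ hn] : \forall n \near \oo, 2 * d n < r / 2.
    by apply: (cvgr_lt _ dcvg); rewrite divr_gt0.
  have {}hn := hn n (leqnn n); exists n; have dn := d0 n.
  by move: (d n) dn hn => x; lra.
apply: filterS (dd n) => T hT; rewrite bop_normE ltcR.
have -> : L - T = (L - S n) + (S n - T) by rewrite addrA subrK.
apply: (le_lt_trans (opnD _ _)); move: (hL n) hT hn.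
by move: (opn _) (opn _) (d n) => x y z; lra.
Qed.

HB.instance Definition _ := Uniform_isComplete.Build bop bop_complete.

Lemma bmulA : associative (@bmul R).
Proof. by move=> S T U; exact: bop_ext. Qed.
Lemma bmulDl : left_distributive (@bmul R) +%R.
Proof. by move=> S T U; exact: bop_ext. Qed.
Lemma bmulDr : right_distributive (@bmul R) +%R.
Proof.
move=> S T U; apply: bop_ext => u; rewrite bopD !bmulE bopD.
by have := bop_linear S 1 (T u) (U u); rewrite !scale1r.
Qed.
Lemma bmulZl (k : C) S T : bmul (k *: S) T = k *: bmul S T.
Proof. exact: bop_ext. Qed.
Lemma bmulZr (k : C) S T : bmul S (k *: T) = k *: bmul S T.
Proof. by apply: bop_ext => u; rewrite bmulE !bopZ bop_scale. Qed.
Lemma bstarD S T : bstar (S + T) = bstar S + bstar T.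
Proof. by apply: bstar_uniq => u v; rewrite !bopD ipDl ipDr !bstarP. Qed.
Lemma bstarZ (k : C) S : bstar (k *: S) = k^* *: bstar S.
Proof.
by apply: bstar_uniq => u v; rewrite !bopZ ipZl ipZr conjCK bstarP.
Qed.
Lemma bstarM S T : bstar (bmul S T) = bmul (bstar T) (bstar S).
Proof. by apply: bstar_uniq => u v; rewrite !bmulE !bstarP. Qed.
Lemma bnormM S T : `|bmul S T| <= `|S| * `|T|.
Proof. by rewrite !bop_normE -rmorphM lecR opnM. Qed.
Lemma bnorm_star S : `|bmul (bstar S) S| = `|S| ^+ 2.
Proof. by rewrite !bop_normE opn_cstar rmorphXn. Qed.

HB.instance Definition _ := isCStarAlgebra.Build R bop bmulA bmulDl bmulDr
  bmulZl bmulZr (@bstarK R) bstarD bstarZ bstarM bnormM bnorm_star.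

End BoundedOperatorsComplete.

(** * Partial injections *)

(** The single law says that the graph of [pinvfun] is the transpose of the graph of [pfun]; this
    makes both injective on their domains. *)
Record pinj (X : countType) := PInj {
  pfun :> X -> option X;
  pinvfun : X -> option X;
  pinjP : forall x y, (pfun x == Some y) = (pinvfun y == Some x)
}.

Section PartialInjections.
Context (X : countType).
Implicit Types p q : pinj X.

Lemma pinv_subproof p x y : (pinvfun p x == Some y) = (p y == Some x).
Proof. by rewrite pinjP. Qed.

Definition pinj_inv p : pinj X := PInj (pinv_subproof p).

Lemma pcomp_subproof p q x y :
  (obind p (q x) == Some y) = (obind (pinvfun q) (pinvfun p y) == Some x).
Proof.
apply/idP/idP.
  case E: (q x) => [z|] //= /eqP; move/eqP: E; rewrite pinjP => /eqP E /eqP.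
  by rewrite pinjP => /eqP -> /=; rewrite E.
case E: (pinvfun p y) => [z|] //= /eqP; move/eqP: E; rewrite -pinjP => /eqP E /eqP.
by rewrite -pinjP => /eqP -> /=; rewrite E.
Qed.

Definition pinj_comp p q : pinj X := PInj (pcomp_subproof p q).

(** Points are moved into nat, so that all operators live on the same [l2]. Indices that code no
    point lie outside the domain. *)
Definition pickled (F : X -> option X) (n : nat) : option nat :=
  obind (fun x => omap pickle (F x)) (pickle_inv n).

Lemma pickled_subproof p n m :
  (pickled p n == Some m) = (pickled (pinvfun p) m == Some n).
Proof.
rewrite /pickled; apply/idP/idP.
  case En: (pickle_inv n) => [x|] //=; case Ex: (p x) => [y|] //= /eqP[<-].
  rewrite pickleK_inv /=; move/eqP: Ex; rewrite pinjP => /eqP -> /=.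
  by have := @pickle_invK X n; rewrite /oapp En => ->.
case En: (pickle_inv m) => [x|] //=; case Ex: (pinvfun p x) => [y|] //= /eqP[<-].
rewrite pickleK_inv /=; move/eqP: Ex; rewrite -pinjP => /eqP -> /=.
by have := @pickle_invK X m; rewrite /oapp En => ->.
Qed.

Definition npinj p : pinj nat := PInj (pickled_subproof p).

End PartialInjections.

(** * Operators induced by partial injections *)

Section ShiftOperators.
Context (R : realType).
Local Notation C := R[i].
Local Notation l2 := (l2 R).
Local Notation bop := (bop R).
Implicit Types (u v : l2) (p q : pinj nat).

(** Reading u along the inverse sends the basis vector at x to the one at p x, and to 0 where p is
    undefined. *)
Definition shift_fun p (u : nat -> C) (n : nat) : C := oapp u 0 (pinvfun p n).

Lemma option_sum (V : pzSemiRingType) (o : option nat) (M : nat) (F : nat -> V) :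
  (forall x, o = Some x -> (x < M)%N) ->
  \sum_(x < M) F x * (o == Some (x : nat))%:R = oapp F 0 o.
Proof.
case: o => [n|] h /=; last by rewrite big1 // => x _; rewrite mulr0.
have <- : \sum_(x < M) F x * (x == n :> nat)%:R = F n by rewrite delta_sum h.
by apply: eq_bigr => x _; rewrite (inj_eq (@Some_inj _)) eq_sym.
Qed.

(** Only coordinates below [M], a strict bound for the preimages of all n < K, contribute. After
    exchanging the sums each of them is counted at most once, since it has at most one image. *)
Lemma shift_partial_sum p u (K : nat) :
  \sum_(n < K) Re (`|shift_fun p u n| ^+ 2) <= nsq u.
Proof.
pose M := \max_(n < K) oapp S 0%N (pinvfun p n).
have hM (n : 'I_K) x : pinvfun p n = Some x -> (x < M)%N.
  move=> E; have := leq_bigmax (F := fun n : 'I_K => oapp S 0%N (pinvfun p n)) n.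
  by rewrite E.
apply: le_trans (nsq_ge_partial u M).
rewrite (eq_bigr (fun n : 'I_K => \sum_(x < M) Re (`|u x| ^+ 2) *
    (pinvfun p n == Some (x : nat))%:R)); last first.
  move=> n _; rewrite (option_sum (fun x => Re (`|u x| ^+ 2))); last exact: hM.
  rewrite /shift_fun; case: (pinvfun p n) => [x|]; first by [].
  by rewrite normr0 expr0n.
rewrite exchange_big /=; apply: ler_sum => x _.
rewrite -mulr_sumr -[leRHS]mulr1; apply: ler_wpM2l; first exact: Re_sqn_ge0.
under eq_bigr do rewrite -pinjP.
case E: (p x) => [y|]; last by rewrite big1.
rewrite (eq_bigr (fun n : 'I_K => 1 * (n == y :> nat)%:R)).
  by rewrite (delta_sum y K (fun=> 1)); case: ifP.
by move=> n _; rewrite mul1r eq_sym.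
Qed.

Lemma shift_l2 p u : shift_fun p u \in @l2pred R.
Proof.
apply/asboolP; exists (nsq u)%:C => K.
rewrite (eq_bigr _ (fun k _ => sqn_ReE _)) -rmorph_sum lecR.
exact: shift_partial_sum.
Qed.

Definition shift p u : l2 := L2 (shift_l2 p u).

Lemma shiftE p u n : shift p u n = oapp u 0 (pinvfun p n). Proof. by []. Qed.

Lemma shift_le p u : nrm (shift p u) <= nrm u.
Proof. by rewrite ler_wsqrtr //; apply: nsq_le => K; exact: shift_partial_sum. Qed.

Lemma shift_linear p a u v : shift p (a *: u + v) = a *: shift p u + shift p v.
Proof.
apply: l2_ext => n; rewrite l2D l2Z !shiftE.
by case: (pinvfun p n) => //=; rewrite mulr0 addr0.
Qed.

Lemma shift_delta p n :
  shift p (delta R n) = oapp (fun m => delta R m) 0 (p n).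
Proof.
apply: l2_ext => k; rewrite shiftE.
have := pinjP p n k; case: (p n) => [m|]; case: (pinvfun p k) => [j|] //=;
  rewrite /delta_fun ?(inj_eq (@Some_inj _)) => // h.
- by rewrite -h eq_sym.
- by rewrite eq_sym h.
- by rewrite -h.
Qed.

(** The defect D is linear in u and vanishes on basis vectors, hence on finitely supported vectors.
    Since |D w| is at most 2 |w| |v|, density gives the rest. *)
Lemma shift_adjoint p : adjoint (shift p) (shift (pinj_inv p)).
Proof.
move=> u v; apply/eqP; rewrite -subr_eq0; apply/eqP/Normc.eq0_normc/eqP.
pose D w : C := ip (shift p w) v - ip w (shift (pinj_inv p) v).
have D_lin a w w' : D (a *: w + w') = a * D w + D w'.
  by rewrite /D shift_linear !(ipDl, ipZl); ring.
have D0 : D 0 = 0.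
  by have := D_lin 1 0 0; rewrite scale1r addr0 mul1r -[LHS]addr0 => /addrI.
have Ddelta n : D (delta R n) = 0.
  rewrite /D shift_delta delta_ip shiftE /=.
  by case: (p n) => [m|] /=; rewrite ?delta_ip ?ip0l ?rmorph0 subrr.
have Dsum n : D (\sum_(k < n) u k *: delta R k) = 0.
  elim/big_ind: _ => [|a b a0 b0|k _] //.
    by rewrite -[a]scale1r D_lin a0 b0 mulr0 addr0.
  by rewrite -[_ *: _]addr0 D_lin D0 Ddelta mulr0 addr0.
rewrite eq_le normc_ge0 andbT -/(D u); apply: (@le0_cvg0 _ _ (nrm v *+ 2) (@harmonic R)) => [|n]; first exact: cvg_harmonic.
have [m hm] := l2_dense u (divr_gt0 ltr01 (ltr0Sn R n)).
set w := u - _ in hm.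
have -> : D u = D w by rewrite /w -[X in _ - X]scale1r -scaleNr addrC D_lin Dsum mulr0 add0r.
rewrite -(lecR (Normc.normc _)).
apply: (le_trans (ler_normB (ip (shift p w) v) (ip w (shift (pinj_inv p) v)))).
apply: (@le_trans _ _ (nrm (shift p w) * nrm v + nrm w * nrm (shift (pinj_inv p) v))%:C).
  by rewrite rmorphD; apply: lerD; exact: ip_le.
rewrite lecR; apply: (@le_trans _ _ (nrm w * nrm v + nrm w * nrm v)).
  apply: lerD; [apply: ler_wpM2r | apply: ler_wpM2l]; rewrite ?nrm_ge0 //;
  exact: shift_le.
rewrite -mulr2n -mulrnAr ler_wpM2r ?mulrn_wge0 ?nrm_ge0 //.
by apply: le_trans hm _; rewrite mul1r.
Qed.

Lemma shift_bop p : shift p \in @boppred R.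
Proof.
apply/asboolP; split; first by exists (shift (pinj_inv p)); exact: shift_adjoint.
by exists 1 => u; rewrite mul1r shift_le.
Qed.

Definition shift_op p : bop := Bop (shift_bop p).

Lemma shift_opM p q : shift_op p ∗ shift_op q = shift_op (pinj_comp p q).
Proof.
apply: bop_ext => u; apply: l2_ext => n; rewrite [LHS]shiftE [RHS]shiftE /=.
by case: (pinvfun p n).
Qed.

Lemma shift_op_star p : (shift_op p)^† = shift_op (pinj_inv p).
Proof. by apply: bstar_uniq; exact: shift_adjoint. Qed.

End ShiftOperators.

Section PartialInjectionOperators.
Context (R : realType) (X : countType).
Implicit Types (p q : pinj X) (x y : X).

Definition pinj_op p : bop R := shift_op R (npinj p).

Lemma eq_pinj_op p q : (forall x, pinvfun p x = pinvfun q x) -> pinj_op p = pinj_op q.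
Proof.
move=> h; apply: bop_ext => u; apply: l2_ext => n.
by rewrite !shiftE /= /pickled; case: (pickle_inv n) => //= x; rewrite h.
Qed.

Lemma pinj_opM p q : pinj_op p ∗ pinj_op q = pinj_op (pinj_comp p q).
Proof.
rewrite /pinj_op shift_opM; apply: bop_ext => u; apply: l2_ext => n.
rewrite !shiftE /= /pickled; case: (pickle_inv n) => //= x.
by case: (pinvfun p x) => //= y; rewrite pickleK_inv.
Qed.

Lemma pinj_op_star p : (pinj_op p)^† = pinj_op (pinj_inv p).
Proof. by rewrite /pinj_op shift_op_star; apply: bop_ext => u; apply: l2_ext. Qed.

Definition coef x y (S : bop R) : R[i] := S (delta R (pickle y)) (pickle x).

Lemma coef_pinj_op x y p : coef x y (pinj_op p) = (p y == Some x)%:R.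
Proof.
rewrite /coef [LHS]shiftE /= /pickled pickleK_inv /= pinjP.
case: (pinvfun p x) => //= z.
by rewrite /delta_fun (inj_eq (pcan_inj pickleK_inv)) (inj_eq (@Some_inj _)).
Qed.

Lemma pinj_op0 p : (forall x, pinvfun p x = None) -> pinj_op p = 0.
Proof.
move=> h; apply: bop_ext => u; apply: l2_ext => n; rewrite shiftE /= /pickled.
by case: (pickle_inv n) => //= x; rewrite h.
Qed.

End PartialInjectionOperators.

(** * A representation of a graph algebra *)

Section GraphAction.
Context (G : digraph).
Implicit Types (v w : vert G) (e f : edge G).

Definition gpoint : countType := ((vert G * nat) * int)%type.

Definition out v : seq (edge G) := enum [pred e | src e == v].
Definition idx e : nat := index e (out (src e)).

Lemma mem_out v e : (e \in out v) = (src e == v).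
Proof. by rewrite mem_enum. Qed.

Lemma idx_lt e : (idx e < size (out (src e)))%N.
Proof. by rewrite index_mem mem_out. Qed.

(* The fibre over a vertex v is v * nat * int. The fibre over a vertex that is
   not a sink is cut into one piece for each edge leaving it by the residue of
   the middle coordinate; the last coordinate records the degree, so that two
   paths that agree on some point have the same length. *)
Definition edge_map e (x : gpoint) : gpoint :=
  (src e, (x.1.2 * size (out (src e)) + idx e)%N, x.2 + 1).

Definition edge_fun e (x : gpoint) : option gpoint :=
  if x.1.1 == rng e then Some (edge_map e x) else None.

(** Division with remainder undoes [edge_map]. The degree is an integer rather than a natural number
    so that it can always be lowered. *)
Definition edge_inv e (x : gpoint) : option gpoint :=
  if (x.1.1 == src e) && (x.1.2 %% size (out (src e)) == idx e)%N
  then Some (rng e, (x.1.2 %/ size (out (src e)))%N, x.2 - 1) else None.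

Lemma edge_subproof e x y : (edge_fun e x == Some y) = (edge_inv e y == Some x).
Proof.
case: x y => [[w n] m] [[v n'] m']; rewrite /edge_fun /edge_inv /=.
have k0 : (0 < size (out (src e)))%N by apply: leq_trans (idx_lt e).
apply/idP/idP.
  case: ifP => // /eqP -> /eqP[<- <- <-].
  rewrite eqxx /= modnMDl modn_small ?idx_lt // eqxx divnMDl // divn_small ?idx_lt //.
  by rewrite addn0 addrK.
case: ifP => // /andP[/eqP -> /eqP h] /eqP[<- <- <-].
by rewrite eqxx /edge_map /= -h -divn_eq subrK.
Qed.

Definition pedge e : pinj gpoint := PInj (edge_subproof e).

Definition vert_fun v (x : gpoint) : option gpoint :=
  if x.1.1 == v then Some x else None.

Lemma vert_subproof v x y : (vert_fun v x == Some y) = (vert_fun v y == Some x).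
Proof.
rewrite /vert_fun; apply/idP/idP; case: ifP => // h /eqP[<-]; by rewrite h.
Qed.

Definition pvert v : pinj gpoint := PInj (vert_subproof v).

Lemma edge_invK e f x : x.1.1 = rng f ->
  edge_inv e (edge_map f x) = if e == f then Some x else None.
Proof.
move=> xf; case: eqP => [->|ef].
  have : edge_fun f x == Some (edge_map f x) by rewrite /edge_fun xf eqxx.
  by rewrite edge_subproof => /eqP.
rewrite /edge_inv /edge_map /=; case: eqP => //= sef.
rewrite -sef modnMDl modn_small ?idx_lt //; case: eqP => // h; case: ef.
have := nth_index e (_ : e \in out (src e)); rewrite mem_out eqxx => /(_ isT) <-.
have := nth_index e (_ : f \in out (src f)); rewrite mem_out eqxx => /(_ isT) <-.
by rewrite -/(idx f) -/(idx e) h sef.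
Qed.

Lemma edge_inv_inj e f x : edge_inv e x -> edge_inv f x -> e = f.
Proof.
case: x => [[v n] m]; rewrite /edge_inv /=.
case: andP => // -[/eqP -> /eqP h] _; case: andP => // -[/eqP h1 /eqP h2] _.
have := nth_index e (_ : e \in out (src e)); rewrite mem_out eqxx => /(_ isT) <-.
have := nth_index e (_ : f \in out (src f)); rewrite mem_out eqxx => /(_ isT) <-.
by rewrite -/(idx f) -/(idx e) -h -h2 h1.
Qed.

Lemma edge_inv_ex v x : nonsink v -> x.1.1 = v ->
  exists2 e, src e = v & edge_inv e x.
Proof.
case=> e0 se0; case: x => [[w n] m] /= ->.
have k0 : (0 < size (out v))%N by rewrite -se0; apply: leq_trans (idx_lt e0).
pose e := nth e0 (out v) (n %% size (out v)).
have eo : e \in out v by rewrite mem_nth // ltn_mod.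
have se : src e = v by apply/eqP; rewrite -mem_out.
exists e => //; rewrite /edge_inv /= se eqxx /= /idx se index_uniq ?eqxx ?ltn_mod //.
exact: enum_uniq.
Qed.

Fixpoint pwalk v (es : seq (edge G)) : pinj gpoint :=
  if es is e :: es' then pinj_comp (pedge e) (pwalk (rng e) es') else pvert v.

Lemma pwalk_degree v es x y : pwalk v es x = Some y -> y.2 = x.2 + (size es)%:Z.
Proof.
elim: es v y => [|e es IH] v y /=.
  by rewrite /vert_fun; case: ifP => // _ [<-]; rewrite addr0.
case E: (pwalk _ _ _) => [z|] //=; rewrite /edge_fun; case: ifP => // _ [<-] /=.
by rewrite (IH _ _ E) intS -addrA (addrC 1).
Qed.

Lemma pwalk_inv_vert v es x : is_walk v es -> pinvfun (pwalk v es) x -> x.1.1 = v.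
Proof.
case: es => [|e es] /=; first by rewrite /vert_fun; case: eqP.
case/andP => /eqP <- _; rewrite /edge_inv.
by case: andP => // -[/eqP].
Qed.

(** A path is read off a point in its range edge by edge: [edge_inv_inj] determines the first edge,
    and the induction continues at the point pulled back along it. *)
Lemma pwalk_inj v w es fs x : is_walk v es -> is_walk w fs -> size es = size fs ->
  pinvfun (pwalk v es) x -> pinvfun (pwalk w fs) x -> (v, es) = (w, fs).
Proof.
elim: es fs v w x => [|e es IH] [|f fs] v w x // wv ww.
  by move=> _ h1 h2; rewrite -(pwalk_inv_vert wv h1) -(pwalk_inv_vert ww h2).
move=> [sz] h1 h2.
have vw : v = w by rewrite -(pwalk_inv_vert wv h1) -(pwalk_inv_vert ww h2).
move: wv ww h1 h2 => /= /andP[_ wv] /andP[_ ww].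
case Ee: (edge_inv e x) => [y|] //=; case Ef: (edge_inv f x) => [z|] //= h1 h2.
have ef : e = f by apply: (@edge_inv_inj e f x); rewrite ?Ee ?Ef.
move: wv ww h1 h2 Ef; rewrite -ef Ee => wv ww h1 h2 [yz].
by rewrite -yz in h2; have [->] := (IH _ _ _ _ wv ww sz h1 h2); rewrite vw.
Qed.

(** If the product fixes x, both walks send the same point y to x. Comparing degrees, they have
    equal length, and [pwalk_inj] identifies them. *)
Lemma pwalk_fix v w es fs x : is_walk v es -> is_walk w fs ->
  (pinj_comp (pwalk v es) (pinj_inv (pwalk w fs)) x == Some x) =
  ((v, es) == (w, fs)) && isSome (pinvfun (pwalk v es) x).
Proof.
move=> wv ww /=; apply/idP/idP; last first.
  case/andP => /eqP[<- <-]; case E: (pinvfun _ x) => [y|] //= _.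
  by rewrite pinjP E.
case E: (pinvfun (pwalk w fs) x) => [y|] //= /eqP h.
have E' : pwalk w fs y = Some x by apply/eqP; rewrite pinjP E.
have h' : pinvfun (pwalk v es) x = Some y by apply/eqP; rewrite -pinjP h.
rewrite h' andbT; apply/eqP; apply: (@pwalk_inj _ _ _ _ x) => //; last 2 first.
- by rewrite h'.
- by rewrite E.
have := pwalk_degree h; rewrite (pwalk_degree E') => /addrI[] //.
Qed.

End GraphAction.

Section GraphRepresentation.
Context (R : realType) (G : digraph).
Implicit Types (v w : vert G) (e f : edge G).

Definition repfam : graph_family G (bop R) :=
  GraphFamily (fun v => pinj_op R (pvert v)) (fun e => pinj_op R (pedge e)).

Lemma obind_inv (X : countType) (p : pinj X) x :
  obind (pinvfun p) (p x) = if p x then Some x else None.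
Proof. by case E: (p x) => [y|] //=; apply/eqP; rewrite -pinjP E. Qed.

Lemma pinj_op_partial_isometry (X : countType) (p : pinj X) :
  pinj_op R p ∗ (pinj_op R p)^† ∗ pinj_op R p = pinj_op R p.
Proof.
rewrite pinj_op_star !pinj_opM; apply: eq_pinj_op => x /=.
case E: (pinvfun p x) => [y|] //=.
have -> : p y = Some x by apply/eqP; rewrite pinjP E.
by rewrite /= E.
Qed.

Lemma bop_sumE (I : Type) (r : seq I) (P : pred I) (F : I -> bop R) u :
  (\sum_(i <- r | P i) F i) u = \sum_(i <- r | P i) F i u.
Proof. by elim/big_rec2: _ => // i a b _ <-. Qed.

Lemma l2_sumE (I : Type) (r : seq I) (P : pred I) (F : I -> l2 R) n :
  (\sum_(i <- r | P i) F i) n = \sum_(i <- r | P i) F i n.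
Proof. by elim/big_rec2: _ => // i a b _ <-. Qed.

Lemma repfam_rel : is_graph_family repfam.
Proof.
split => /=.
- move=> v; split; last by rewrite pinj_op_star; exact: eq_pinj_op.
  rewrite pinj_opM; apply: eq_pinj_op => x /=.
  by rewrite /vert_fun; case: ifP => //= h; rewrite h.
- move=> v w vw; rewrite pinj_opM; apply: pinj_op0 => x /=.
  by rewrite /vert_fun; case: eqP => //= ->; rewrite (negPf vw).
- by move=> e; exact: pinj_op_partial_isometry.
- move=> e; rewrite pinj_op_star pinj_opM; apply: eq_pinj_op => x.
  rewrite [LHS](obind_inv (pedge e)) /= /edge_fun /vert_fun.
  by case: (_ == _).
(* The sum is compared coordinate by coordinate: a point over the nonsink v lies in the range of
   exactly one edge leaving v, and only that term survives. *)
- move=> v nv; apply: bop_ext => u; apply: l2_ext => n.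
  rewrite bop_sumE l2_sumE (eq_bigr (fun e => if pickle_inv n is Some x then
     (edge_inv e x : bool)%:R * u n else 0)); last first.
    move=> e _; rewrite pinj_op_star pinj_opM !shiftE /= /pickled.
    have := @pickle_invK (gpoint G) n.
    case: (pickle_inv n) => [x|] //= <-.
    have := obind_inv (pinj_inv (pedge e)) x => /= ->.
    by case: (edge_inv e x) => [y|] /=; rewrite ?mul1r ?mul0r.
  rewrite shiftE /= /pickled; have := @pickle_invK (gpoint G) n.
  case: (pickle_inv n) => [x|] /= xn; last by rewrite big1.
  rewrite /vert_fun; case: eqP => [xv|xv] /=.
    have [e se ex] := edge_inv_ex nv xv.
    rewrite (bigD1 e) ?se //= ex mul1r big1 ?addr0 ?xn // => f /andP[_ fe].
    case fx: (edge_inv f x) => [y|] /=; last by rewrite mul0r.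
    by move/eqP: fe; case; apply: (@edge_inv_inj _ _ _ x); rewrite ?fx.
  rewrite big1 // => e /eqP se; rewrite /edge_inv se.
  by case: eqP => //=; rewrite mul0r.
Qed.

End GraphRepresentation.

(** * Projections in a C*-algebra *)

Section CStarBasics.
Context (R : realType) (A : cstarAlgType R).
Implicit Types (a b p q h x : A) (z : R[i]).

Lemma cmul0l a : 0 ∗ a = 0.
Proof. by rewrite -[X in X ∗ _](scale0r (0 : A)) cmulZl scale0r. Qed.
Lemma cmul0r a : a ∗ 0 = 0.
Proof. by rewrite -[X in _ ∗ X](scale0r (0 : A)) cmulZr scale0r. Qed.
Lemma cmulNl a b : (- a) ∗ b = - (a ∗ b).
Proof. by rewrite -scaleN1r cmulZl scaleN1r. Qed.
Lemma cmulNr a b : a ∗ (- b) = - (a ∗ b).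
Proof. by rewrite -scaleN1r cmulZr scaleN1r. Qed.
Lemma cmulBl a b c : (a - b) ∗ c = a ∗ c - b ∗ c.
Proof. by rewrite cmulDl cmulNl. Qed.
Lemma cmulBr a b c : a ∗ (b - c) = a ∗ b - a ∗ c.
Proof. by rewrite cmulDr cmulNr. Qed.
Lemma cstar0 : (0 : A)^† = 0.
Proof. by rewrite -[X in X^†](scale0r (0 : A)) cstarZ rmorph0 scale0r. Qed.
Lemma cstarN a : (- a)^† = - a^†.
Proof. by rewrite -scaleN1r cstarZ rmorphN rmorph1 scaleN1r. Qed.

Lemma cmul_suml (I : Type) (r : seq I) (P : pred I) (F : I -> A) a :
  (\sum_(i <- r | P i) F i) ∗ a = \sum_(i <- r | P i) F i ∗ a.
Proof. by elim/big_rec2: _ => [|i x y _ <-]; rewrite ?cmul0l ?cmulDl. Qed.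

Lemma cmul_sumr (I : Type) (r : seq I) (P : pred I) (F : I -> A) a :
  a ∗ (\sum_(i <- r | P i) F i) = \sum_(i <- r | P i) a ∗ F i.
Proof. by elim/big_rec2: _ => [|i x y _ <-]; rewrite ?cmul0r ?cmulDr. Qed.

Lemma cstar_sum (I : Type) (r : seq I) (P : pred I) (F : I -> A) :
  (\sum_(i <- r | P i) F i)^† = \sum_(i <- r | P i) (F i)^†.
Proof. by elim/big_rec2: _ => [|i x y _ <-]; rewrite ?cstar0 ?cstarD. Qed.

Lemma cstar_mul_eq0 a : a^† ∗ a = 0 -> a = 0.
Proof.
move=> h; apply/normr0_eq0; have := cnorm_star a.
by rewrite h normr0 => /esym/eqP; rewrite expf_eq0 /= => /eqP.
Qed.

Lemma sqr_norm_le1 a : `|a^† ∗ a| <= 1 -> `|a| <= 1.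
Proof. by rewrite cnorm_star expr_le1. Qed.

Lemma cproj_norm_le1 p : is_cproj p -> `|p| <= 1.
Proof.
case=> pp ps; have := cnorm_star p; rewrite ps pp => E.
have [->|p0] := eqVneq `|p| 0; first exact: ler01.
have : `|p| * 1 = `|p| * `|p| by rewrite mulr1 -expr2.
by move/(mulfI p0) => <-.
Qed.

(* The unit of the corner p A p is an extreme point of its unit ball. The
   C*-identity bounds p + i h, and averaging the squares of p + z h and
   p + i z h enlarges the radius by |1 + i| at each step. *)
Lemma hermitian_extreme p h : is_cproj p -> p ∗ h = h -> h ∗ p = h ->
  h^† = h -> `|p + h| <= 1 -> `|p - h| <= 1 -> h = 0.
Proof.
move=> pP ph hp hs h1 h2; have [pp ps] := pP.
have sq z : (p + z *: h) ∗ (p + z *: h) =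
    p + (2 * z) *: h + (z * z) *: (h ∗ h).
  rewrite cmulDl !cmulDr !cmulZl !cmulZr pp ph hp scalerA.
  by rewrite addrA -(addrA p) -scalerDl -mulr2n mulr_natl.
have mul_le1 a b : `|a| <= 1 -> `|b| <= 1 -> `|a ∗ b| <= 1.
  by move=> a1 b1; apply: (le_trans (cnormM _ _)); rewrite mulr_ile1.
have half_le1 a b x : `|a| <= 1 -> `|b| <= 1 -> 2 *: x = a + b -> `|x| <= 1.
  move=> a1 b1 E; rewrite -(ler_pM2l (ltr0n _ 2)) mulr1.
  have -> : 2 * `|x| = `|2 *: x| by rewrite normrZ normr_nat.
  by rewrite E (le_trans (ler_normD _ _)) // lerD.
pose P z := `|p + z *: h| <= 1.
have P1 : P 1 by rewrite /P scale1r.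
have PN1 : P (-1) by rewrite /P scaleN1r.
(* This element is the average of the squares of p + h and p - h, and it is also a^† ∗ a for a = p +
   i h. *)
have Psq : `|p + h ∗ h| <= 1.
  apply: (half_le1 _ _ _ (mul_le1 _ _ P1 P1) (mul_le1 _ _ PN1 PN1)).
  rewrite !sq mulrN1 mulNr mulrN opprK !mulr1 scalerDr !scale1r addrACA.
  rewrite (addrACA p) -scalerDl subrr scale0r addr0.
  by rewrite -(scale1r p) -(scale1r (h ∗ h)) -!scalerDl !scalerA mulr1.
have Pimag z : z^* = - z -> z * z = -1 -> P z.
  move=> zc zz; apply: sqr_norm_le1.
  rewrite cstarD cstarZ ps hs zc cmulDl !cmulDr !cmulZl !cmulZr pp ph hp.
  rewrite !scalerA mulNr zz opprK scale1r.
  by rewrite addrA -(addrA p) -scalerDl subrr scale0r addr0.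
have ii : 'i%C * 'i%C = -1 :> R[i] by rewrite -expr2 sqr_i.
have iJ : ('i%C : R[i])^* = - 'i%C by apply/eqP; rewrite eq_complex /= oppr0 !eqxx.
have Pi : P 'i%C by apply: Pimag.
have PNi : P (- 'i%C) by apply: Pimag; [rewrite conjN iJ | rewrite mulrNN].
have step z : P z -> P ('i%C * z) -> P ((1 + 'i%C) * z).
  move=> Pz Piz.
  apply: (half_le1 _ _ _ (mul_le1 _ _ Pz Pz) (mul_le1 _ _ Piz Piz)).
  rewrite !sq addrACA -scalerDl.
  have -> : z * z + 'i%C * z * ('i%C * z) = 0.
    by rewrite mulrACA ii mulN1r subrr.
  rewrite scale0r addr0 addrACA -scalerDl scalerDr scalerA.
  congr (_ + _ *: h); first by rewrite -(scale1r p) scalerA -scalerDl mulr1.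
  by ring.
have Pik k : P ('i%C ^+ k).
  suff : P ('i%C ^+ k) /\ P ('i%C ^+ k.+1) /\ P ('i%C ^+ k.+2) /\ P ('i%C ^+ k.+3) by case.
  elim: k => [|k [p0 [p1 [p2 p3]]]]; last first.
    split=> //; split=> //; split=> //.
    suff -> : 'i%C ^+ k.+4 = 'i%C ^+ k :> R[i] by [].
    by rewrite -addn4 exprD (exprM _ 2 2) sqr_i sqrrN expr1n mulr1.
  by rewrite !exprS expr0 !mulr1 ii mulrN1.
(* The induction hypothesis covers all k, because [step] asks for the bound at z and at i z. *)
have Pn n k : P ('i%C ^+ k * (1 + 'i%C) ^+ n).
  elim: n k => [|n IH] k; first by rewrite mulr1.
  rewrite exprS mulrCA; apply: step => //.
  by rewrite mulrA -exprS.
have hn n : `|h| <= (2^-1 ^+ n)%:C * 2.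
  (* Even exponents give the modulus 2^n, without square roots. *)
  have := Pn n.*2 0%N; rewrite expr0 mul1r /P => Pe.
  have : `|(1 + 'i%C) ^+ n.*2 *: h| <= 2.
    rewrite -(addKr p (_ *: h)) addrC.
    apply: (le_trans (ler_normB _ _)).
    by rewrite -[2]/(1 + 1); apply: lerD => //; exact: cproj_norm_le1.
  rewrite normrZ -muln2 mulnC exprM normrX.
  have -> : `|(1 + 'i%C) ^+ 2 : R[i]| = 2.
    have -> : (1 + 'i%C) ^+ 2 = 2 * 'i%C :> R[i] by rewrite sqrrD sqr_i; ring.
    rewrite normrM normr_nat normc_def /= expr0n expr1n add0r sqrtr1; exact: mulr1.
  have -> : (2^-1 ^+ n)%:C = (2 ^+ n)^-1 :> R[i].
    by rewrite rmorphXn fmorphV rmorph_nat exprVn.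
  by rewrite ler_pdivlMl ?exprn_gt0 // ltr0n.
apply/normr0_eq0/eqP; rewrite eq_le normr_ge0 andbT.
have hE : `|h| = (Re `|h|)%:C by rewrite RRe_real // normr_real.
rewrite hE -[0]/(0%:C) lecR; apply: (@le0_cvg0 _ _ 2 (fun n => 2^-1 ^+ n)).
  by apply: cvg_expr; rewrite ger0_norm // invf_lt1 ?ltr1n.
move=> n; rewrite -lecR -hE rmorphM rmorph_nat; exact: hn.
Qed.

(** Let n be the number of indices other than j, and c = 2 / (n + 1). Since the h_i sum to 0, p + c
    h_j is the average of p and the n elements p - 2 h_i with i <> j, while p - c h_j is the average
    of n copies of p and of p - 2 h_j. Both lie in the unit ball, so [hermitian_extreme] applies to
    c h_j. *)
Lemma corner_sum_eq0 (I : finType) (Q : pred I) p (h : I -> A) : is_cproj p ->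
  (forall i, Q i -> [/\ p ∗ h i = h i, h i ∗ p = h i, (h i)^† = h i &
     `|p - 2 *: h i| <= 1]) ->
  \sum_(i | Q i) h i = 0 -> forall j, Q j -> h j = 0.
Proof.
move=> pP hP s0 j Qj; have [ph hp hs hj] := hP j Qj.
have p1 := cproj_norm_le1 pP.
pose n := #|[pred i | Q i && (i != j)]|.
have np : 0 < n.+1%:R :> R[i] by rewrite ltr0Sn.
pose c : R[i] := 2 / n.+1%:R.
have scaleE a x : n.+1%:R *: a = x -> `|x| <= n.+1%:R -> `|a| <= 1.
  move=> <-; rewrite normrZ normr_nat => h1.
  by rewrite -(ler_pM2l np) mulr1.
have cE : n.+1%:R * c = 2 by rewrite mulrC divfK // gt_eqF.
suff : c *: h j = 0.
  move/eqP; rewrite scaler_eq0 => /orP[/eqP c0|/eqP //].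
  by move: cE; rewrite c0 mulr0 => /esym/eqP; rewrite pnatr_eq0.
apply: (@hermitian_extreme p) => //.
- by rewrite cmulZr ph.
- by rewrite cmulZl hp.
- by rewrite cstarZ hs rmorphM fmorphV !rmorph_nat.
- apply: (scaleE _ (p + \sum_(i | Q i && (i != j)) (p - 2 *: h i))).
    rewrite scalerDr scalerA cE big_split /= sumrN -scaler_sumr.
    have -> : \sum_(i | Q i && (i != j)) h i = - h j.
      by move: s0; rewrite (bigD1 j) //= => /eqP; rewrite addrC addr_eq0 => /eqP.
    rewrite scalerN opprK addrA; congr (_ + _).
    by rewrite sumr_const scaler_nat mulrS.
  apply: (le_trans (ler_normD _ _)); rewrite -(natr1 n) [leRHS]addrC; apply: lerD => //.
  apply: (le_trans (ler_norm_sum _ _ _)); rewrite /n -sumr_const.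
  by apply: ler_sum => i /andP[Qi _]; case: (hP i Qi).
- apply: (scaleE _ (p *+ n + (p - 2 *: h j))).
    rewrite scalerBr scalerA cE addrA scaler_nat; congr (_ - _).
    by rewrite mulrSr.
  apply: (le_trans (ler_normD _ _)); rewrite -(natr1 n); apply: lerD => //.
  by rewrite normrMn; apply: ler_wMn2r.
Qed.

(* Orthogonality of the range projections of distinct edges with the same
   source is not among the defining relations; it follows from this. The usual
   proof uses that a vanishing sum of positive elements has vanishing terms;
   here the bound on p - 2 p q p replaces positivity. *)
Lemma sum_cproj_orthogonal (I : finType) (Q : pred I) (p : I -> A) :
  (forall i, Q i -> is_cproj (p i)) -> is_cproj (\sum_(i | Q i) p i) ->
  forall i j, Q i -> Q j -> i != j -> p i ∗ p j = 0.
Proof.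
move=> pP; set P := \sum_(i | Q i) p i => PP i j Qi Qj ij.
have [pp ps] := pP j Qj.
have corner q : is_cproj q -> `|p j - 2 *: (p j ∗ q ∗ p j)| <= 1.
  move=> [qq qs].
  have -> : p j - 2 *: (p j ∗ q ∗ p j) = p j ∗ (p j - 2 *: (q ∗ p j)).
    by rewrite cmulBr cmulZr pp cmulA.
  apply: (le_trans (cnormM _ _)).
  apply: mulr_ile1 => //; first exact: cproj_norm_le1.
  apply: sqr_norm_le1.
  (* Formally p_j - 2 q p_j is the reflection 1 - 2 q applied to p_j, hence a partial isometry with
     initial projection p_j. *)
  suff -> : (p j - 2 *: (q ∗ p j))^† ∗ (p j - 2 *: (q ∗ p j)) = p j.
    by apply: cproj_norm_le1; exact: pP.
  rewrite cstarD cstarN cstarZ cstarM rmorph_nat ps qs cmulBl !cmulBr.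
  rewrite pp !cmulZr !cmulZl !cmulA -(cmulA _ q q) qq scalerA -scalerBl.
  rewrite -addrA -opprD -scalerDl (_ : 2 + _ = 0 :> R[i]); last by ring.
  by rewrite scale0r subr0.
(* The entry at j makes the total vanish: the other terms add up to p_j P p_j - p_j. Its norm
   condition is that of the projection P, up to sign. *)
pose h k := if k == j then p j - p j ∗ P ∗ p j else p j ∗ p k ∗ p j.
have hP k : Q k -> [/\ p j ∗ h k = h k, h k ∗ p j = h k, (h k)^† = h k &
     `|p j - 2 *: h k| <= 1].
  rewrite /h; case: eqP => [_ _|_ Qk].
    have [PP1 PP2] := PP; split.
    - by rewrite cmulBr !cmulA pp.
    - by rewrite cmulBl -!cmulA pp.
    - by rewrite cstarD cstarN !cstarM ps PP2 cmulA.
    - rewrite scalerBr opprB addrC -addrA.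
      have -> : - (2 *: p j) + p j = - p j.
        by rewrite scaler_nat mulr2n opprD subrK.
      by rewrite -normrN opprB; exact: corner.
  have [qq qs] := pP k Qk; split.
  - by rewrite !cmulA pp.
  - by rewrite -!cmulA pp.
  - by rewrite !cstarM ps qs cmulA.
  - by apply: corner; exact: pP.
have h0 : \sum_(k | Q k) h k = 0.
  rewrite (bigD1 j) //= {1}/h eqxx.
  rewrite (eq_bigr (fun k => p j ∗ p k ∗ p j)); last first.
    by move=> k /andP[_ /negPf kj]; rewrite /h kj.
  rewrite -cmul_suml -cmul_sumr [P](bigD1 j) //= cmulDr cmulDl !pp.
  by rewrite opprD addrA subrr add0r addNr.
(* The vanishing element p_j p_i p_j is a^† ∗ a for a = p_i p_j. *)
have := corner_sum_eq0 (pP j Qj) hP h0 Qi; rewrite /h (negPf ij) => E.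
apply: cstar_mul_eq0; have [qq qs] := pP i Qi.
by rewrite cstarM ps qs cmulA -(cmulA (p j)) qq.
Qed.

End CStarBasics.

(** * Relations in a graph algebra *)

Section GraphFamilyRelations.
Context (R : realType) (G : digraph) (A : cstarAlgType R).
Context (F : graph_family G A) (FP : is_graph_family F).
Implicit Types (v w : vert G) (e f : edge G) (es fs : seq (edge G)).
Local Notation P := (gP F).
Local Notation S := (gS F).

Lemma gP_star v : (P v)^† = P v.
Proof. by case: FP => h _ _ _ _; case: (h v). Qed.

Lemma gPP v w : P v ∗ P w = if v == w then P v else 0.
Proof.
case: FP => h h' _ _ _; case: eqP => [<-|/eqP]; first by case: (h v).
exact: h'.
Qed.

Lemma gS_partial e : S e ∗ (S e)^† ∗ S e = S e.
Proof. by case: FP => _ _ h _ _; exact: h. Qed.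

Lemma gSSr e : (S e)^† ∗ S e = P (rng e).
Proof. by case: FP => _ _ _ h _; exact: h. Qed.

Lemma gS_rng e : S e ∗ P (rng e) = S e.
Proof. by rewrite -gSSr cmulA gS_partial. Qed.

Lemma gSS_cproj e : is_cproj (S e ∗ (S e)^†).
Proof.
by split; [rewrite cmulA gS_partial | rewrite cstarM cstarK].
Qed.

(** The range projections of the edges leaving a vertex sum to its projection, so
    [sum_cproj_orthogonal] makes them orthogonal; S_e and S_f absorb their own range projections. *)
Lemma gSS_orthogonal e f : src e = src f -> e != f -> (S e)^† ∗ S f = 0.
Proof.
move=> ef nef; have [h _ _ _ hs] := FP.
have ss : is_cproj (\sum_(d | src d == src e) S d ∗ (S d)^†).
  by rewrite -hs; [exact: h | exists e].
have := sum_cproj_orthogonal (fun d _ => gSS_cproj d) ss (eqxx _) _ nef.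
rewrite -ef eqxx => /(_ isT) E.
have he : (S e)^† = (S e)^† ∗ S e ∗ (S e)^†.
  by rewrite -{1}(gS_partial e) !cstarM cstarK cmulA.
have -> : (S e)^† ∗ S f = (S e)^† ∗ (S e ∗ (S e)^† ∗ (S f ∗ (S f)^†)) ∗ S f.
  rewrite !cmulA -he -(cmulA _ (S f) (S f)^†) -(cmulA _ (S f ∗ _)).
  by rewrite gS_partial.
by rewrite E cmul0r cmul0l.
Qed.

Lemma gP_gS v e : P v ∗ S e = if src e == v then S e else 0.
Proof.
have E : P (src e) ∗ S e = S e.
  have [_ _ _ _ ->] := FP; last by exists e.
  rewrite cmul_suml (bigD1 e) //= gS_partial big1 ?addr0 // => f /andP[/eqP sf fe].
  by rewrite -cmulA gSS_orthogonal ?cmul0r.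
rewrite -{1}E cmulA gPP eq_sym; case: eqP => [<- //|_]; by rewrite ?E ?cmul0l.
Qed.

Lemma gS_gS e f : (S e)^† ∗ S f = if e == f then P (rng e) else 0.
Proof.
case: eqP => [<-|/eqP nef]; first exact: gSSr.
have [ef|nsf] := eqVneq (src e) (src f); first exact: gSS_orthogonal.
have : P (src e) ∗ S f = 0 by rewrite gP_gS eq_sym (negPf nsf).
have <- : P (src e) ∗ S e = S e by rewrite gP_gS eqxx.
by rewrite cstarM gP_star -cmulA => ->; rewrite cmul0r.
Qed.

(** The vertex v matters for the empty word only. Ending every word with a vertex projection treats
    all lengths alike; by [gS_rng] the extra factor changes nothing after an edge. *)
Fixpoint sword v es : A :=
  if es is e :: es' then S e ∗ sword (rng e) es' else P v.

Definition wend v es : vert G := last v (map (@rng G) es).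

Lemma gP_sword v w es : is_walk v es ->
  P w ∗ sword v es = if v == w then sword v es else 0.
Proof.
case: es => [_|e es] /=; first by rewrite gPP eq_sym; case: eqP => // ->.
case/andP => /eqP <- _; rewrite cmulA gP_gS; case: eqP => // _.
by rewrite cmul0l.
Qed.

Lemma gS_sword e v es : is_walk v es ->
  S e ∗ sword v es = if rng e == v then sword (src e) (e :: es) else 0.
Proof.
move=> wv; case: eqP => [<- //|nv]; rewrite -gS_rng -cmulA gP_sword //.
by case: eqP => [/esym //|_]; rewrite cmul0r.
Qed.

Lemma gS_star_sword e v f es : is_walk v (f :: es) ->
  (S e)^† ∗ sword v (f :: es) = if e == f then sword (rng e) es else 0.
Proof.
case/andP => _ wf; rewrite /= cmulA gS_gS; case: eqP => [->|_].
  by rewrite gP_sword // eqxx.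
by rewrite cmul0l.
Qed.

Lemma sword_wend v es : is_walk v es -> sword v es ∗ P (wend v es) = sword v es.
Proof.
elim: es v => [|e es IH] v /=; first by rewrite gPP eqxx.
by case/andP => _ we; rewrite -cmulA IH.
Qed.

Lemma sword_gS v es e : is_walk v es -> src e = wend v es ->
  sword v es ∗ S e = sword v (rcons es e).
Proof.
elim: es v => [|f es IH] v /=; first by rewrite gS_rng gP_gS => _ ->; rewrite eqxx.
by case/andP => _ wf se; rewrite -cmulA IH.
Qed.

Lemma is_walk_rcons v es e : is_walk v es -> src e = wend v es ->
  is_walk v (rcons es e).
Proof.
elim: es v => [|f es IH] v /=; first by rewrite /wend /= => _ ->; rewrite eqxx.
by case/andP => -> wf se /=; exact: IH.
Qed.

Lemma wend_rcons v es e : wend v (rcons es e) = rng e.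
Proof. by rewrite /wend map_rcons last_rcons. Qed.

Definition gmonomial (x : A) := exists v es w fs,
  [/\ is_walk v es, is_walk w fs, wend v es = wend w fs &
      x = sword v es ∗ (sword w fs)^†].

(** A product of monomials may vanish; with 0 added, the set is closed under multiplication. *)
Definition gmonomial0 (x : A) := x = 0 \/ gmonomial x.

Lemma gmonomial_star x : gmonomial x -> gmonomial x^†.
Proof.
move=> [v [es [w [fs [wv ww E ->]]]]]; exists w, fs, v, es; split => //.
by rewrite cstarM cstarK.
Qed.

Lemma gmonomial0_star x : gmonomial0 x -> gmonomial0 x^†.
Proof. by case=> [->|/gmonomial_star]; [left; rewrite cstar0|right]. Qed.

Lemma gmonomial0_gP v x : gmonomial0 x -> gmonomial0 (P v ∗ x).
Proof.
case=> [->|[u [es [w [fs [wv ww E ->]]]]]]; first by left; rewrite cmul0r.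
rewrite cmulA gP_sword //; case: eqP => _; last by left; rewrite cmul0l.
by right; exists u, es, w, fs.
Qed.

Lemma gmonomial0_gS e x : gmonomial0 x -> gmonomial0 (S e ∗ x).
Proof.
case=> [->|[u [es [w [fs [wv ww E ->]]]]]]; first by left; rewrite cmul0r.
rewrite cmulA gS_sword //; case: eqP => re; last by left; rewrite cmul0l.
move: wv E; rewrite -re => wv E.
by right; exists (src e), (e :: es), w, fs; split => //=; rewrite eqxx.
Qed.

Lemma gmonomial0_gS_star e x : gmonomial0 x -> gmonomial0 ((S e)^† ∗ x).
Proof.
case=> [->|[u [es [w [fs [wv ww E ->]]]]]]; first by left; rewrite cmul0r.
case: es wv E => [_ E|f es wv E]; rewrite cmulA; last first.
  rewrite gS_star_sword //; case: eqP => ef; last by left; rewrite cmul0l.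
  right; exists (rng e), es, w, fs; split => //.
  - by move: wv => /andP[_]; rewrite ef.
  - by rewrite -E /wend /= ef.
(* With an empty word on the left, the adjoint of S_e joins the starred word, which becomes
   [rcons fs e]. *)
have -> : (S e)^† ∗ sword u [::] = if src e == u then (S e)^† else 0.
  rewrite /= -(gP_star u) -cstarM gP_gS; case: eqP => // _; exact: cstar0.
case: eqP => su; last by left; rewrite cmul0l.
right; exists (rng e), [::], w, (rcons fs e); split => //=.
- by apply: is_walk_rcons => //; rewrite -E.
- by rewrite wend_rcons.
rewrite -cstarM sword_gS // -?E //.
rewrite -[in RHS](gP_star (rng e)) -cstarM -{1}(wend_rcons w fs e) sword_wend //.
by apply: is_walk_rcons => //; rewrite -E.
Qed.

Lemma gmonomial0_sword v es x : gmonomial0 x -> gmonomial0 (sword v es ∗ x).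
Proof.
elim: es v => [|e es IH] v hx /=; first exact: gmonomial0_gP.
by rewrite -cmulA; apply: gmonomial0_gS; exact: IH.
Qed.

Lemma gmonomial0_sword_star v es x : gmonomial0 x ->
  gmonomial0 ((sword v es)^† ∗ x).
Proof.
elim: es v x => [|e es IH] v x hx /=; first by rewrite gP_star; exact: gmonomial0_gP.
by rewrite cstarM -cmulA; apply: IH; exact: gmonomial0_gS_star.
Qed.

Lemma gmonomial0M x y : gmonomial0 x -> gmonomial0 y -> gmonomial0 (x ∗ y).
Proof.
case=> [-> _|[u [es [w [fs [_ _ _ ->]]]]] hy]; first by left; rewrite cmul0l.
rewrite -cmulA; apply: gmonomial0_sword; exact: gmonomial0_sword_star.
Qed.

Lemma gP_gmonomial v : gmonomial (P v).
Proof. by exists v, [::], v, [::]; split => //=; rewrite gP_star gPP eqxx. Qed.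

Lemma gS_gmonomial e : gmonomial (S e).
Proof.
exists (src e), [:: e], (rng e), [::]; split => //=; first by rewrite eqxx.
by rewrite gP_star -cmulA gPP eqxx gS_rng.
Qed.

End GraphFamilyRelations.

(** * The unit of a graph algebra *)

Section GraphAlgebraUnit.
Context (R : realType) (G : digraph) (A : graph_cstar R G).
Local Notation P := (gP (gc_fam A)).
Local Notation S := (gS (gc_fam A)).
Let FP := gc_rel A.

Lemma cmul_continuousl (D : cstarAlgType R) (a : D) : continuous (cmul a).
Proof.
move=> x; apply/cvgrPdist_lt => e e0; near=> y.
rewrite -cmulBr; apply: (le_lt_trans (cnormM _ _)).
have a1 : 0 < `|a| + 1 by rewrite ltr_wpDl.
apply: (@le_lt_trans _ _ ((`|a| + 1) * `|x - y|)).
  by rewrite ler_wpM2r // lerDl.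
rewrite -ltr_pdivlMl //; near: y; apply: cvgr_dist_lt => //.
by rewrite mulr_gt0 // invr_gt0.
Unshelve. all: by end_near. Qed.

Lemma cmul_continuousr (D : cstarAlgType R) (a : D) : continuous (fun x : D => x ∗ a).
Proof.
move=> x; apply/cvgrPdist_lt => e e0; near=> y.
rewrite -cmulBl; apply: (le_lt_trans (cnormM _ _)); rewrite mulrC.
have a1 : 0 < `|a| + 1 by rewrite ltr_wpDl.
apply: (@le_lt_trans _ _ ((`|a| + 1) * `|x - y|)).
  by rewrite ler_wpM2r // lerDl.
rewrite -ltr_pdivlMl //; near: y; apply: cvgr_dist_lt => //.
by rewrite mulr_gt0 // invr_gt0.
Unshelve. all: by end_near. Qed.

Lemma closed_fixed_points (D : cstarAlgType R) (f : D -> D) : continuous f ->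
  closed [set a | f a = a].
Proof.
move=> fc.
have -> : [set a | f a = a] = (fun a => f a - a) @^-1` [set 0].
  apply/seteqP; split => a /= h; first by rewrite h subrr.
  by apply/eqP; rewrite -subr_eq0; apply/eqP.
apply: preimage_closed; first by move=> a _; apply: cvgB => //; exact: fc.
by apply: accessible_closed_set1; apply: hausdorff_accessible; exact: norm_hausdorff.
Qed.

Definition gunit : A := \sum_v P v.

(** The elements that [gunit] fixes from both sides form a closed star subalgebra containing the
    generators, hence everything. *)
Lemma gunitP : is_cunit gunit.
Proof.
pose X := [set a : A | gunit ∗ a = a] `&` [set a : A | a ∗ gunit = a].
have us : gunit^† = gunit.
  by rewrite cstar_sum; apply: eq_bigr => v _; exact: gP_star.
have uP v : gunit ∗ P v = P v.
  rewrite cmul_suml (bigD1 v) //= gPP // eqxx big1 ?addr0 // => w /negPf wv.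
  by rewrite gPP // wv.
have Pu v : P v ∗ gunit = P v by rewrite -(gP_star FP v) -us -cstarM uP.
suff XT : X = setT by move=> a; have [] : X a by rewrite XT.
apply: (@gc_generated _ _ A); last 2 first.
- by move=> v; split; [exact: uP | exact: Pu].
- move=> e; split => /=; last first.
    by rewrite -(gS_rng FP) -cmulA Pu.
  rewrite cmul_suml (bigD1 (src e)) //= gP_gS // eqxx big1 ?addr0 // => w.
  by rewrite gP_gS // eq_sym => /negPf ->.
split.
  apply: closedI.
    exact: closed_fixed_points (@cmul_continuousl _ gunit).
  exact: closed_fixed_points (@cmul_continuousr _ gunit).
split.
- by split => /=; rewrite ?cmul0l ?cmul0r.
- by move=> a b [/= h1 h2] [/= h3 h4]; split => /=; rewrite ?cmulDl ?cmulDr ?h1 ?h2 ?h3 ?h4.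
- by move=> k a [/= h1 h2]; split => /=; rewrite ?cmulZl ?cmulZr ?h1 ?h2.
- by move=> a b [/= h1 h2] [/= h3 h4]; split => /=; rewrite ?cmulA ?h1 // -cmulA h4.
- move=> a [/= h1 h2]; split => /=.
    by rewrite -us -cstarM h2.
  by rewrite -us -cstarM h1.
Qed.

Lemma cunitE : cunit A = gunit.
Proof.
rewrite /cunit; case: xgetP => [u _ uP|h]; last by case: (h gunit gunitP).
by have [h1 _] := uP gunit; have [_ h2] := gunitP u; rewrite -h1 h2.
Qed.

Lemma cunitP : is_cunit (cunit A).
Proof. by rewrite cunitE; exact: gunitP. Qed.

Lemma cunit1l (a : A) : cunit A ∗ a = a. Proof. by have [] := cunitP a. Qed.
Lemma cunit1r (a : A) : a ∗ cunit A = a. Proof. by have [] := cunitP a. Qed.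

Lemma cunit_star : (cunit A)^† = cunit A.
Proof. by rewrite -[LHS]cunit1r -{2}(cstarK (cunit A)) -cstarM cunit1r cstarK. Qed.

End GraphAlgebraUnit.

(** * The functional of a graph weight *)

Section PathMeasure.
Context (R : realType) (G : digraph).
Context (g : vert G -> R) (lam : edge G -> R) (gw : graph_weight g lam).
Implicit Types (v w : vert G) (e f : edge G) (es fs : seq (edge G)).
Implicit Types (h : gpoint G -> R[i]).

(* Approximates the integral over the paths from v of the measure giving to the
   cylinder of mu the mass lam(mu) g(r(mu)): each cylinder of depth N is
   replaced by an atom at one of its points. *)
Fixpoint meas (N : nat) v h : R[i] :=
  if N is N'.+1 then
    if out v is [::] then (g v)%:C * h (v, 0%N, 0)
    else \sum_(e | src e == v) (lam e)%:C * meas N' (rng e) (h \o edge_map e)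
  else (g v)%:C * h (v, 0%N, 0).

Lemma eq_meas N v h h' : (forall x, x.1.1 = v -> h x = h' x) ->
  meas N v h = meas N v h'.
Proof.
elim: N v h h' => [|N IH] v h h' E /=; first by rewrite E.
case: (out v) => [|_ _]; first by rewrite E.
by apply: eq_bigr => e /eqP se; congr (_ * _); apply: IH => x _; exact: E.
Qed.

Lemma meas_linear N v (k : R[i]) h h' :
  meas N v (fun x => k * h x + h' x) = k * meas N v h + meas N v h'.
Proof.
elim: N v h h' => [|N IH] v h h' /=; first by ring.
case: (out v) => [|_ _]; first by ring.
rewrite mulr_sumr -big_split; apply: eq_bigr => e _ /=.
by rewrite (IH (rng e) (h \o edge_map e) (h' \o edge_map e)); ring.
Qed.

Lemma meas0 N v : meas N v (fun=> 0) = 0.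
Proof.
transitivity (meas N v (fun=> -1 * 0 + 0)).
  by apply: eq_meas => x _; rewrite mulr0 addr0.
by rewrite (meas_linear N v (-1) (fun=> 0) (fun=> 0)) mulN1r addNr.
Qed.

Lemma meas_ge0 N v h : (forall x, 0 <= h x) -> 0 <= meas N v h.
Proof.
case: gw => g0 l0 _; elim: N v h => [|N IH] v h h0 /=.
  by rewrite mulr_ge0 // lecR.
case: (out v) => [|_ _]; first by rewrite mulr_ge0 // lecR.
by apply: sumr_ge0 => e _; rewrite mulr_ge0 ?lecR // IH // => x /=.
Qed.

Lemma meas_cst N v : meas N v (fun=> 1) = (g v)%:C.
Proof.
elim: N v => [|N IH] v /=; first by rewrite mulr1.
case E: (out v) => [|e0 s]; first by rewrite mulr1.
have nv : nonsink v.
  by exists e0; apply/eqP; rewrite -mem_out E mem_head.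
case: gw => _ _ -> //; rewrite rmorph_sum; apply: eq_bigr => e _.
by rewrite (IH (rng e)) rmorphM.
Qed.

Definition pweight v es : R := (\prod_(e <- es) lam e) * g (wend v es).

(** Moving the mass of a cylinder of depth N to one of its points does not change the mass of the
    cylinders of smaller depth, so the value is exact. In the induction only the summand of the
    first edge of the walk survives. *)
Lemma meas_walk N u v es : is_walk v es -> (size es <= N)%N ->
  meas N u (fun x => (isSome (pinvfun (pwalk v es) x))%:R) =
  (u == v)%:R * (pweight v es)%:C.
Proof.
elim: es N u v => [|e es IH] N u v wv sN.
  rewrite (@eq_meas _ _ _ (fun=> (u == v)%:R * 1 + 0)) => [|x /= <-].
    rewrite meas_linear meas_cst meas0 /pweight big_nil mul1r /wend /=.
    by case: eqP => [->|_]; rewrite addr0 // !mul0r.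
  by rewrite /vert_fun addr0 mulr1; case: (_ == v).
case: N sN => // N sN; move: wv => /= /andP[/eqP sv wv].
have nonout : out (src e) <> [::] by move=> h; have := mem_out (src e) e; rewrite h eqxx.
(* A sink u differs from v, the source of e, and the single atom over u lies outside the range of
   e. *)
case E: (out u) => [|e0 s].
  have -> : (u == v) = false by apply/eqP => uv; apply: nonout; rewrite sv -uv.
  rewrite mul0r /edge_inv /=; case: eqP => [su|_] /=; last by rewrite mulr0.
  by case: nonout; rewrite -su.
transitivity (\sum_(f | src f == u) (f == e)%:R * ((u == v)%:R * (pweight v (e :: es))%:C)).
  apply: eq_bigr => f /eqP sf.
  rewrite (@eq_meas _ _ _ (fun x => (f == e)%:R * (isSome (pinvfun (pwalk (rng e) es) x))%:R + 0)).
    rewrite meas_linear (IH N) // meas0.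
    case: eqP => [fe|_]; last by rewrite mul0r addr0 mulr0 mul0r.
    rewrite fe eqxx !mul1r addr0 -sf fe sv eqxx mul1r -rmorphM.
    by rewrite /pweight big_cons mulrA.
  move=> x xf /=; rewrite edge_invK // eq_sym; case: eqP => _ /=.
    by rewrite mul1r addr0.
  by rewrite mul0r addr0.
rewrite -mulr_suml; case: eqP => [uv|_]; last by rewrite mul0r mulr0.
rewrite (bigD1 e) /= ?sv ?uv // eqxx big1 ?addr0 ?mul1r // => f /andP[_ /negPf ->].
by [].
Qed.

Definition tmeas N h : R[i] := \sum_v meas N v h.

Lemma tmeas_linear N (k : R[i]) h h' :
  tmeas N (fun x => k * h x + h' x) = k * tmeas N h + tmeas N h'.
Proof.
by rewrite /tmeas mulr_sumr -big_split; apply: eq_bigr => v _; rewrite meas_linear.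
Qed.

Lemma eq_tmeas N h h' : h =1 h' -> tmeas N h = tmeas N h'.
Proof. by move=> E; apply: eq_bigr => v _; apply: eq_meas. Qed.

Lemma tmeas0 N : tmeas N (fun=> 0) = 0.
Proof. by rewrite /tmeas big1 // => v _; exact: meas0. Qed.

Lemma tmeasZ N k h : tmeas N (fun x => k * h x) = k * tmeas N h.
Proof.
transitivity (tmeas N (fun x => k * h x + 0)).
  by apply: eq_tmeas => x; rewrite addr0.
by rewrite (tmeas_linear N k h (fun=> 0)) tmeas0 addr0.
Qed.

Lemma tmeas_sum N (I : Type) (r : seq I) (F : I -> gpoint G -> R[i]) :
  tmeas N (fun x => \sum_(i <- r) F i x) = \sum_(i <- r) tmeas N (F i).
Proof.
elim: r => [|i r IH].
  by rewrite big_nil -[RHS](tmeas0 N); apply: eq_tmeas => x; rewrite big_nil.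
rewrite big_cons -IH -[X in _ = X + _]mul1r -tmeas_linear.
by apply: eq_tmeas => x; rewrite big_cons mul1r.
Qed.

Lemma tmeas_ge0 N h : (forall x, 0 <= h x) -> 0 <= tmeas N h.
Proof. by move=> h0; apply: sumr_ge0 => v _; exact: meas_ge0. Qed.

Lemma tmeas_walk N v es : is_walk v es -> (size es <= N)%N ->
  tmeas N (fun x => (isSome (pinvfun (pwalk v es) x))%:R) = (pweight v es)%:C.
Proof.
move=> wv sN; rewrite /tmeas (bigD1 v) //= meas_walk // eqxx mul1r.
by rewrite big1 ?addr0 // => u /negPf uv; rewrite meas_walk // uv mul0r.
Qed.

End PathMeasure.

(* The eventual value of s, and 0 if s is not eventually constant. *)
Definition evlim (R : realType) (s : nat -> R[i]) : R[i] :=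
  xget 0 [set c | exists N0, forall N, (N0 <= N)%N -> s N = c].

Lemma evlimP (R : realType) (s : nat -> R[i]) c :
  (exists N0, forall N, (N0 <= N)%N -> s N = c) -> evlim s = c.
Proof.
move=> [N1 h1]; rewrite /evlim; case: xgetP => [d _ [N0 h0]|h]; last first.
  by case: (h c); exists N1.
by rewrite -(h0 (maxn N0 N1)) ?leq_maxl // h1 ?leq_maxr.
Qed.

(** * The functional on a graph algebra and its KMS relation *)

Section GraphState.
Context (R : realType) (G : digraph) (A : graph_cstar R G).
Implicit Types (v w : vert G) (e f : edge G) (es fs : seq (edge G)) (a b : A).
Local Notation F := (gc_fam A).

Definition rep : A -> bop R :=
  proj1_sig (cid (gc_universal A (repfam_rel R G))).

Lemma rep_starhom : is_starhom rep.
Proof. by rewrite /rep; case: cid => f /= []. Qed.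

Lemma rep_gP v : rep (gP F v) = pinj_op R (pvert v).
Proof. by rewrite /rep; case: cid => f /= []. Qed.

Lemma rep_gS e : rep (gS F e) = pinj_op R (pedge e).
Proof. by rewrite /rep; case: cid => f /= []. Qed.

Lemma repM a b : rep (a ∗ b) = rep a ∗ rep b.
Proof. by case: rep_starhom. Qed.

Lemma rep_star a : rep a^† = (rep a)^†.
Proof. by case: rep_starhom. Qed.

Lemma rep_sword v es : rep (sword F v es) = pinj_op R (pwalk v es).
Proof.
elim: es v => [|e es IH] v /=; first exact: rep_gP.
by rewrite repM rep_gS IH pinj_opM.
Qed.

Definition dcoef (x : gpoint G) a : R[i] := coef x x (rep a).

Lemma dcoefD x a b : dcoef x (a + b) = dcoef x a + dcoef x b.
Proof. by rewrite /dcoef; case: rep_starhom => -> _ _ _. Qed.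

Lemma dcoefZ x (k : R[i]) a : dcoef x (k *: a) = k * dcoef x a.
Proof. by rewrite /dcoef; case: rep_starhom => _ -> _ _. Qed.

Lemma dcoef_sword x v es w fs : is_walk v es -> is_walk w fs ->
  dcoef x (sword F v es ∗ (sword F w fs)^†) =
  ((v, es) == (w, fs))%:R * (isSome (pinvfun (pwalk v es) x))%:R.
Proof.
move=> wv ww; rewrite /dcoef repM rep_star !rep_sword pinj_op_star pinj_opM coef_pinj_op.
by rewrite pwalk_fix // -mulnb natrM.
Qed.

Lemma rep_gmonomial a : gmonomial F a -> exists p : pinj (gpoint G), rep a = pinj_op R p.
Proof.
move=> [v [es [w [fs [_ _ _ ->]]]]]; rewrite repM rep_star !rep_sword.
by rewrite pinj_op_star pinj_opM; eexists.
Qed.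

(** The coefficient is the inner product of the images of the basis vector at x under b and under a,
    each of them a basis vector or 0. *)
Lemma dcoef_star_mul x a b (p q : pinj (gpoint G)) : rep a = pinj_op R p -> rep b = pinj_op R q ->
  dcoef x (a^† ∗ b) = ((p x == q x) && isSome (p x))%:R.
Proof.
move=> ap bq; rewrite /dcoef repM rep_star ap bq pinj_op_star pinj_opM coef_pinj_op /=.
congr (nat_of_bool _)%:R; case E: (q x) => [y|] /=; last by rewrite andbC; case: (p x).
by rewrite -(pinjP p x y); case: (p x) => [z|] //=; rewrite andbT.
Qed.

Lemma dcoef_gP v : dcoef (v, 0%N, 0) (gP F v) = 1.
Proof. by rewrite /dcoef rep_gP coef_pinj_op /= /vert_fun /= !eqxx. Qed.

Context (g : vert G -> R) (lam : edge G -> R) (gw : graph_weight g lam).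

Definition phiN N a : R[i] := tmeas g lam N (fun x => dcoef x a).

Lemma phiND N a b : phiN N (a + b) = phiN N a + phiN N b.
Proof.
rewrite /phiN -[X in _ = X + _]mul1r -tmeas_linear.
by apply: eq_tmeas => x; rewrite dcoefD mul1r.
Qed.

Lemma phiNZ N (k : R[i]) a : phiN N (k *: a) = k * phiN N a.
Proof. by rewrite /phiN -tmeasZ; apply: eq_tmeas => x; rewrite dcoefZ. Qed.

Lemma phiN0 N : phiN N 0 = 0.
Proof. by rewrite -(scale0r 0) phiNZ mul0r. Qed.

Lemma phiN_sword N v es w fs : is_walk v es -> is_walk w fs ->
  (size es <= N)%N ->
  phiN N (sword F v es ∗ (sword F w fs)^†) =
  ((v, es) == (w, fs))%:R * (pweight g lam v es)%:C.
Proof.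
move=> wv ww sN; rewrite -(tmeas_walk gw wv sN) -tmeasZ.
by apply: eq_tmeas => x; rewrite dcoef_sword.
Qed.

(** The values need not stabilise outside the span of the monomials, so the properties below are
    stated for a single monomial or 0. *)
Definition phi a : R[i] := evlim (fun N => phiN N a).

Lemma phi0 : phi 0 = 0.
Proof. by apply: evlimP; exists 0%N => N _; rewrite phiN0. Qed.

Lemma phi_sword v es w fs : is_walk v es -> is_walk w fs ->
  phi (sword F v es ∗ (sword F w fs)^†) =
  ((v, es) == (w, fs))%:R * (pweight g lam v es)%:C.
Proof.
by move=> wv ww; apply: evlimP; exists (size es) => N sN; exact: phiN_sword.
Qed.

Lemma phi_stable a : gmonomial0 F a ->
  exists N0, forall N, (N0 <= N)%N -> phiN N a = phi a.
Proof.
case=> [->|[v [es [w [fs [wv ww _ ->]]]]]].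
  by exists 0%N => N _; rewrite phiN0 phi0.
by exists (size es) => N sN; rewrite phi_sword // phiN_sword.
Qed.

(** No conjugation appears because the values on monomials are real. *)
Lemma phi_star a : gmonomial0 F a -> phi a^† = phi a.
Proof.
case=> [->|[v [es [w [fs [wv ww _ ->]]]]]]; first by rewrite cstar0.
rewrite cstarM cstarK !phi_sword // eq_sym; case: eqP => [[-> ->] //|_].
by rewrite !mul0r.
Qed.

Lemma phi_gP v a : gmonomial0 F a -> phi (gP F v ∗ a) = phi (a ∗ gP F v).
Proof.
have FP := gc_rel A.
case=> [->|[u [es [w [fs [wu ww E ->]]]]]]; first by rewrite cmul0l cmul0r.
have -> : sword F u es ∗ (sword F w fs)^† ∗ gP F v =
    sword F u es ∗ (gP F v ∗ sword F w fs)^†.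
  by rewrite cstarM (gP_star FP) cmulA.
rewrite cmulA !(gP_sword FP) //.
case: (eqVneq u v) => [uv|uv]; case: (eqVneq w v) => [wv|wv] //.
- by rewrite cstar0 cmul0r phi0 phi_sword // uv xpair_eqE eq_sym (negPf wv) mul0r.
- by rewrite cmul0l phi0 phi_sword // wv xpair_eqE (negPf uv) mul0r.
- by rewrite cstar0 cmul0r cmul0l.
Qed.

(** For a = S_mu S_nu^*, either side can be nonzero only if nu = e mu: on the left e is put in front
    of mu, on the right it is removed from nu. The weights of e mu and of mu differ by the factor
    lam(e). *)
Lemma phi_gS e a : gmonomial0 F a ->
  phi (gS F e ∗ a) = (lam e)%:C * phi (a ∗ gS F e).
Proof.
have FP := gc_rel A.
case=> [->|[u [es [w [fs [wu ww E ->]]]]]].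
  by rewrite cmul0l cmul0r phi0 mulr0.
rewrite cmulA (gS_sword FP) //.
have we : rng e = u -> is_walk (src e) (e :: es) by move=> re; rewrite /= re eqxx.
case: fs ww E => [_|f fs ww] E.
  (* When nu is a vertex, both sides vanish: each product is 0 or a monomial whose two paths have
     different lengths. *)
  have -> : phi ((if rng e == u then sword F (src e) (e :: es) else 0) ∗
      (sword F w [::])^†) = 0.
    case: eqP => re; last by rewrite cmul0l phi0.
    by rewrite phi_sword ?we // xpair_eqE andbF mul0r.
  rewrite -cmulA (gP_star FP) (gP_gS FP).
  case: eqP => se; last by rewrite cmul0r phi0 mulr0.
  rewrite (sword_gS FP) //; last by rewrite E.
  have wr : is_walk u (rcons es e) by apply: is_walk_rcons => //; rewrite E.
  rewrite -(sword_wend FP wr) wend_rcons -[gP F _](gP_star FP).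
  rewrite -/(sword F (rng e) [::]) phi_sword // xpair_eqE andbC.
  by case: es {wu we E wr} => [|? ?]; rewrite ?mul0r ?mulr0.
have -> : sword F u es ∗ (sword F w (f :: fs))^† ∗ gS F e =
    sword F u es ∗ ((gS F e)^† ∗ sword F w (f :: fs))^†.
  by rewrite cstarM cstarK cmulA.
rewrite (gS_star_sword FP) //.
have /andP[/eqP sf wf] : (src f == w) && is_walk (rng f) fs by [].
case: (eqVneq e f) => [ef|ef]; last first.
  rewrite cstar0 cmul0r phi0 mulr0.
  case: eqP => re; last by rewrite cmul0l phi0.
  by rewrite phi_sword ?we // xpair_eqE eqseq_cons (negPf ef) andbF mul0r.
rewrite phi_sword //; last by rewrite ef.
case: eqP => re; last first.
  rewrite cmul0l phi0 xpair_eqE (_ : (u == rng e) = false) ?mul0r ?mulr0 //.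
  by apply/eqP => ur; exact: re.
rewrite phi_sword ?we // !xpair_eqE eqseq_cons ef eqxx sf -ef re !eqxx /=.
rewrite mulrCA -rmorphM /pweight big_cons mulrA.
by rewrite -[wend w _]/(wend (rng e) es) re.
Qed.

Definition lprod es : R[i] := \prod_(e <- es) (lam e)%:C.

Lemma phi_swordC v es a : gmonomial0 F a ->
  phi (sword F v es ∗ a) = lprod es * phi (a ∗ sword F v es).
Proof.
have FP := gc_rel A.
elim: es v a => [|e es IH] v a ha /=.
  by rewrite /lprod big_nil mul1r phi_gP.
rewrite -cmulA phi_gS; last exact: gmonomial0_sword.
rewrite -cmulA IH; last by apply: gmonomial0M => //; right; exact: gS_gmonomial.
by rewrite /lprod big_cons mulrA cmulA.
Qed.

Lemma gmonomial0_word v es : gmonomial0 F (sword F v es).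
Proof.
have FP := gc_rel A; elim: es v => [|e es IH] v /=.
  by right; exact: gP_gmonomial.
by apply: gmonomial0_gS.
Qed.

Lemma phi_sword_starC v es a : gmonomial0 F a ->
  lprod es * phi ((sword F v es)^† ∗ a) = phi (a ∗ (sword F v es)^†).
Proof.
have FP := gc_rel A => ha.
have hw := gmonomial0_word v es.
rewrite -phi_star; last by apply: gmonomial0M => //; exact: gmonomial0_star.
rewrite -[RHS]phi_star; last by apply: gmonomial0M => //; exact: gmonomial0_star.
by rewrite !cstarM cstarK -phi_swordC //; exact: gmonomial0_star.
Qed.

(** Moving S_mu to the right contributes [lprod es]; moving S_nu^* would contribute the inverse of
    [lprod fs], which is kept on the left to avoid dividing. *)
Lemma phi_kms v es w fs a : gmonomial0 F a ->
  lprod fs * phi (sword F v es ∗ (sword F w fs)^† ∗ a) =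
  lprod es * phi (a ∗ (sword F v es ∗ (sword F w fs)^†)).
Proof.
have FP := gc_rel A => ha; have hv := gmonomial0_word v es.
rewrite -cmulA phi_swordC; last exact: gmonomial0_sword_star.
rewrite mulrCA -cmulA phi_sword_starC; last exact: gmonomial0M.
by rewrite cmulA.
Qed.

End GraphState.

(** * Linear maps on the algebraic tensor product *)

Section TensorLift.
Context (R : realType) (A1 A2 : cstarAlgType R) (T : cstar_tensor A1 A2).
Implicit Types (a : A1) (c : A2) (x y : T).
Local Notation "a ⊗ c" := (tens T a c) (at level 35).

Lemma tensDl a a' c : (a + a') ⊗ c = a ⊗ c + a' ⊗ c.
Proof. by case: (ct_bilinear T). Qed.
Lemma tensDr a c c' : a ⊗ (c + c') = a ⊗ c + a ⊗ c'.
Proof. by case: (ct_bilinear T). Qed.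
Lemma tensZl (k : R[i]) a c : (k *: a) ⊗ c = k *: (a ⊗ c).
Proof. by case: (ct_bilinear T). Qed.
Lemma tensZr (k : R[i]) a c : a ⊗ (k *: c) = k *: (a ⊗ c).
Proof. by case: (ct_bilinear T). Qed.
Lemma tens0l c : 0 ⊗ c = 0.
Proof. by rewrite -[X in X ⊗ _](scale0r (0 : A1)) tensZl scale0r. Qed.
Lemma tens0r a : a ⊗ 0 = 0.
Proof. by rewrite -[X in _ ⊗ X](scale0r (0 : A2)) tensZr scale0r. Qed.

Lemma tens_sumr (I : Type) (r : seq I) (F : I -> A2) a :
  a ⊗ (\sum_(i <- r) F i) = \sum_(i <- r) a ⊗ F i.
Proof. by elim/big_rec2: _ => [|i x y _ <-]; rewrite ?tens0r ?tensDr. Qed.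

Lemma tens_suml (I : Type) (r : seq I) (F : I -> A1) c :
  (\sum_(i <- r) F i) ⊗ c = \sum_(i <- r) F i ⊗ c.
Proof. by elim/big_rec2: _ => [|i x y _ <-]; rewrite ?tens0l ?tensDl. Qed.

Definition algtens : set T := [set x | exists n (a : 'I_n -> A1) (c : 'I_n -> A2),
  x = \sum_(i < n) a i ⊗ c i].

Lemma algtens_tens a c : algtens (a ⊗ c).
Proof. by exists 1%N, (fun=> a), (fun=> c); rewrite big_ord1. Qed.

Lemma algtensZ (k : R[i]) x : algtens x -> algtens (k *: x).
Proof.
move=> [n [a [c ->]]]; exists n, (fun i => k *: a i), c.
by rewrite scaler_sumr; apply: eq_bigr => i _; rewrite tensZl.
Qed.

Definition ord_cat (V : Type) n m (f : 'I_n -> V) (h : 'I_m -> V)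
  (i : 'I_(n + m)) : V := match fintype.split i with inl j => f j | inr j => h j end.

Lemma sum_ord_cat (U V : Type) (W : nmodType) n m (f : 'I_n -> U) (h : 'I_m -> U)
    (f' : 'I_n -> V) (h' : 'I_m -> V) (b : U -> V -> W) :
  \sum_(i < n + m) b (ord_cat f h i) (ord_cat f' h' i) =
  \sum_(i < n) b (f i) (f' i) + \sum_(i < m) b (h i) (h' i).
Proof.
rewrite big_split_ord; congr (_ + _); apply: eq_bigr => i _; rewrite /ord_cat.
  by rewrite (unsplitK (inl i)).
by rewrite (unsplitK (inr i)).
Qed.

Lemma algtensD x y : algtens x -> algtens y -> algtens (x + y).
Proof.
move=> [n [a [c ->]]] [m [a' [c' ->]]].
by exists (n + m)%N, (ord_cat a a'), (ord_cat c c'); rewrite sum_ord_cat.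
Qed.

Lemma algtens0 : algtens 0.
Proof. by rewrite -(tens0l 0); exact: algtens_tens. Qed.

Lemma algtens_sum (I : Type) (r : seq I) (F : I -> T) :
  (forall i, algtens (F i)) -> algtens (\sum_(i <- r) F i).
Proof.
by move=> h; elim/big_ind: _ => // [|x y]; [exact: algtens0 | exact: algtensD].
Qed.

Section Lift.
Context (W : lmodType R[i]) (b : A1 -> A2 -> W) (bP : bilinear_map b).

(** The value is computed from some representation of x by elementary tensors, and is 0 outside
    [algtens]. *)
Definition tlift x : W := xget 0 [set w | exists n (a : 'I_n -> A1) (c : 'I_n -> A2),
  x = \sum_(i < n) a i ⊗ c i /\ w = \sum_(i < n) b (a i) (c i)].

Lemma tlift_ordE n (a : 'I_n -> A1) (c : 'I_n -> A2) :
  tlift (\sum_(i < n) a i ⊗ c i) = \sum_(i < n) b (a i) (c i).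
Proof.
rewrite /tlift; case: xgetP => [w _ [m [a' [c' [E ->]]]]|h]; last first.
  by case: (h (\sum_(i < n) b (a i) (c i))); exists n, a, c.
have bN u v : b (- u) v = - b u v.
  by case: bP => _ _ bZ _; rewrite -[- u]scaleN1r bZ scaleN1r.
have tN u v : tens T (- u) v = - tens T u v by rewrite -[- u]scaleN1r tensZl scaleN1r.
(* Two representations of the same element, one of them negated and appended to the other, form the
   vanishing sum to which [ct_alg_tensor] applies. *)
have := @ct_alg_tensor _ _ _ T _ (ord_cat a (fun i => - a' i)) (ord_cat c c').
move=> /(_ _ W b bP).
rewrite (sum_ord_cat a (fun i => - a' i) c c' (tens T)).
rewrite (sum_ord_cat a (fun i => - a' i) c c' b).
under [X in _ + X = 0 -> _]eq_bigr do rewrite tN.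
under [X in _ -> _ + X = 0]eq_bigr do rewrite bN.
rewrite !sumrN E subrr => /(_ erefl)/eqP; rewrite subr_eq0 => /eqP ->.
by [].
Qed.

Lemma tlift_tens a c : tlift (a ⊗ c) = b a c.
Proof.
have := tlift_ordE (fun _ : 'I_1 => a) (fun _ : 'I_1 => c).
by rewrite !big_ord1.
Qed.

Lemma tliftD x y : algtens x -> algtens y -> tlift (x + y) = tlift x + tlift y.
Proof.
move=> [n [a [c ->]]] [m [a' [c' ->]]].
by rewrite -(sum_ord_cat a a' c c' (tens T)) !tlift_ordE sum_ord_cat.
Qed.

Lemma tliftZ (k : R[i]) x : algtens x -> tlift (k *: x) = k *: tlift x.
Proof.
move=> [n [a [c ->]]]; rewrite scaler_sumr; under eq_bigr do rewrite -tensZl.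
rewrite !tlift_ordE scaler_sumr; apply: eq_bigr => i _.
by case: bP => _ _ ->.
Qed.

Lemma tlift0 : tlift 0 = 0.
Proof. by rewrite -(scale0r 0) tliftZ ?scale0r //; exact: algtens0. Qed.

Lemma tlift_sum (I : Type) (r : seq I) (F : I -> T) :
  (forall i, algtens (F i)) -> tlift (\sum_(i <- r) F i) = \sum_(i <- r) tlift (F i).
Proof.
move=> h; elim: r => [|i r IH]; first by rewrite !big_nil tlift0.
by rewrite !big_cons tliftD ?IH //; exact: algtens_sum.
Qed.

End Lift.

End TensorLift.

Section PathElements.
Context (R : realType) (G : digraph) (A : graph_cstar R G).

(** [Spath] associates to the left and does not end in a vertex projection; the hypothesis on a
    allows one to be inserted. *)
Lemma foldl_sword (a : A) v es :
  a ∗ gP (gc_fam A) v = a -> is_walk v es ->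
  foldl (fun x f => x ∗ gS (gc_fam A) f) a es = a ∗ sword (gc_fam A) v es.
Proof.
elim: es a v => [|e es IH] a v av wv //=.
case/andP: wv => _ we; rewrite (IH _ (rng e)) //; first by rewrite -cmulA.
by rewrite -cmulA (gS_rng (gc_rel A)).
Qed.

Lemma Spath_sword (p : gpath G) :
  Spath A p = sword (gc_fam A) (val p).1 (val p).2.
Proof.
case: p => [[v es] wv]; rewrite /Spath /pedges /=.
case: es wv => [|e es] // /andP[_ we].
exact: (foldl_sword (gS_rng (gc_rel A) e) we).
Qed.

Lemma gmonomial_paths (a : A) : gmonomial (gc_fam A) a <->
  exists mu nu : gpath G, prange mu = prange nu /\ a = Spath A mu ∗ (Spath A nu)^†.
Proof.
split; last first.
  move=> [mu [nu [E ->]]]; rewrite !Spath_sword; case: mu nu E => [[v es] wv] [[w fs] ww] E.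
  by exists v, es, w, fs.
move=> [v [es [w [fs [wv ww E ->]]]]].
exists (exist _ (v, es) wv), (exist _ (w, fs) ww).
by rewrite !Spath_sword.
Qed.

End PathElements.

(** * The algebra M_B and the product functional *)

Section ComplexAlgebra.
Context (R : realType) (B : oriented_complex).
Context (A1 : graph_cstar R (skeleton B)).
Context (A2 : graph_cstar R (boundary_graph B)).
Context (T : cstar_tensor A1 A2).
Implicit Types (a : A1) (c : A2) (x y : T).
Local Notation "a ⊗ c" := (tens T a c) (at level 35).
Local Notation F1 := (gc_fam A1).
Local Notation F2 := (gc_fam A2).
Let FP1 : is_graph_family F1 := gc_rel A1.
Let FP2 : is_graph_family F2 := gc_rel A2.

Lemma inLM a a' : inL T a ∗ inL T a' = inL T (a ∗ a').
Proof. by rewrite /inL ct_mul cunit1l. Qed.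
Lemma inRM c c' : inR T c ∗ inR T c' = inR T (c ∗ c').
Proof. by rewrite /inR ct_mul cunit1l. Qed.
Lemma inL_star a : (inL T a)^† = inL T a^†.
Proof. by rewrite /inL ct_star cunit_star. Qed.
Lemma inR_star c : (inR T c)^† = inR T c^†.
Proof. by rewrite /inR ct_star cunit_star. Qed.
Lemma inLR a c : inL T a ∗ inR T c = a ⊗ c.
Proof. by rewrite /inL /inR ct_mul cunit1l cunit1r. Qed.

Lemma monomial_tens mu nu Om La : monomial T mu nu Om La =
  (Spath A1 mu ∗ (Spath A1 nu)^†) ⊗ (Spath A2 Om ∗ (Spath A2 La)^†).
Proof. by rewrite /monomial inL_star inR_star -cmulA inLM inRM inLR. Qed.

Local Notation MB := (@MB _ _ _ _ T).

Lemma MB_tens a c : gmonomial F1 a -> gmonomial F2 c -> MB (a ⊗ c).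
Proof.
move=> /gmonomial_paths[mu [nu [E1 ->]]] /gmonomial_paths[Om [La [E2 ->]]].
exists 1%N, (fun=> 1), (fun=> monomial T mu nu Om La).
split; first by move=> _; exists mu, nu, Om, La.
by rewrite big_ord1 scale1r monomial_tens.
Qed.

Lemma MB0 : MB 0.
Proof.
exists 0%N, (fun=> 0), (fun=> 0); split; last by rewrite big_ord0.
by case.
Qed.

Lemma MBD x y : MB x -> MB y -> MB (x + y).
Proof.
move=> [n [k [f [hf ->]]]] [m [l [h [hh ->]]]].
exists (n + m)%N, (ord_cat k l), (ord_cat f h).
split; last by rewrite (sum_ord_cat k l f h (fun k x => k *: x)).
by move=> i; rewrite /ord_cat; case: fintype.split.
Qed.

Lemma MBZ (k : R[i]) x : MB x -> MB (k *: x).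
Proof.
move=> [n [l [f [hf ->]]]]; exists n, (fun i => k * l i), f; split=> //.
by rewrite scaler_sumr; apply: eq_bigr => i _; rewrite scalerA.
Qed.

Lemma MB_sum (I : Type) (r : seq I) (F : I -> T) :
  (forall i, MB (F i)) -> MB (\sum_(i <- r) F i).
Proof.
by move=> h; elim/big_ind: _ => // [|x y]; [exact: MB0 | exact: MBD].
Qed.

(** Membership is carried along because the functional and the scalings are known to be linear on
    [MB] only. *)
Lemma MB_ind (Q : T -> Prop) :
  Q 0 -> (forall x y, MB x -> MB y -> Q x -> Q y -> Q (x + y)) ->
  (forall k x, MB x -> Q x -> Q (k *: x)) ->
  (forall a c, gmonomial F1 a -> gmonomial F2 c -> Q (a ⊗ c)) ->
  forall x, MB x -> Q x.
Proof.
move=> Q0 QD QZ Qm x [n [k [f [hf ->]]]].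
suff [] : MB (\sum_(i < n) k i *: f i) /\ Q (\sum_(i < n) k i *: f i) by [].
elim/big_ind: _ => [|y z [My Qy] [Mz Qz]|i _].
- by split; [exact: MB0 |].
- by split; [exact: MBD | exact: QD].
have [mu [nu [Om [La [E1 E2 ->]]]]] := hf i; rewrite monomial_tens.
have h1 : gmonomial F1 (Spath A1 mu ∗ (Spath A1 nu)^†).
  by apply/gmonomial_paths; exists mu, nu.
have h2 : gmonomial F2 (Spath A2 Om ∗ (Spath A2 La)^†).
  by apply/gmonomial_paths; exists Om, La.
have h := MB_tens h1 h2.
by split; [exact: MBZ | apply: QZ => //; exact: Qm].
Qed.

Lemma MB_tens0 a c : gmonomial0 F1 a -> gmonomial0 F2 c -> MB (a ⊗ c).
Proof.
case=> [->|ha]; first by rewrite tens0l => _; exact: MB0.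
by case=> [->|hc]; [rewrite tens0r; exact: MB0 | exact: MB_tens].
Qed.

Lemma MB_algtens x : MB x -> algtens x.
Proof.
apply: MB_ind => [|y z _ _|k y _|a c _ _].
- exact: algtens0.
- exact: algtensD.
- exact: algtensZ.
- exact: algtens_tens.
Qed.

Lemma MBM x y : MB x -> MB y -> MB (x ∗ y).
Proof.
move=> hx hy; move: x hx; apply: MB_ind => [|x x' _ _ h h'|k x _ h|a c ha hc].
- by rewrite cmul0l; exact: MB0.
- by rewrite cmulDl; exact: MBD.
- by rewrite cmulZl; exact: MBZ.
move: y hy; apply: MB_ind => [|y y' _ _ h h'|k y _ h|a' c' ha' hc'].
- by rewrite cmul0r; exact: MB0.
- by rewrite cmulDr; exact: MBD.
- by rewrite cmulZr; exact: MBZ.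
by rewrite ct_mul; apply: MB_tens0; apply: gmonomial0M => //; right.
Qed.

Lemma MB_star x : MB x -> MB x^†.
Proof.
move: x; apply: MB_ind => [|x x' _ _ h h'|k x _ h|a c ha hc].
- by rewrite cstar0; exact: MB0.
- by rewrite cstarD; exact: MBD.
- by rewrite cstarZ; exact: MBZ.
by rewrite ct_star; apply: MB_tens; exact: gmonomial_star.
Qed.

(** Since the unit is a finite sum of vertex projections, an embedded monomial is a sum of
    elementary tensors of monomials and so belongs to M_B. *)
Lemma inL_sum a : inL T a = \sum_e a ⊗ gP F2 e.
Proof. by rewrite /inL cunitE /gunit tens_sumr. Qed.

Lemma inR_sum c : inR T c = \sum_v gP F1 v ⊗ c.
Proof. by rewrite /inR cunitE /gunit tens_suml. Qed.

Lemma MB_inL a : gmonomial0 F1 a -> MB (inL T a).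
Proof.
move=> ha; rewrite inL_sum; apply: MB_sum => e; apply: MB_tens0 => //.
by right; exact: gP_gmonomial.
Qed.

Lemma MB_inR c : gmonomial0 F2 c -> MB (inR T c).
Proof.
move=> hc; rewrite inR_sum; apply: MB_sum => v; apply: MB_tens0 => //.
by right; exact: gP_gmonomial.
Qed.

Lemma tens_dcoef_eq0 a c p q : a ⊗ c = 0 -> dcoef p a * dcoef q c = 0.
Proof.
move=> h.
have bP : bilinear_map (fun a c => dcoef p a * dcoef q c : R[i]^o).
  split=> [u u' v|u v v'|k u v|k u v].
  - by rewrite dcoefD mulrDl.
  - by rewrite dcoefD mulrDr.
  - by rewrite dcoefZ -mulrA.
  - by rewrite dcoefZ mulrCA.
by rewrite -(tlift_tens T bP) h tlift0.
Qed.

Section State.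
Context (g : vert (skeleton B) -> R) (lamt lam : edge (skeleton B) -> R).
Context (eta : face B -> R) (rw : rank2_weight g lamt lam eta).
Local Notation etat := (fun x : edge (boundary_graph B) => eta (tag x)).
Let gw1 : graph_weight g lamt. Proof. by case: rw. Qed.
Let gw2 : @graph_weight R (boundary_graph B) lam etat. Proof. by case: rw. Qed.
Local Notation phi1 := (phi (A := A1) g lamt).
Local Notation phi2 := (phi (A := A2) (lam : vert (boundary_graph B) -> R) etat).
Local Notation phiN1 := (phiN (A := A1) g lamt).
Local Notation phiN2 := (phiN (A := A2) (lam : vert (boundary_graph B) -> R) etat).

Definition psiN_form N a c : R[i]^o := phiN1 N a * phiN2 N c.

Lemma psiN_bilinear N : bilinear_map (psiN_form N).
Proof.
rewrite /psiN_form; split=> [u u' v|u v v'|k u v|k u v].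
- by rewrite phiND mulrDl.
- by rewrite phiND mulrDr.
- by rewrite phiNZ -mulrA.
- by rewrite phiNZ mulrCA.
Qed.

Definition psiN N x : R[i] := tlift (psiN_form N) x.

(** The limit is taken after lifting: [phiN] is linear, so [psiN_form] is bilinear, whereas [phi] is
    not known to be linear on the whole algebra. *)
Definition psi x : R[i] := evlim (fun N => psiN N x).

Lemma psi_stable x : MB x ->
  exists N0, forall N, (N0 <= N)%N -> psiN N x = psi x.
Proof.
suff h : MB x -> exists (l : R[i]) N0, forall N, (N0 <= N)%N -> psiN N x = l.
  move=> /h[c [N0 hc]]; exists N0 => N NN; rewrite (hc N NN).
  by apply/esym/evlimP; exists N0.
move: x; apply: MB_ind => [|x y Mx My [c [n hc]] [d [m hd]]|k x Mx [c [n hc]]|a c ha hc].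
- by exists 0, 0%N => N _; rewrite /psiN tlift0 //; exact: psiN_bilinear.
- exists (c + d), (maxn n m) => N; rewrite geq_max => /andP[nN mN].
  rewrite /psiN tliftD; try exact: MB_algtens; last exact: psiN_bilinear.
  by rewrite -(hc N nN) -(hd N mN).
- exists (k * c), n => N nN; rewrite -(hc N nN) /psiN tliftZ //.
    exact: psiN_bilinear.
  exact: MB_algtens.
have [n hn] := phi_stable gw1 (or_intror ha).
have [m hm] := phi_stable gw2 (or_intror hc).
exists (phi1 a * phi2 c), (maxn n m) => N; rewrite geq_max => /andP[nN mN].
by rewrite /psiN tlift_tens ?/psiN_form ?hn ?hm //; exact: psiN_bilinear.
Qed.

Lemma psiD x y : MB x -> MB y -> psi (x + y) = psi x + psi y.
Proof.
move=> Mx My; have [n hn] := psi_stable Mx; have [m hm] := psi_stable My.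
apply: evlimP; exists (maxn n m) => N; rewrite geq_max => /andP[nN mN].
rewrite -(hn N nN) -(hm N mN) /psiN tliftD //; try exact: MB_algtens.
exact: psiN_bilinear.
Qed.

Lemma psiZ (k : R[i]) x : MB x -> psi (k *: x) = k * psi x.
Proof.
move=> Mx; have [n hn] := psi_stable Mx; apply: evlimP; exists n => N nN.
rewrite -(hn N nN) /psiN tliftZ //; first exact: psiN_bilinear.
exact: MB_algtens.
Qed.

Lemma psi_tens a c : gmonomial0 F1 a -> gmonomial0 F2 c ->
  psi (a ⊗ c) = phi1 a * phi2 c.
Proof.
move=> ha hc; have [n hn] := phi_stable gw1 ha; have [m hm] := phi_stable gw2 hc.
apply: evlimP; exists (maxn n m) => N; rewrite geq_max => /andP[nN mN].
by rewrite /psiN tlift_tens ?/psiN_form ?hn ?hm //; exact: psiN_bilinear.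
Qed.

(** The matrix is a Gram matrix of indicator functions: the double sum is the sum over w of the
    squared modulus of the sum of the k_i with z_i = w. *)
Lemma diagonal_gram_ge0 (I : finType) (Z : eqType) (k : I -> R[i]) (z : I -> option Z) :
  0 <= \sum_i \sum_j (k i)^* * k j * ((z i == z j) && isSome (z i))%:R.
Proof.
pose s := undup (pmap z (index_enum I)).
have E i j : ((z i == z j) && isSome (z i))%:R =
    \sum_(w <- s) (z i == Some w)%:R * (z j == Some w)%:R :> R[i].
  case Ei: (z i) => [w|] /=; last first.
    by rewrite andbF big1 // => w _; rewrite mul0r.
  rewrite andbT (bigD1_seq w) /= ?undup_uniq //; last first.
    by rewrite mem_undup mem_pmap; apply/mapP; exists i; rewrite ?mem_index_enum.
  rewrite eqxx mul1r big1 ?addr0; first by rewrite eq_sym.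
  by move=> w' /negPf ww'; rewrite (inj_eq (@Some_inj _)) eq_sym ww' mul0r.
have -> : \sum_i \sum_j (k i)^* * k j * ((z i == z j) && isSome (z i))%:R =
    \sum_(w <- s) (\sum_i k i * (z i == Some w)%:R)^* * (\sum_i k i * (z i == Some w)%:R).
  under eq_bigr => i _ do under eq_bigr => j _ do rewrite E mulr_sumr.
  under eq_bigr => i _ do rewrite exchange_big.
  rewrite exchange_big /=; apply: eq_bigr => w _.
  rewrite rmorph_sum mulr_suml; apply: eq_bigr => i _.
  rewrite mulr_sumr; apply: eq_bigr => j _.
  by rewrite rmorphM /= conjC_nat mulrACA.
by apply: sumr_ge0 => w _; rewrite mulrC; exact: mul_conjC_ge0.
Qed.

(** One fixes a depth N at which x^† ∗ x already has its final value. There [psiN N] is an iterated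
    integral of diagonal coefficients, and the integrand is a Gram sum at each pair of points. *)
Lemma psi_ge0 x : MB x -> 0 <= psi (x^† ∗ x).
Proof.
move=> Mx; have [N0 hN] := psi_stable (MBM (MB_star Mx) Mx).
rewrite -(hN N0 (leqnn _)); move: N0 {hN} => N.
have [n [k [f [hf xE]]]] := Mx.
have ex i : exists ac : A1 * A2, [/\ gmonomial F1 ac.1, gmonomial F2 ac.2 &
    f i = ac.1 ⊗ ac.2].
  have [mu [nu [Om [La [E1 E2 ->]]]]] := hf i; rewrite monomial_tens.
  exists (Spath A1 mu ∗ (Spath A1 nu)^†, Spath A2 Om ∗ (Spath A2 La)^†).
  by split=> //; apply/gmonomial_paths; [exists mu, nu | exists Om, La].
pose a i := (proj1_sig (cid (ex i))).1; pose c i := (proj1_sig (cid (ex i))).2.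
have ha i : gmonomial F1 (a i) by rewrite /a; case: cid => ? [].
have hc i : gmonomial F2 (c i) by rewrite /c; case: cid => ? [].
have fE i : f i = a i ⊗ c i by rewrite /a /c; case: cid => ? [].
have p1ex i : exists p : pinj (gpoint (skeleton B)), rep (a i) = pinj_op R p.
  exact: rep_gmonomial.
have p2ex i : exists p : pinj (gpoint (boundary_graph B)), rep (c i) = pinj_op R p.
  exact: rep_gmonomial.
pose p1 i := proj1_sig (cid (p1ex i)); pose p2 i := proj1_sig (cid (p2ex i)).
have h1 i : rep (a i) = pinj_op R (p1 i) by rewrite /p1; case: cid.
have h2 i : rep (c i) = pinj_op R (p2 i) by rewrite /p2; case: cid.
have algt i j : algtens (((k i)^* * k j) *: ((a i)^† ∗ a j) ⊗ ((c i)^† ∗ c j)).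
  by apply: algtensZ; exact: algtens_tens.
have -> : x^† ∗ x = \sum_i \sum_j ((k i)^* * k j) *: ((a i)^† ∗ a j) ⊗ ((c i)^† ∗ c j).
  rewrite xE cstar_sum cmul_suml; apply: eq_bigr => i _.
  rewrite cmul_sumr; apply: eq_bigr => j _.
  by rewrite cstarZ cmulZl cmulZr scalerA !fE ct_star ct_mul.
have bP := psiN_bilinear N.
rewrite /psiN tlift_sum //; last by move=> i; exact: algtens_sum.
under eq_bigr => i _.
  rewrite tlift_sum //.
  under eq_bigr => j _ do
    rewrite (tliftZ bP _ (algtens_tens T _ _)) (tlift_tens T bP) /psiN_form.
  over.
have -> : \sum_i \sum_j ((k i)^* * k j) *: (phiN1 N ((a i)^† ∗ a j) *
      phiN2 N ((c i)^† ∗ c j)) =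
    tmeas g lamt N (fun p => tmeas (lam : vert (boundary_graph B) -> R) etat N
      (fun q => \sum_i \sum_j ((k i)^* * k j) *
        (dcoef p ((a i)^† ∗ a j) * dcoef q ((c i)^† ∗ c j)))).
  rewrite (eq_tmeas g lamt N (h' := fun p => \sum_i \sum_j
      phiN2 N ((c i)^† ∗ c j) * ((k i)^* * k j) * dcoef p ((a i)^† ∗ a j))); last first.
    move=> p; rewrite tmeas_sum; apply: eq_bigr => i _.
    rewrite tmeas_sum; apply: eq_bigr => j _.
    rewrite (eq_tmeas _ _ _ (h' := fun q => ((k i)^* * k j *
      dcoef p ((a i)^† ∗ a j)) * dcoef q ((c i)^† ∗ c j))) => [|q].
      by rewrite tmeasZ -/(phiN _ _ _ _) mulrC mulrA.
    by rewrite mulrA.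
  rewrite tmeas_sum; apply: eq_bigr => i _.
  rewrite tmeas_sum; apply: eq_bigr => j _.
  rewrite tmeasZ /phiN -[LHS]/(_ * (_ * _)).
  by rewrite mulrA mulrAC [X in X * _]mulrC.
apply: tmeas_ge0 => // p; apply: tmeas_ge0 => // q.
(* The pair of images of p and q under the i-th monomial, undefined as soon as one of them is. The
   product of the two indicators is then the indicator that the pairs are defined and agree. *)
pose z i : option (gpoint (skeleton B) * gpoint (boundary_graph B)) :=
  if p1 i p is Some u then if p2 i q is Some w then Some (u, w) else None else None.
rewrite (eq_bigr (fun i => \sum_j (k i)^* * k j * ((z i == z j) && isSome (z i))%:R)).
  exact: diagonal_gram_ge0.
move=> i _; apply: eq_bigr => j _; congr (_ * _).
rewrite (dcoef_star_mul p (h1 i) (h1 j)) (dcoef_star_mul q (h2 i) (h2 j)) -natrM mulnb.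
congr (nat_of_bool _)%:R; rewrite /z.
case: (p1 i p) (p1 j p) => [u|] [u'|] //=; rewrite ?andbF //;
case: (p2 i q) (p2 j q) => [w|] [w'|] //=; rewrite ?andbF ?andbT //.
Qed.

End State.

End ComplexAlgebra.

(** * The complex exponential *)

Section ComplexExponential.
Context (R : realType).
Implicit Types (x a b : R) (w z h : R[i]).

Lemma norm_sin_le x : `|sin x| <= `|x|.
Proof.
wlog x0 : x / 0 <= x => [H|].
  have [/H //|/ltW x0] := leP 0 x.
  by rewrite -normrN -sinN -(normrN x); apply: H; rewrite oppr_ge0.
have [c _] := @MVT_segment R sin cos 0 x x0 (fun y _ => is_derive_sin y)
  (continuous_subspaceT (@continuous_sin R)).
rewrite sin0 !subr0 => ->; rewrite normrM ler_piMl // ler_norml cos_le1 andbT.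
exact: cos_geN1.
Qed.

Lemma norm_cosB1_le x : `|cos x - 1| <= x ^+ 2.
Proof.
have E : x = (x / 2) *+ 2 by rewrite -mulr_natr divfK.
have : cos x - 1 = - (sin (x / 2) ^+ 2 *+ 2).
  by rewrite {1}E cos_mulr2n cos2sin2; ring.
move=> ->; rewrite normrN ger0_norm ?mulrn_wge0 ?sqr_ge0 //.
have : sin (x / 2) ^+ 2 <= (x / 2) ^+ 2.
  by rewrite -real_normK ?num_real // -[leRHS]real_normK ?num_real //
    lerXn2r ?nnegrE // norm_sin_le.
have := sqr_ge0 x; rewrite expr_div_n; lra.
Qed.

Lemma norm_sinBid_le x : `|x| <= 1 -> `|sin x - x| <= x ^+ 2.
Proof.
wlog x0 : x / 0 <= x => [H|].
  have [/H //|/ltW x0] := leP 0 x.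
  rewrite -normrN => x1; rewrite -normrN opprD -sinN -sqrrN.
  by apply: H; rewrite ?oppr_ge0.
rewrite (ger0_norm x0) => x1.
have hd y : y \in `]0, x[%R -> is_derive y 1 (fun t : R => sin t - t) (cos y - 1).
  by move=> _; exact: is_deriveB.
have hc : {within `[0, x], continuous (fun t : R => sin t - t)}.
  apply: continuous_subspaceT => t; apply: cvgB; last exact: cvg_id.
  exact: continuous_sin.
have [c /[!in_itv]/= /andP[c0 cx]] := MVT_segment x0 hd hc.
rewrite sin0 !subr0 => ->; rewrite normrM (ger0_norm x0).
apply: (@le_trans _ _ (x ^+ 2 * x)).
  apply: ler_wpM2r => //; apply: (le_trans (norm_cosB1_le c)).
  by rewrite lerXn2r ?nnegrE.
by rewrite -[leRHS]mulr1 ler_wpM2l // sqr_ge0.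
Qed.

(** From e^a (1 - a) <= e^a e^(-a) = 1 one gets (e^a - 1 - a) (1 - a) <= a^2, and 1 - a is at least
    1/2. *)
Lemma expR_bounds a : `|a| <= 2^-1 -> 0 <= expR a - 1 - a <= 2 * a ^+ 2.
Proof.
rewrite ler_norml => /andP[a1 a2].
have h1 := expR_ge1Dx a.
have h2 : expR a * (1 - a) <= 1.
  rewrite -[leRHS](expR0 R) -(subrr a) expRD ler_wpM2l ?expR_ge0 //.
  exact: expR_ge1Dx.
apply/andP; split; first by lra.
have h3 : (expR a - 1 - a) * (1 - a) <= a ^+ 2 by rewrite !mulrBl; lra.
have h4 : (expR a - 1 - a) * 2^-1 <= (expR a - 1 - a) * (1 - a).
  by apply: ler_wpM2l; lra.
lra.
Qed.

Definition cexp w : R[i] :=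
  (expR (Re w) * cos (Im w)) +i* (expR (Re w) * sin (Im w)).

Lemma cexpD w z : cexp (w + z) = cexp w * cexp z.
Proof.
rewrite /cexp ReD ImD expRD cosD sinD.
by apply/eqP; rewrite eq_complex /=; apply/andP; split; apply/eqP; ring.
Qed.

Lemma norm_le_ReIm z : `|z| <= (`|Re z| + `|Im z|)%:C.
Proof.
rewrite normc_def lecR -[leRHS]ger0_norm ?addr_ge0 // -sqrtr_sqr ler_wsqrtr //.
rewrite sqrrD !real_normK ?num_real // lerD2r lerDl.
by rewrite mulrn_wge0 // mulr_ge0.
Qed.

Lemma cexp_bound w : `|w| <= (2^-1)%:C -> `|cexp w - 1 - w| <= 8 * `|w| ^+ 2.
Proof.
rewrite sqn_ReE Re_sqn; case: w => a b /=; rewrite normc_def /= lecR => h.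
have ab0 : 0 <= a ^+ 2 + b ^+ 2 by rewrite addr_ge0 // sqr_ge0.
have hab : a ^+ 2 + b ^+ 2 <= 4^-1.
  rewrite -(sqr_sqrtr ab0) (_ : 4^-1 = 2^-1 ^+ 2); last by field.
  by rewrite lerXn2r ?nnegrE ?sqrtr_ge0 // invr_ge0.
have sq_le (c : R) : c ^+ 2 <= 4^-1 -> `|c| <= 2^-1.
  move=> hc; rewrite -(ler_pXn2r (ltn0Sn 1)) ?nnegrE ?invr_ge0 //.
  by rewrite real_normK ?num_real // (le_trans hc) // le_eqVlt; apply/orP; left; apply/eqP; field.
have a2 := sqr_ge0 a; have b2 := sqr_ge0 b.
have ha : `|a| <= 2^-1 by apply: sq_le; lra.
have hb : `|b| <= 2^-1 by apply: sq_le; lra.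
apply: (le_trans (norm_le_ReIm _)).
rewrite -[8]/(8%:R) -(rmorph_nat (real_complex R)) -rmorphM lecR /= !subr0.
have /andP[e1 e2] := expR_bounds ha.
have hc := norm_cosB1_le b; have hs := norm_sin_le b.
have hsb : `|sin b - b| <= b ^+ 2 by apply: norm_sinBid_le; lra.
have E2 : expR a <= 2.
  by move: ha; rewrite ler_norml => /andP[? ?]; lra.
have E0 := expR_ge0 a.
have r1 : `|expR a * cos b - 1 - a| <= 2 * b ^+ 2 + 2 * a ^+ 2.
  have -> : expR a * cos b - 1 - a = expR a * (cos b - 1) + (expR a - 1 - a) by ring.
  apply: (le_trans (ler_normD _ _)); rewrite (ger0_norm e1) normrM (ger0_norm E0).
  by apply: lerD => //; apply: ler_pM.
have r2 : `|expR a * sin b - b| <= 2 * `|a| * `|b| + b ^+ 2.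
  have -> : expR a * sin b - b = (expR a - 1) * sin b + (sin b - b) by ring.
  apply: (le_trans (ler_normD _ _)); rewrite normrM; apply: lerD => //.
  apply: ler_pM => //.
  have -> : expR a - 1 = a + (expR a - 1 - a) by ring.
  apply: (le_trans (ler_normD _ _)); rewrite (ger0_norm e1).
  have : a ^+ 2 <= `|a| * 2^-1.
    by rewrite -real_normK ?num_real // expr2 ler_wpM2l.
  lra.
have r3 : 2 * `|a| * `|b| <= a ^+ 2 + b ^+ 2.
  rewrite -(real_normK (num_real a)) -(real_normK (num_real b)).
  have := sqr_ge0 (`|a| - `|b|); rewrite sqrrB; lra.
(* By [r3] the bounds [r1] and [r2] add up to at most 3 a^2 + 4 b^2; the constant 8 is generous. *)
lra.
Qed.

(* Complex differentiability with a quadratic remainder: unlike the filter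
   notion, it is visibly stable under sums. *)
Definition qdiff (F : R[i] -> R[i]) := forall z, exists L K d : R[i],
  [/\ 0 < d, 0 <= K & forall h, `|h| < d -> `|F (z + h) - F z - L * h| <= K * `|h| ^+ 2].

Lemma qdiffD F G : qdiff F -> qdiff G -> qdiff (fun z => F z + G z).
Proof.
move=> hF hG z; have [L [K [d [d0 K0 h]]]] := hF z.
have [L' [K' [d' [d'0 K'0 h']]]] := hG z.
exists (L + L'), (K + K'), (Order.min d d'); split.
(* [R[i]] is only partially ordered; the minimum behaves as usual because d and d' are positive,
   hence real. *)
- by rewrite comparable_lt_min ?d0 ?d'0 //; apply: real_comparable; apply: gtr0_real.
- by rewrite addr_ge0.
move=> e; rewrite comparable_lt_min; last by apply: real_comparable; apply: gtr0_real.
case/andP => ed ed'.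
have -> : F (z + e) + G (z + e) - (F z + G z) - (L + L') * e =
  (F (z + e) - F z - L * e) + (G (z + e) - G z - L' * e) by ring.
by apply: (le_trans (ler_normD _ _)); rewrite mulrDl lerD ?h ?h'.
Qed.

Lemma qdiffZ k F : qdiff F -> qdiff (fun z => k * F z).
Proof.
move=> hF z; have [L [K [d [d0 K0 h]]]] := hF z.
exists (k * L), (`|k| * K), d; split=> //; first by rewrite mulr_ge0.
move=> e ed; have -> : k * F (z + e) - k * F z - k * L * e =
  k * (F (z + e) - F z - L * e) by ring.
by rewrite normrM -mulrA ler_wpM2l // h.
Qed.

Lemma qdiff_cexp (l : R) : qdiff (fun z => cexp ('i%C * l%:C * z)).
Proof.
move=> z; pose c : R[i] := 'i%C * l%:C.
have c1 : 0 < `|c| + 1 by rewrite ltr_wpDl.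
exists (cexp (c * z) * c), (`|cexp (c * z)| * (8 * `|c| ^+ 2)), ((2^-1)%:C / (`|c| + 1)).
split.
- by rewrite divr_gt0 // ltcR invr_gt0.
- by rewrite !mulr_ge0.
move=> h; rewrite ltr_pdivlMr // => hd.
rewrite -/c mulrDr cexpD.
have -> : cexp (c * z) * cexp (c * h) - cexp (c * z) - cexp (c * z) * c * h =
  cexp (c * z) * (cexp (c * h) - 1 - c * h) by ring.
rewrite normrM -(mulrA `|cexp _|) ler_wpM2l // -mulrA -exprMn -normrM.
apply: cexp_bound.
rewrite normrM; apply: le_trans (ltW hd); rewrite mulrC ler_wpM2l //.
by rewrite lerDl.
Qed.

Lemma qdiff_derivable (F : R[i]^o -> R[i]^o) z : qdiff F -> derivable F z 1.
Proof.
move=> /(_ z)[L [K [d [d0 K0 h]]]].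
apply/cvg_ex; exists L; apply/cvgrPdist_lt => /= e e0.
have K1 : 0 < K + 1 by rewrite ltr_wpDl.
(* On this ball the error K |t| of the difference quotient stays below e; K + 1 stands in for K,
   which may be 0. *)
rewrite near_withinE; apply/nbhs_ballP; exists (Order.min d (e / (K + 1))) => /=.
  rewrite comparable_lt_min ?d0 ?divr_gt0 //.
  by apply: real_comparable; apply: gtr0_real; rewrite ?divr_gt0.
move=> t; rewrite -ball_normE /ball_ /= sub0r normrN.
rewrite comparable_lt_min; last first.
  by apply: real_comparable; apply: gtr0_real; rewrite ?divr_gt0.
move=> /andP[td te] t0.
have := h t td.
have tp : 0 < `|t| by rewrite normr_gt0.
have -> : L - t^-1 *: (F (t *: 1 + z) - F z) = - (t^-1 * (F (z + t) - F z - L * t)).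
  rewrite -[t *: 1]/(t * 1) mulr1 (addrC t z) -[_ *: _]/(t^-1 * _).
  have E (u v : R[i]) : L - t^-1 * (u - v) = - (t^-1 * (u - v - L * t)) by field.
  exact: E.
move=> hh; rewrite normrN normrM normfV ltr_pdivrMl //.
apply: (le_lt_trans hh); rewrite expr2 mulrA mulrC ltr_pM2l //.
apply: (@le_lt_trans _ _ ((K + 1) * `|t|)); first by rewrite ler_wpM2r // lerDl.
by rewrite mulrC -ltr_pdivlMr.
Qed.

Lemma qdiff_continuous (F : R[i]^o -> R[i]^o) : qdiff F -> continuous F.
Proof.
move=> hF z; apply: differentiable_continuous; apply/derivable1_diffP.
exact: qdiff_derivable.
Qed.

End ComplexExponential.

(** * Gauge action and time evolution *)

Section GraphAutomorphism.
Context (R : realType) (G : digraph) (A : graph_cstar R G).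
Context (s : edge G -> R[i]) (hs : forall e, s e * (s e)^* = 1).
Local Notation F := (gc_fam A).
Let FP : is_graph_family F := gc_rel A.

Definition twist_fam : graph_family G A :=
  GraphFamily (gP F) (fun e => s e *: gS F e).

(** Phases of modulus one cancel in S_e S_e^* and in S_e^* S_e, so the universal property yields an
    endomorphism. *)
Lemma twist_fam_rel : is_graph_family twist_fam.
Proof.
have [h1 h2 h3 h4 h5] := FP.
have E e (a b : A) : (s e *: a) ∗ (s e *: b)^† = a ∗ b^†.
  by rewrite cstarZ cmulZl cmulZr scalerA hs scale1r.
split => //=.
- by move=> e; rewrite /is_partial_isometry E cmulZr gS_partial.
- move=> e; rewrite cstarZ cmulZl cmulZr scalerA mulrC hs scale1r; exact: h4.
- by move=> v nv; rewrite h5 //; apply: eq_bigr => e _; rewrite E.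
Qed.

Definition gaut : A -> A := proj1_sig (cid (gc_universal A twist_fam_rel)).

Lemma gaut_starhom : is_starhom gaut.
Proof. by rewrite /gaut; case: cid => f /= []. Qed.

Lemma gaut_gP v : gaut (gP F v) = gP F v.
Proof. by rewrite /gaut; case: cid => f /= []. Qed.

Lemma gaut_gS e : gaut (gS F e) = s e *: gS F e.
Proof. by rewrite /gaut; case: cid => f /= []. Qed.

Lemma gaut_cunit : gaut (cunit A) = cunit A.
Proof.
have [hD hZ _ _] := gaut_starhom.
have h0 : gaut 0 = 0 by rewrite -[X in gaut X](scale0r (0 : A)) hZ scale0r.
rewrite cunitE /gunit; elim/big_rec: _ => [//|v x _ hx].
by rewrite hD hx gaut_gP.
Qed.

Lemma gaut_sword v es : gaut (sword F v es) = (\prod_(e <- es) s e) *: sword F v es.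
Proof.
have [_ _ hM _] := gaut_starhom.
elim: es v => [|e es IH] v /=; first by rewrite gaut_gP big_nil scale1r.
by rewrite hM IH gaut_gS big_cons cmulZl cmulZr scalerA.
Qed.

Lemma gaut_gmonomial a : gmonomial F a -> exists k : R[i], gaut a = k *: a.
Proof.
have [_ _ hM hS] := gaut_starhom.
move=> [v [es [w [fs [_ _ _ ->]]]]]; rewrite hM hS !gaut_sword cstarZ cmulZl cmulZr.
by rewrite scalerA; eexists.
Qed.

End GraphAutomorphism.

(** * Scalings of M_B and invariance of the functional *)

Section Dynamics.
Context (R : realType) (B : oriented_complex).
Context (A1 : graph_cstar R (skeleton B)).
Context (A2 : graph_cstar R (boundary_graph B)).
Context (T : cstar_tensor A1 A2).
Implicit Types (x y : T).
Local Notation "a ⊗ c" := (tens T a c) (at level 35).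
Local Notation F1 := (gc_fam A1).
Local Notation F2 := (gc_fam A2).
Local Notation MB := (@MB _ _ _ _ T).
Let FP1 : is_graph_family F1 := gc_rel A1.
Let FP2 : is_graph_family F2 := gc_rel A2.
Implicit Types (v w : vert (skeleton B)) (es fs : seq (edge (skeleton B))).
Implicit Types (p q : edge (skeleton B)) (Os Ls : seq (edge (boundary_graph B))).

Definition word2 v es w fs p Os q Ls : T :=
  (sword F1 v es ∗ (sword F1 w fs)^†) ⊗ (sword F2 p Os ∗ (sword F2 q Ls)^†).

Lemma MB_word_ind (Q : T -> Prop) :
  Q 0 -> (forall x y, MB x -> MB y -> Q x -> Q y -> Q (x + y)) ->
  (forall k x, MB x -> Q x -> Q (k *: x)) ->
  (forall v es w fs p Os q Ls, is_walk v es -> is_walk w fs ->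
     @is_walk (boundary_graph B) p Os -> @is_walk (boundary_graph B) q Ls ->
     wend v es = wend w fs ->
     @wend (boundary_graph B) p Os = @wend (boundary_graph B) q Ls ->
     MB (word2 v es w fs p Os q Ls) -> Q (word2 v es w fs p Os q Ls)) ->
  forall x, MB x -> Q x.
Proof.
move=> Q0 QD QZ Qw; apply: MB_ind => // a c ha hc.
have M := MB_tens T ha hc; move: M.
case: ha => v [es [w [fs [wv ww E1 ->]]]]; case: hc => p [Os [q [Ls [wp wq E2 ->]]]].
exact: Qw.
Qed.

Section Twist.
Context (a : edge (skeleton B) -> R[i]) (b : face B -> R[i]).
Context (ha : forall e, a e * (a e)^* = 1) (hb : forall f, b f * (b f)^* = 1).
Let hb' : forall e : edge (boundary_graph B), b (tag e) * (b (tag e))^* = 1.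
Proof. by move=> e. Qed.

Definition twist_form (x : A1) (y : A2) : T := gaut ha x ⊗ gaut hb' y.

Lemma twist_bilinear : bilinear_map twist_form.
Proof.
have [hD hZ _ _] := gaut_starhom A1 ha.
have [kD kZ _ _] := gaut_starhom A2 hb'.
rewrite /twist_form; split=> [u u' v|u v v'|k u v|k u v].
- by rewrite hD tensDl.
- by rewrite kD tensDr.
- by rewrite hZ tensZl.
- by rewrite kZ tensZr.
Qed.

Definition twist : T -> T := tlift twist_form.

Lemma twist_tens u c : twist (u ⊗ c) = gaut ha u ⊗ gaut hb' c.
Proof. exact: (tlift_tens T twist_bilinear). Qed.

Lemma twistD x y : MB x -> MB y -> twist (x + y) = twist x + twist y.
Proof. by move=> Mx My; apply: (tliftD twist_bilinear); exact: MB_algtens. Qed.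

Lemma twistZ (k : R[i]) x : MB x -> twist (k *: x) = k *: twist x.
Proof. by move=> Mx; apply: (tliftZ twist_bilinear); exact: MB_algtens. Qed.

Lemma twist0 : twist 0 = 0.
Proof. exact: (tlift0 T twist_bilinear). Qed.

Lemma twist_MB x : MB x -> MB (twist x).
Proof.
move: x; apply: MB_ind => [|x y Mx My h h'|k x Mx h|u c hu hc].
- by rewrite twist0; exact: MB0.
- by rewrite twistD //; exact: MBD.
- by rewrite twistZ //; exact: MBZ.
rewrite twist_tens; have [k ->] := gaut_gmonomial ha hu.
have [l ->] := gaut_gmonomial hb' hc.
by rewrite tensZl tensZr; do 2 apply: MBZ; exact: MB_tens.
Qed.

Lemma twist_starhom : is_MB_starhom twist.
Proof.
have [_ _ hM hS] := gaut_starhom A1 ha.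
have [_ _ kM kS] := gaut_starhom A2 hb'.
split; first exact: twist_MB.
split; [exact: twistD | exact: twistZ | |].
- move=> x y + My; move: x; apply: MB_ind => [|x x' Mx Mx' h h'|k x Mx h|u c hu hc].
  + by rewrite cmul0l twist0 cmul0l.
  + by rewrite cmulDl !twistD ?h ?h' ?cmulDl //; exact: MBM.
  + by rewrite cmulZl !twistZ ?h ?cmulZl //; exact: MBM.
  have Mu := MB_tens T hu hc.
  move: y My; apply: MB_ind => [|y y' My My' h h'|k y My h|u' c' hu' hc'].
  + by rewrite cmul0r twist0 cmul0r.
  + by rewrite cmulDr !twistD ?h ?h' ?cmulDr //; exact: MBM.
  + by rewrite cmulZr !twistZ ?h ?cmulZr //; exact: MBM.
  by rewrite ct_mul !twist_tens hM kM ct_mul.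
apply: MB_ind => [|x x' Mx Mx' h h'|k x Mx h|u c hu hc].
- by rewrite cstar0 twist0 cstar0.
- by rewrite cstarD !twistD ?h ?h' ?cstarD //; exact: MB_star.
- by rewrite cstarZ !twistZ ?h ?cstarZ //; exact: MB_star.
by rewrite ct_star !twist_tens hS kS ct_star.
Qed.

Lemma twist_scales : scales_generators a b twist.
Proof.
split => [v|e|e|x].
- by rewrite /Pv /inL twist_tens gaut_gP gaut_cunit.
- by rewrite /Pe /inR twist_tens gaut_gP gaut_cunit.
- by rewrite /Se /inL twist_tens gaut_gS gaut_cunit tensZl.
- by rewrite /Sf /inR twist_tens gaut_gS gaut_cunit tensZr.
Qed.

End Twist.

Lemma scaling_ex (a : edge (skeleton B) -> R[i]) (b : face B -> R[i]) :
  (forall e, a e * (a e)^* = 1) -> (forall f, b f * (b f)^* = 1) ->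
  exists f : T -> T, is_MB_starhom f /\ scales_generators a b f.
Proof.
move=> ha hb; exists (twist ha hb).
by split; [exact: twist_starhom | exact: twist_scales].
Qed.

Definition wprod (a : edge (skeleton B) -> R[i]) (b : face B -> R[i]) es fs Os Ls : R[i] :=
  (\prod_(e <- es) a e) * (\prod_(e <- fs) a e)^* *
  ((\prod_(x <- Os) b (tag x)) * (\prod_(x <- Ls) b (tag x))^*).

Section Scaling.
Context (a : edge (skeleton B) -> R[i]) (b : face B -> R[i]).
Context (f : T -> T) (fh : is_MB_starhom f) (fs : scales_generators a b f).

(** A word is a product of embedded generators and their adjoints. The lemma covers every
    homomorphism scaling the generators, not just [twist]: the theorem speaks of an arbitrary time
    evolution, and the group laws are read off these scalars. *)
Lemma scaling_word v es w fs' p Os q Ls :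
  f (word2 v es w fs' p Os q Ls) = wprod a b es fs' Os Ls *: word2 v es w fs' p Os q Ls.
Proof.
have [_ [fD fZ fM fS]] := fh; have [fPv fPe fSe fSf] := fs.
have mL u ds : MB (inL T (sword F1 u ds)) by apply: MB_inL; exact: gmonomial0_word.
have mR u ds : MB (inR T (sword F2 u ds)) by apply: MB_inR; exact: gmonomial0_word.
have mS e : MB (inL T (gS F1 e)).
  by apply: MB_inL; right; exact: gS_gmonomial.
have mS' e : MB (inR T (gS F2 e)).
  by apply: MB_inR; right; exact: gS_gmonomial.
have hL u ds : f (inL T (sword F1 u ds)) = (\prod_(e <- ds) a e) *: inL T (sword F1 u ds).
  elim: ds u => [|e ds IH] u /=; first by rewrite big_nil scale1r; exact: fPv.
  by rewrite -inLM fM // IH [f _]fSe big_cons cmulZl cmulZr scalerA.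
have hR u ds : f (inR T (sword F2 u ds)) =
    (\prod_(e <- ds) b (tag e)) *: inR T (sword F2 u ds).
  elim: ds u => [|e ds IH] u /=; first by rewrite big_nil scale1r; exact: fPe.
  by rewrite -inRM fM // IH [f _]fSf big_cons cmulZl cmulZr scalerA.
have E : word2 v es w fs' p Os q Ls = (inL T (sword F1 v es) ∗ (inL T (sword F1 w fs'))^†) ∗
    (inR T (sword F2 p Os) ∗ (inR T (sword F2 q Ls))^†).
  by rewrite inL_star inR_star inLM inRM inLR.
have mLs u ds := MB_star (mL u ds); have mRs u ds := MB_star (mR u ds).
rewrite {1}E !fM ?fS //; try exact: MBM.
rewrite !hL !hR !cstarZ !cmulZl !cmulZr !cmulZl !scalerA -E.
by congr (_ *: _); rewrite /wprod; ring.
Qed.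

End Scaling.

Lemma MB_starhom_eq (f h : T -> T) : is_MB_starhom f -> is_MB_starhom h ->
  (forall v es w fs p Os q Ls, MB (word2 v es w fs p Os q Ls) ->
     f (word2 v es w fs p Os q Ls) = h (word2 v es w fs p Os q Ls)) ->
  forall x, MB x -> f x = h x.
Proof.
move=> [_ [fD fZ _ _]] [_ [hD hZ _ _]] E.
apply: MB_word_ind => [|x y Mx My|k x Mx|].
- have M0 := MB0 T.
  by have := fZ 0 _ M0; have := hZ 0 _ M0; rewrite !scale0r => -> ->.
- by rewrite fD ?hD // => -> ->.
- by rewrite fZ ?hZ // => ->.
by move=> *; exact: E.
Qed.

Lemma MB_starhom_id : is_MB_starhom (fun x : T => x).
Proof. by []. Qed.

Lemma MB_starhom_comp (f h : T -> T) : is_MB_starhom f -> is_MB_starhom h ->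
  is_MB_starhom (f \o h).
Proof.
move=> [f0 [fD fZ fM fS]] [h0 [hD hZ hM hS]].
split; first by move=> x Mx /=; apply: f0; exact: h0.
split=> [x y Mx My|k x Mx|x y Mx My|x Mx] /=.
- by rewrite hD // fD //; exact: h0.
- by rewrite hZ // fZ //; exact: h0.
- by rewrite hM // fM //; exact: h0.
- by rewrite hS // fS //; exact: h0.
Qed.

Section WeightInvariance.
Context (g : vert (skeleton B) -> R) (lamt lam : edge (skeleton B) -> R).
Context (eta : face B -> R) (rw : rank2_weight g lamt lam eta).
Local Notation psi := (psi (T := T) g lamt lam eta).
Local Notation etat := (fun x : edge (boundary_graph B) => eta (tag x)).
Let gw1 : graph_weight g lamt. Proof. by case: rw. Qed.
Let gw2 : @graph_weight R (boundary_graph B) lam etat. Proof. by case: rw. Qed.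

Lemma psi_word v es w fs p Os q Ls : is_walk v es -> is_walk w fs ->
  @is_walk (boundary_graph B) p Os -> @is_walk (boundary_graph B) q Ls ->
  wend v es = wend w fs -> @wend (boundary_graph B) p Os = @wend (boundary_graph B) q Ls ->
  psi (word2 v es w fs p Os q Ls) =
  ((v, es) == (w, fs))%:R * ((p, Os) == (q, Ls))%:R *
  (pweight g lamt v es *
   @pweight R (boundary_graph B) lam etat p Os)%:C.
Proof.
move=> wv ww wp wq E1 E2; rewrite (psi_tens T rw); first last.
- by right; exists p, Os, q, Ls.
- by right; exists v, es, w, fs.
rewrite (phi_sword _ gw1) // (phi_sword _ gw2) // mulrACA; congr (_ * _).
by apply/esym; exact: rmorphM.
Qed.

(** On a word where [psi] does not vanish, the two paths in each factor coincide and the phases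
    cancel in pairs. *)
Lemma psi_invariant (a : edge (skeleton B) -> R[i]) (b : face B -> R[i]) f :
  (forall e, a e * (a e)^* = 1) -> (forall d, b d * (b d)^* = 1) ->
  is_MB_starhom f -> scales_generators a b f -> forall x, MB x -> psi (f x) = psi x.
Proof.
move=> ha hb fh fs; have [fM [fD fZ _ _]] := fh.
have aprod es : (\prod_(e <- es) a e) * (\prod_(e <- es) a e)^* = 1.
  elim: es => [|e es IH]; first by rewrite big_nil rmorph1 mulr1.
  by rewrite big_cons rmorphM mulrACA ha mul1r.
have bprod Os : (\prod_(x <- Os) b (tag x)) * (\prod_(x <- Os) b (tag x))^* = 1.
  elim: Os => [|e es IH]; first by rewrite big_nil rmorph1 mulr1.
  by rewrite big_cons rmorphM mulrACA hb mul1r.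
apply: MB_word_ind => [|x y Mx My hx hy|k x Mx hx|].
- by have := fZ 0 _ (MB0 T); rewrite !scale0r => ->.
- by rewrite fD // !(psiD rw) ?hx ?hy //; exact: fM.
- by rewrite fZ // !(psiZ rw) ?hx //; exact: fM.
move=> v es w ds p Os q Ls wv ww wp wq E1 E2 M.
rewrite (scaling_word fh fs) (psiZ rw) // psi_word //.
case: eqP => [[_ <-]|_]; last by rewrite !mul0r mulr0.
case: eqP => [[_ <-]|_]; last by rewrite !(mulr0, mul0r).
by rewrite /wprod aprod bprod !mul1r.
Qed.

Lemma psi_weight : is_weight psi.
Proof. by split; [exact: (psiD rw) | exact: (psiZ rw) | exact: (psi_ge0 rw)]. Qed.

Lemma psi_formula : monomial_formula g lamt lam eta psi.
Proof.
move=> [[v es] wv] [[w fs] ww] [[p Os] wp] [[q Ls] wq] E1 E2.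
by rewrite monomial_tens !Spath_sword psi_word.
Qed.

Lemma psi_unique (psi' : T -> R[i]) : is_weight psi' ->
  monomial_formula g lamt lam eta psi' -> forall x, MB x -> psi' x = psi x.
Proof.
move=> [pD pZ _] pF; apply: MB_ind => [|x y Mx My hx hy|k x Mx hx|a c].
- have := pZ 0 _ (MB0 T); have := psiZ rw 0 (MB0 T).
  by rewrite !scale0r !mul0r => -> ->.
- by rewrite pD // (psiD rw) // hx hy.
- by rewrite pZ // (psiZ rw) // hx.
move=> /gmonomial_paths[mu [nu [E1 ->]]] /gmonomial_paths[Om [La [E2 ->]]].
by rewrite -monomial_tens pF // psi_formula.
Qed.

(** Both sides are linear in y, so y may be taken to be a tensor of monomials; then the relations
    [phi_kms] of the two factors are multiplied. *)
Lemma psi_kms_word v es w fs p Os q Ls y : is_walk v es -> is_walk w fs ->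
  @is_walk (boundary_graph B) p Os -> @is_walk (boundary_graph B) q Ls ->
  wend v es = wend w fs -> @wend (boundary_graph B) p Os = @wend (boundary_graph B) q Ls ->
  MB y ->
  (lprod lamt fs * @lprod R (boundary_graph B) etat Ls) *
    psi (word2 v es w fs p Os q Ls ∗ y) =
  (lprod lamt es * @lprod R (boundary_graph B) etat Os) *
    psi (y ∗ word2 v es w fs p Os q Ls).
Proof.
move=> wv ww wp wq E1 E2; set x := word2 _ _ _ _ _ _ _ _.
have h1 : gmonomial0 F1 (sword F1 v es ∗ (sword F1 w fs)^†).
  by right; exists v, es, w, fs.
have h2 : gmonomial0 F2 (sword F2 p Os ∗ (sword F2 q Ls)^†).
  by right; exists p, Os, q, Ls.
have Mx : MB x by exact: MB_tens0.
move: y; apply: MB_ind => [|y y' My My' hy hy'|k y My hy|a c ha hc].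
- have := psiZ rw 0 (MB0 T); rewrite scale0r mul0r => h0.
  by rewrite cmul0l cmul0r h0 !mulr0.
- rewrite cmulDl cmulDr !(psiD rw); try exact: MBM.
  by rewrite !mulrDr hy hy'.
- rewrite cmulZl cmulZr !(psiZ rw); try exact: MBM.
  by rewrite !(mulrCA _ k) hy.
rewrite /x /word2 !ct_mul !(psi_tens T rw);
  try by apply: gmonomial0M => //; right.
rewrite mulrACA [RHS]mulrACA (phi_kms gw1 v es w fs (or_intror ha)).
by rewrite (phi_kms gw2 p Os q Ls (or_intror hc)).
Qed.

End WeightInvariance.

End Dynamics.

Section ImaginaryPowers.
Context (R : realType).
Implicit Types (x s t l : R).

(** Defined through [cexp] so that the same formula extends to complex time. *)
Definition cis l t : R[i] := cexp ('i%C * l%:C * t%:C).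

Lemma cisE l t : cis l t = cos (t * l) +i* sin (t * l).
Proof.
rewrite /cis (_ : 'i%C * l%:C * t%:C = 0 +i* (t * l)).
  by rewrite /cexp /= expR0 !mul1r.
by apply/eqP; rewrite eq_complex /=; apply/andP; split; apply/eqP; ring.
Qed.

Lemma powit_cis x t : powit x t = cis (ln x) t.
Proof. by rewrite cisE. Qed.

Lemma cexp0 : cexp 0 = 1 :> R[i].
Proof. by rewrite /cexp /= expR0 cos0 sin0 mulr0 mulr1. Qed.

Lemma cisDl l l' t : cis (l + l') t = cis l t * cis l' t.
Proof. by rewrite /cis -cexpD rmorphD mulrDr mulrDl. Qed.

Lemma cisDr l s t : cis l (s + t) = cis l s * cis l t.
Proof. by rewrite /cis -cexpD rmorphD mulrDr. Qed.

Lemma cis_0l t : cis 0 t = 1. Proof. by rewrite /cis rmorph0 mulr0 mul0r cexp0. Qed.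

Lemma cis_0r l : cis l 0 = 1. Proof. by rewrite /cis rmorph0 mulr0 cexp0. Qed.

Lemma cis_conj l t : (cis l t)^* = cis (- l) t.
Proof. by rewrite !cisE mulrN cosN sinN. Qed.

Lemma cis_unit l t : cis l t * (cis l t)^* = 1.
Proof. by rewrite cis_conj -cisDl subrr cis_0l. Qed.

(** Shifting time by i produces the factor e^(-l) of the KMS condition. *)
Lemma cis_imag l t :
  cexp ('i%C * l%:C * (t +i* 1)) = cis l t * (expR (- l))%:C.
Proof.
have -> : 'i%C * l%:C * (t +i* 1) = 'i%C * l%:C * t%:C + (- l)%:C.
  by apply/eqP; rewrite eq_complex /=; apply/andP; split; apply/eqP; ring.
by rewrite cexpD; congr (_ * _); rewrite /cexp /= cos0 sin0 mulr1 mulr0.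
Qed.

Lemma real_complex_continuous : continuous (fun t : R => t%:C : R[i]^o).
Proof.
move=> t; apply/cvgrPdist_lt => /= e e0.
have eE : e = (Re e)%:C by rewrite RRe_real // gtr0_real.
have e0' : 0 < Re e by rewrite -ltcR -eE.
near=> u.
rewrite eE -rmorphB normc_def /= expr0n addr0 sqrtr_sqr ltcR.
by near: u; exact: cvgr_dist_lt.
Unshelve. all: by end_near. Qed.

Lemma cis_continuous l (V : normedModType R[i]) (a : V) :
  continuous (fun t : R => cis l t *: a).
Proof.
move=> t; apply: cvgZr_tmp.
apply: (@cvg_comp _ _ _ (fun t : R => t%:C) (fun z => cexp ('i%C * l%:C * z))
  _ (nbhs (t%:C : R[i]^o))).
  exact: real_complex_continuous.
exact: (@qdiff_continuous R _ (qdiff_cexp l) t%:C).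
Qed.

Lemma prod_powit (E : Type) (f : E -> R) (es : seq E) t :
  \prod_(e <- es) powit (f e) t = cis (\sum_(e <- es) ln (f e)) t.
Proof.
elim: es => [|e es IH]; first by rewrite !big_nil cis_0l.
by rewrite !big_cons cisDl powit_cis IH.
Qed.

Lemma prod_expR_ln (E : Type) (f : E -> R) (es : seq E) : (forall e, 0 < f e) ->
  \prod_(e <- es) (f e)%:C = (expR (\sum_(e <- es) ln (f e)))%:C.
Proof.
move=> f0; elim: es => [|e es IH]; first by rewrite !big_nil expR0.
by rewrite !big_cons expRD IH lnK ?posrE // rmorphM.
Qed.

End ImaginaryPowers.

(** * Time evolution and the KMS condition *)

Section Evolution.
Context (R : realType) (B : oriented_complex).
Context (A1 : graph_cstar R (skeleton B)).
Context (A2 : graph_cstar R (boundary_graph B)).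
Context (T : cstar_tensor A1 A2).
Context (lamt : edge (skeleton B) -> R) (eta : face B -> R).
Implicit Types (x y : T).
Local Notation MB := (@MB _ _ _ _ T).
Local Notation etat := (fun x : edge (boundary_graph B) => eta (tag x)).

(** Words are eigenvectors of the evolution, with eigenvalue e^(i t l) for this l. *)
Definition energy (es fs : seq (edge (skeleton B)))
    (Os Ls : seq (edge (boundary_graph B))) : R :=
  (\sum_(e <- es) ln (lamt e) - \sum_(e <- fs) ln (lamt e)) +
  (\sum_(x <- Os) ln (etat x) - \sum_(x <- Ls) ln (etat x)).

Lemma wprod_powit es fs Os Ls t :
  wprod (fun e => powit (lamt e) t) (fun f => powit (eta f) t) es fs Os Ls =
  cis (energy es fs Os Ls) t.
Proof.
by rewrite /wprod !prod_powit !cis_conj -!cisDl.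
Qed.

Lemma powit_unit (x t : R) : powit x t * (powit x t)^* = 1.
Proof. by rewrite powit_cis cis_unit. Qed.

Lemma weight_evolution_ex : exists sig : R -> T -> T, weight_evolution lamt eta sig.
Proof.
have ex t : exists f : T -> T, is_MB_starhom f /\
    scales_generators (fun e => powit (lamt e) t) (fun f => powit (eta f) t) f.
  by apply: scaling_ex => ?; exact: powit_unit.
exists (fun t => proj1_sig (cid (ex t))); set sig := fun t => _.
have sh t : is_MB_starhom (sig t) by rewrite /sig; case: cid => f [].
have ss t : scales_generators (fun e => powit (lamt e) t)
  (fun f => powit (eta f) t) (sig t) by rewrite /sig; case: cid => f [].
have sw t v es w fs p Os q Ls : sig t (word2 T v es w fs p Os q Ls) =
    cis (energy es fs Os Ls) t *: word2 T v es w fs p Os q Ls.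
  by rewrite (scaling_word (sh t) (ss t)) wprod_powit.
split=> //; split=> // [x Mx|s t x Mx|].
- apply: (MB_starhom_eq (sh 0) (MB_starhom_id T)) => // *.
  by rewrite sw cis_0r scale1r.
- apply: (MB_starhom_eq (sh (s + t)) (MB_starhom_comp (sh s) (sh t))) => //=.
  move=> v es w fs p Os q Ls M; rewrite !sw.
  have [_ [_ fZ _ _]] := sh s.
  by rewrite fZ // sw scalerA cisDr mulrC.
apply: MB_word_ind => [|x y Mx My hx hy|k x Mx hx|].
- have -> : (fun t => sig t 0) = fun=> 0.
    apply/funext => t; have [_ [_ fZ _ _]] := sh t.
    by have := fZ 0 _ (MB0 T); rewrite !scale0r.
  exact: cst_continuous.
- have -> : (fun t => sig t (x + y)) = (fun t => sig t x) + (fun t => sig t y).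
    by apply/funext => t; have [_ [fD _ _ _]] := sh t; rewrite fD.
  by move=> t; apply: cvgD; [exact: hx | exact: hy].
- have -> : (fun t => sig t (k *: x)) = k \*: (fun t => sig t x).
    by apply/funext => t; have [_ [_ fZ _ _]] := sh t; rewrite fZ.
  by move=> t; apply: cvgZl_tmp; exact: hx.
move=> v es w fs p Os q Ls _ _ _ _ _ _ _.
have -> : (fun t => sig t (word2 T v es w fs p Os q Ls)) =
    (fun t => cis (energy es fs Os Ls) t *: word2 T v es w fs p Os q Ls).
  by apply/funext => t; rewrite sw.
exact: cis_continuous.
Qed.

Context (g : vert (skeleton B) -> R) (lam : edge (skeleton B) -> R).
Context (rw : rank2_weight g lamt lam eta).
Context (lamt0 : forall e, 0 < lamt e) (eta0 : forall f, 0 < eta f).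
Local Notation psi := (psi (T := T) g lamt lam eta).

Lemma psi_kms_energy v es w fs p Os q Ls y : is_walk v es -> is_walk w fs ->
  @is_walk (boundary_graph B) p Os -> @is_walk (boundary_graph B) q Ls ->
  wend v es = wend w fs -> @wend (boundary_graph B) p Os = @wend (boundary_graph B) q Ls ->
  MB y ->
  psi (y ∗ word2 T v es w fs p Os q Ls) =
  (expR (- energy es fs Os Ls))%:C * psi (word2 T v es w fs p Os q Ls ∗ y).
Proof.
move=> wv ww wp wq E1 E2 My.
have := psi_kms_word rw wv ww wp wq E1 E2 My.
rewrite /lprod !(prod_expR_ln _ lamt0).
have h Xs : \prod_(e <- Xs) (etat e)%:C = (expR (\sum_(e <- Xs) ln (etat e)))%:C.
  by apply: prod_expR_ln => e; exact: eta0.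
rewrite !h -!rmorphM -!expRD => K.
have e0 : (expR (\sum_(e <- es) ln (lamt e) + \sum_(e <- Os) ln (etat e)))%:C != 0 :> R[i].
  by rewrite gt_eqF // ltcR expR_gt0.
apply: (mulfI e0); rewrite -K mulrA -rmorphM -expRD; congr (_%:C * _).
by congr expR; rewrite /energy; ring.
Qed.

Lemma psi_kms sig : weight_evolution lamt eta sig -> kms sig psi.
Proof.
move=> [[sh s0 sD sc] ss]; split.
  by move=> t x Mx; apply: (psi_invariant rw _ _ (sh t) (ss t)) => // ?; exact: powit_unit.
move=> x y Mx My.
(* Analyticity on the strip is strengthened to [qdiff] on the whole plane, which is stable under
   sums and multiples, so that the induction on x goes through. *)
suff [F [Fd F0 F1]] : exists F : R[i] -> R[i], [/\ qdiff F,
    forall t : R, F t%:C = psi (sig t x ∗ y) &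
    forall t : R, F (t +i* 1) = psi (y ∗ sig t x)].
  exists F; split=> //; first by move=> z _; exact: qdiff_derivable.
  by apply: continuous_subspaceT; exact: qdiff_continuous.
have sM t z : MB z -> MB (sig t z) by move=> Mz; case: (sh t) => + _; exact.
have sigD t z z' : MB z -> MB z' -> sig t (z + z') = sig t z + sig t z'.
  by case: (sh t) => _ [+ _ _ _]; exact.
have sigZ t k z : MB z -> sig t (k *: z) = k *: sig t z.
  by case: (sh t) => _ [_ + _ _]; exact.
have psi0 : psi 0 = 0.
  by have := psiZ rw 0 (MB0 T); rewrite scale0r mul0r.
move: x Mx; apply: MB_word_ind => [|x x' Mx Mx' [F [Fd F0 F1]] [G [Gd G0 G1]]|k x Mx [F [Fd F0 F1]]|].
- exists (fun=> 0); have s00 t : sig t 0 = 0.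
    by have := sigZ t 0 _ (MB0 T); rewrite !scale0r.
  split=> [z|t|t]; rewrite ?s00 ?cmul0l ?cmul0r ?psi0 //.
  exists 0, 0, 1; split => // h _.
  by rewrite mul0r !subr0 normr0 mul0r.
- exists (fun z => F z + G z); split; first exact: qdiffD.
    move=> t; rewrite F0 G0 sigD // cmulDl (psiD rw) //; apply: MBM => //; exact: sM.
  move=> t; rewrite F1 G1 sigD // cmulDr (psiD rw) //; apply: MBM => //; exact: sM.
- exists (fun z => k * F z); split; first exact: qdiffZ.
    move=> t; rewrite F0 sigZ // cmulZl (psiZ rw) //; apply: MBM => //; exact: sM.
  move=> t; rewrite F1 sigZ // cmulZr (psiZ rw) //; apply: MBM => //; exact: sM.
move=> v es w fs p Os q Ls wv ww wp wq E1 E2 Mx.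
set x := word2 _ _ _ _ _ _ _ _ _ in Mx *; set l := energy es fs Os Ls.
have sw t : sig t x = cis l t *: x.
  by rewrite (scaling_word (sh t) (ss t)) wprod_powit.
(* At real t this is the eigenvalue equation of the word x; at t + i the additional factor e^(-l) is
   the one in [psi_kms_energy]. *)
exists (fun z => psi (x ∗ y) * cexp ('i%C * l%:C * z)).
split; first by apply: qdiffZ; exact: qdiff_cexp.
  move=> t; rewrite sw cmulZl (psiZ rw); last exact: MBM.
  by rewrite -/(cis l t) [LHS]mulrC.
move=> t; rewrite sw cmulZr (psiZ rw) //; last exact: MBM.
by rewrite cis_imag psi_kms_energy // [LHS]mulrC mulrA.
Qed.

Lemma psi_gauge_invariant : gauge_invariant psi.
Proof.
have unit (z : R[i]) : `|z| = 1 -> z * z^* = 1.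
  by move=> z1; rewrite -normCK z1 expr1n.
(* Guarding the requirement by the two moduli lets [gam] be chosen for all z and w; off the torus
   the identity serves. *)
pose P z w (f : T -> T) := `|z| = 1 -> `|w| = 1 ->
  is_MB_starhom f /\ scales_generators (fun=> z) (fun=> w) f.
have ex z w : exists f, P z w f.
  case: (pselect (`|z| = 1 /\ `|w| = 1)) => [[z1 w1]|h].
    have [f hf] := @scaling_ex _ _ _ _ T (fun=> z) (fun=> w) (fun=> unit z z1) (fun=> unit w w1).
    by exists f => _ _.
  by exists id => z1 w1; case: h.
pose gam z w := proj1_sig (cid (ex z w)).
have gP z w : P z w (gam z w) by rewrite /gam; case: cid.
have gw z w : `|z| = 1 -> `|w| = 1 -> forall v es u fs p Os q Ls,
    gam z w (word2 T v es u fs p Os q Ls) =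
    wprod (fun=> z) (fun=> w) es fs Os Ls *: word2 T v es u fs p Os q Ls.
  move=> z1 w1 *; have [gh gs] := gP z w z1 w1.
  by rewrite (scaling_word gh gs).
exists gam.
  split=> [x Mx|z w z' w' z1 w1 z'1 w'1 x Mx|z w z1 w1]; last exact: gP.
    have [gh _] := gP 1 1 (normr1 _) (normr1 _).
    apply: (MB_starhom_eq gh (MB_starhom_id T)) => // *.
    by rewrite gw ?normr1 // /wprod !big1 // rmorph1 !mulr1 scale1r.
  have zz : `|z * z'| = 1 by rewrite normrM z1 z'1 mulr1.
  have ww : `|w * w'| = 1 by rewrite normrM w1 w'1 mulr1.
  have [gh _] := gP _ _ zz ww.
  have [gh1 _] := gP _ _ z1 w1; have [gh2 _] := gP _ _ z'1 w'1.
  apply: (MB_starhom_eq gh (MB_starhom_comp gh1 gh2)) => //=.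
  move=> v es u fs p Os q Ls M; have [_ [_ fZ _ _]] := gh1.
  rewrite !gw // fZ // gw // scalerA; congr (_ *: _).
  by rewrite /wprod !big_split /= !rmorphM /=; ring.
move=> z w z1 w1 x Mx; have [gh gs] := gP z w z1 w1.
by apply: (psi_invariant rw _ _ gh gs) => // _; exact: unit.
Qed.

End Evolution.

(** * Faithful weights *)

Section FaithfulWeights.
Context (R : realType) (B : oriented_complex).
Context (A1 : graph_cstar R (skeleton B)).
Context (A2 : graph_cstar R (boundary_graph B)).
Context (T : cstar_tensor A1 A2).
Implicit Types (x y : T).
Local Notation MB := (@MB _ _ _ _ T).
Local Notation F1 := (gc_fam A1).
Local Notation F2 := (gc_fam A2).
Let FP1 : is_graph_family F1 := gc_rel A1.
Let FP2 : is_graph_family F2 := gc_rel A2.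

Lemma tens_gP_neq0 v e : tens T (gP F1 v) (gP F2 e) != 0.
Proof.
apply/eqP => /(@tens_dcoef_eq0 _ _ _ _ T _ _ (v, 0%N, 0) (e, 0%N, 0)).
by rewrite !dcoef_gP mulr1 => /eqP; rewrite oner_eq0.
Qed.

Lemma Pv_Pe v e : Pv T v ∗ Pe T e = tens T (gP F1 v) (gP F2 e).
Proof. exact: inLR. Qed.

(** Nonvanishing of P_v tensor 1 is tested on P_v tensor P_e, which takes some edge e; a face
    provides one, its word being nonempty. *)
Lemma edge_inhabited : inhabited (edge (skeleton B)).
Proof.
have /card_gt0P[f _] := face_exists B.
by constructor; exact: (tnth (fword f) (Ordinal (flen_gt0 f))).
Qed.

Lemma Pv_neq0 v : Pv T v != 0.
Proof.
have [e] := edge_inhabited; apply: contra (tens_gP_neq0 v e) => /eqP h.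
by rewrite -Pv_Pe h cmul0l.
Qed.

Lemma Pe_neq0 e : Pe T e != 0.
Proof.
apply: contra (tens_gP_neq0 (src e) e) => /eqP h.
by rewrite -Pv_Pe h cmul0r.
Qed.

Lemma Pv_star v : (Pv T v)^† = Pv T v.
Proof. by rewrite /Pv inL_star gP_star. Qed.
Lemma Pe_star e : (Pe T e)^† = Pe T e.
Proof. by rewrite /Pe inR_star gP_star. Qed.
Lemma PvK v : Pv T v ∗ Pv T v = Pv T v.
Proof. by rewrite /Pv inLM gPP // eqxx. Qed.
Lemma PeK e : Pe T e ∗ Pe T e = Pe T e.
Proof. by rewrite /Pe inRM gPP // eqxx. Qed.
Lemma Se_star_Se e : (Se T e)^† ∗ Se T e = Pv T (rng e).
Proof. by rewrite /Se inL_star inLM gSSr. Qed.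
Lemma Sf_star_Sf (d : edge (boundary_graph B)) : (Sf T d)^† ∗ Sf T d = Pe T (rng d).
Proof. by rewrite /Sf inR_star inRM gSSr. Qed.

Lemma Pv_sum v : nonsink v ->
  Pv T v = \sum_(e <- [seq e <- index_enum (edge (skeleton B)) | src e == v]) Se T e ∗ (Se T e)^†.
Proof.
move=> nv; rewrite /Pv (_ : gP F1 v = \sum_(e | src e == v) gS F1 e ∗ (gS F1 e)^†).
  rewrite -big_filter /inL tens_suml; apply: eq_bigr => e _.
  by rewrite /Se inL_star inLM.
by have [_ _ _ _ h] := FP1; exact: h.
Qed.

Lemma Pe_sum (e : vert (boundary_graph B)) : nonsink e ->
  Pe T e = \sum_(d <- [seq d <- index_enum (edge (boundary_graph B)) | src d == e]) Sf T d ∗ (Sf T d)^†.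
Proof.
move=> nv; rewrite /Pe (_ : gP F2 e = \sum_(d | src d == e) gS F2 d ∗ (gS F2 d)^†).
  rewrite -big_filter /inR tens_sumr; apply: eq_bigr => d _.
  by rewrite /Sf inR_star inRM.
by have [_ _ _ _ h] := FP2; exact: h.
Qed.

Lemma MB_Pv v : MB (Pv T v).
Proof. by apply: MB_inL; right; exact: gP_gmonomial. Qed.
Lemma MB_Pe e : MB (Pe T e).
Proof. by apply: MB_inR; right; exact: gP_gmonomial. Qed.
Lemma MB_Se e : MB (Se T e).
Proof. by apply: MB_inL; right; exact: gS_gmonomial. Qed.
Lemma MB_Sf d : MB (Sf T d).
Proof. by apply: MB_inR; right; exact: gS_gmonomial. Qed.

Context (psi : T -> R[i]) (pw : is_weight psi) (pf : faithful psi).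

Lemma weight_sum (I : Type) (r : seq I) (F : I -> T) : (forall i, MB (F i)) ->
  psi (\sum_(i <- r) F i) = \sum_(i <- r) psi (F i).
Proof.
have [pD pZ _] := pw => MF; elim: r => [|i r IH].
  by have := pZ 0 _ (MB0 T); rewrite !big_nil scale0r mul0r.
by rewrite !big_cons pD ?IH //; exact: MB_sum.
Qed.

Lemma psi_Pv_gt0 v : 0 < psi (Pv T v).
Proof.
by rewrite -PvK -{1}Pv_star; apply: pf; [exact: MB_Pv | exact: Pv_neq0].
Qed.

Lemma psi_Pe_gt0 e : 0 < psi (Pe T e).
Proof.
by rewrite -PeK -{1}Pe_star; apply: pf; [exact: MB_Pe | exact: Pe_neq0].
Qed.

Lemma psi_SS_gt0 x : MB x -> x != 0 -> 0 < psi (x ∗ x^†).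
Proof.
move=> Mx x0; rewrite -{1}(cstarK x); apply: pf; first exact: MB_star.
by apply: contra x0 => /eqP h; rewrite -(cstarK x) h cstar0.
Qed.

Lemma Se_neq0 e : Se T e != 0.
Proof.
by apply: contra (Pv_neq0 (rng e)) => /eqP h; rewrite -Se_star_Se h cmul0r.
Qed.

Lemma Sf_neq0 d : Sf T d != 0.
Proof.
by apply: contra (Pe_neq0 (rng d)) => /eqP h; rewrite -Sf_star_Sf h cmul0r.
Qed.

Definition edge_ratio e : R[i] :=
  psi (Se T e ∗ (Se T e)^†) / psi ((Se T e)^† ∗ Se T e).

Lemma edge_ratio_gt0 e : 0 < edge_ratio e.
Proof.
rewrite /edge_ratio Se_star_Se divr_gt0 ?psi_Pv_gt0 //.
by apply: psi_SS_gt0; [exact: MB_Se | exact: Se_neq0].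
Qed.

Lemma face_ratio_gt0 (f : face B) (i : 'I_(flen f)) : 0 < face_ratio psi i.
Proof.
rewrite /face_ratio Sf_star_Sf divr_gt0 ?psi_Pe_gt0 //.
by apply: psi_SS_gt0; [exact: MB_Sf | exact: Sf_neq0].
Qed.

Lemma edge_ratioK e : edge_ratio e * psi (Pv T (rng e)) = psi (Se T e ∗ (Se T e)^†).
Proof. by rewrite /edge_ratio Se_star_Se divfK // gt_eqF // psi_Pv_gt0. Qed.

Lemma face_ratioK (d : edge (boundary_graph B)) :
  face_ratio psi (tagged d) * psi (Pe T (rng d)) = psi (Sf T d ∗ (Sf T d)^†).
Proof.
case: d => f i /=.
by rewrite /face_ratio Sf_star_Sf divfK // gt_eqF // psi_Pe_gt0.
Qed.

Lemma Re_gt0E (z : R[i]) : 0 < z -> (Re z)%:C = z.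
Proof. by move=> z0; rewrite RRe_real // gtr0_real. Qed.

Lemma faithful_rank2_weight :
  (forall (f : face B) (i j : 'I_(flen f)), face_ratio psi i = face_ratio psi j) ->
  exists (g : vert (skeleton B) -> R) (lamt lam : edge (skeleton B) -> R)
      (eta : face B -> R),
    [/\ forall v, (g v)%:C = psi (Pv T v),
        forall e, (lamt e)%:C =
          psi (Se T e ∗ (Se T e)^†) / psi ((Se T e)^† ∗ Se T e),
        forall e, (lam e)%:C = psi (Pe T e),
        forall (f : face B) (i : 'I_(flen f)), (eta f)%:C = face_ratio psi i &
        rank2_weight g lamt lam eta /\
        [/\ nowhere_zero g, nowhere_zero lamt, nowhere_zero lam & nowhere_zero eta]].
Proof.
move=> const.
pose g v := Re (psi (Pv T v)); pose lamt e := Re (edge_ratio e).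
pose lam e := Re (psi (Pe T e)).
(* The letter of index 0 exists because words are nonempty; by [const] any other letter gives the
   same ratio. *)
pose eta (f : face B) := Re (face_ratio psi (Ordinal (flen_gt0 f))).
have gE v : (g v)%:C = psi (Pv T v) by apply: Re_gt0E; exact: psi_Pv_gt0.
have lE e : (lamt e)%:C = edge_ratio e by apply: Re_gt0E; exact: edge_ratio_gt0.
have mE e : (lam e)%:C = psi (Pe T e) by apply: Re_gt0E; exact: psi_Pe_gt0.
have eE (f : face B) (i : 'I_(flen f)) : (eta f)%:C = face_ratio psi i.
  by rewrite (const f i (Ordinal (flen_gt0 f))); apply: Re_gt0E; exact: face_ratio_gt0.
have g0 v : 0 < g v by rewrite -ltcR gE psi_Pv_gt0.
have l0 e : 0 < lamt e by rewrite -ltcR lE edge_ratio_gt0.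
have m0 e : 0 < lam e by rewrite -ltcR mE psi_Pe_gt0.
have e0 f : 0 < eta f by rewrite -ltcR (eE f (Ordinal (flen_gt0 f))) face_ratio_gt0.
exists g, lamt, lam, eta; split=> //; split; last first.
  by split=> ?; rewrite gt_eqF.
split; last 2 first.
- by move=> f; exact: ltW.
- split=> [v|e|e ne]; [exact: ltW | exact: ltW|].
  apply: (@complexI R); rewrite mE (Pe_sum ne) weight_sum.
    rewrite big_filter rmorph_sum; apply: eq_bigr => d _.
    by rewrite rmorphM /= mE (eE _ (tagged d)) face_ratioK.
  by move=> d; apply: MBM; [exact: MB_Sf | apply: MB_star; exact: MB_Sf].
split=> [v|e|v nv]; [exact: ltW | exact: ltW|].
apply: (@complexI R); rewrite gE (Pv_sum nv) weight_sum.
  rewrite big_filter rmorph_sum; apply: eq_bigr => e _.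
  by rewrite rmorphM /= gE lE edge_ratioK.
by move=> e; apply: MBM; [exact: MB_Se | apply: MB_star; exact: MB_Se].
Qed.

End FaithfulWeights.

Theorem proposition3p18 (R : realType) (B : oriented_complex)
  (A1 : graph_cstar R (skeleton B)) (A2 : graph_cstar R (boundary_graph B))
  (T : cstar_tensor A1 A2) :
  (forall (g : vert (skeleton B) -> R) (lamt lam : edge (skeleton B) -> R)
      (eta : face B -> R),
    rank2_weight g lamt lam eta ->
    nowhere_zero g -> nowhere_zero lamt -> nowhere_zero lam -> nowhere_zero eta ->
    exists psi : T -> R[i],
      [/\ is_weight psi /\ monomial_formula g lamt lam eta psi,
          forall psi' : T -> R[i],
            is_weight psi' -> monomial_formula g lamt lam eta psi' ->
            forall x, MB x -> psi' x = psi x,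
          gauge_invariant psi,
          exists sig : R -> T -> T, weight_evolution lamt eta sig &
          forall sig : R -> T -> T, weight_evolution lamt eta sig -> kms sig psi]) /\
  (forall psi : T -> R[i],
    is_weight psi -> faithful psi -> gauge_invariant psi ->
    (forall (f : face B) (i j : 'I_(flen f)),
      face_ratio psi i = face_ratio psi j) ->
    exists (g : vert (skeleton B) -> R) (lamt lam : edge (skeleton B) -> R)
        (eta : face B -> R),
      [/\ forall v, (g v)%:C = psi (Pv T v),
          forall e, (lamt e)%:C =
            psi (Se T e ∗ (Se T e)^†) / psi ((Se T e)^† ∗ Se T e),
          forall e, (lam e)%:C = psi (Pe T e),
          forall (f : face B) (i : 'I_(flen f)),
            (eta f)%:C = face_ratio psi i &
          rank2_weight g lamt lam eta /\
          [/\ nowhere_zero g, nowhere_zero lamt, nowhere_zero lam &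
              nowhere_zero eta]]).
Proof.
split=> [g lamt lam eta rw _ lt0 _ et0|psi pw pf _]; last first.
  exact: faithful_rank2_weight.
have [[_ l0 _] e0 _] := rw.
have lp e : 0 < lamt e by rewrite lt_neqAle eq_sym lt0 l0.
have ep f : 0 < eta f by rewrite lt_neqAle eq_sym et0 e0.
exists (psi g lamt lam eta); split.
- by split; [exact: psi_weight | exact: psi_formula].
- by move=> psi'; exact: psi_unique.
- exact: psi_gauge_invariant.
- exact: weight_evolution_ex.
- by move=> sig; exact: psi_kms.
Qed.
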